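(* Let $b>0$, let $f:[0,+\infty)\to\mathbb{R}$ be a function, and let $u$ be a function with $u\in C^2(\overline{\Sigma_c})$ for every $0<c<2b$ which is a solution to $$\begin{cases}-\Delta u=f(u) & \text{in } \Sigma_{2b},\\ u>0 & \text{in } \Sigma_{2b},\\ u=0 & \text{on } \{y=0\}.\end{cases}$$ Assume that $f$ is continuous on $[0,+\infty)$ and locally Lipschitz continuous from above, and that either (i) $f(0)=0$ and $f$ satisfies the one-sided Osgood condition at every $\bar t\in[0,+\infty)$; or (ii) $f(0)\neq 0$ and $f$ satisfies the one-sided Osgood condition at every $\bar t\in(0,+\infty)$. Then $\dfrac{\partial u}{\partial y}>0$ in $\Sigma_b$. If, in addition, $u\in C^2(\overline{\Sigma_{2b}})$ and $u=0$ on $\partial\Sigma_{2b}$, then $u$ is symmetric about $\{y=b\}$, i.e. $u(x,y)=u(x,2b-y)$ for all $(x,y)\in\Sigma_{2b}$.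
   Context: For $\lambda>0$, $\Sigma_\lambda=\{(x,y)\in\mathbb{R}^2: 0<y<\lambda\}$. A function $f:[0,+\infty)\to\mathbb{R}$ is *locally Lipschitz continuous from above* if for every $b'>0$ there is $L_{b'}>0$ such that $f(u)-f(v)\le L_{b'}(u-v)$ for all $0\le v\le u\le b'$. $f$ satisfies the *one-sided Osgood condition at* $\bar t\in[0,+\infty)$ if there exist $\delta=\delta(\bar t)>0$ and a continuous function $g:[0,\delta]\to\mathbb{R}$ with $g(0)=0$ such that $f(s)-f(t)\le g(t-s)$ for all $s\le t$ with $s,t\in[\bar t-\frac{\delta}{2},\bar t+\frac{\delta}{2}]\cap[0,+\infty)$, and such that either $g$ vanishes identically on $[0,\delta]$, or $g$ is positive on $(0,\delta]$, non-decreasing on $[0,\delta]$, and $\int_0^\delta \frac{ds}{\sqrt{G(s)}}=\infty$, where $G(s)=\int_0^s g(t)\,dt$. *)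

(* Defs.v *)
From Stdlib Require Import Reals Lra.
From Coquelicot Require Import Coquelicot.
Open Scope R_scope.

Definition closure (D : R * R -> Prop) (p : R * R) : Prop :=
  forall P : R * R -> Prop, locally p P -> exists q, D q /\ P q.

Definition boundary (D : R * R -> Prop) (p : R * R) : Prop :=
  closure D p /\ closure (fun q => ~ D q) p.

Definition strip (lam : R) (p : R * R) : Prop := 0 < snd p < lam.

(* For an open set D, [C2_closure D u] says that u is twice continuously
   differentiable in D and that u and all its partial derivatives of order at
   most 2 extend continuously to the closure of D.  The extension of u is u
   itself, so its boundary values are meaningful.  No boundedness or uniform
   continuity is required when D is unbounded.  Values of u outside the closure
   of D play no role. *)
Definition C2_closure (D : R * R -> Prop) (u : R -> R -> R) : Prop :=
  (forall x y, D (x, y) -> ex_diff_n u 2 x y) /\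
  continuous_on (closure D) (fun p => u (fst p) (snd p)) /\
  (forall m k : nat, (m + k <= 2)%nat ->
     exists w : R * R -> R,
       continuous_on (closure D) w /\
       forall x y, D (x, y) -> w (x, y) = partial_derive m k u x y).

Definition laplacian (u : R -> R -> R) (x y : R) : R :=
  partial_derive 2 0 u x y + partial_derive 0 2 u x y.

Definition locally_lipschitz_from_above (f : R -> R) : Prop :=
  forall b' : R, 0 < b' ->
    exists L : R, 0 < L /\
      forall u v : R, 0 <= v -> v <= u -> u <= b' -> f u - f v <= L * (u - v).

(* The integral of 1/sqrt G over (0, delta] is improper at 0, where G vanishes. *)
Definition one_sided_osgood (f : R -> R) (tbar : R) : Prop :=
  exists (delta : R) (g : R -> R),
    0 < delta /\
    continuous_on (fun s => 0 <= s <= delta) g /\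
    g 0 = 0 /\
    (forall s t : R, s <= t ->
       0 <= s -> tbar - delta / 2 <= s <= tbar + delta / 2 ->
       0 <= t -> tbar - delta / 2 <= t <= tbar + delta / 2 ->
       f s - f t <= g (t - s)) /\
    ((forall s, 0 <= s <= delta -> g s = 0) \/
     ((forall s, 0 < s <= delta -> 0 < g s) /\
      (forall s t, 0 <= s -> s <= t -> t <= delta -> g s <= g t) /\
      filterlim (fun e => RInt (fun s => / sqrt (RInt g 0 s)) e delta)
        (at_right 0) (Rbar_locally p_infty))).

Lemma locally_snd (p : R * R) (e : R) :
  0 < e -> locally p (fun q => Rabs (snd q - snd p) < e).
Proof. intros He; exists (mkposreal e He); intros q [_ Hq]; exact Hq. Qed.

Lemma locally_vertical (p : R * R) (P : R * R -> Prop) :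
  locally p P ->
  exists e, 0 < e /\ forall y, Rabs (y - snd p) < e -> P (fst p, y).
Proof.
intros [[e He] H]; exists e; split; [exact He |].
intros y Hy; apply H; split; [apply ball_center | exact Hy].
Qed.

Lemma closure_strip (lam : R) (p : R * R) :
  0 < lam -> closure (strip lam) p <-> 0 <= snd p <= lam.
Proof.
intros Hl; split.
- intros H; split; apply Rnot_lt_le; intros Hp.
  + destruct (H _ (locally_snd p (- snd p) ltac:(lra))) as [q [[Hq1 Hq2] Hq]].
    apply Rabs_def2 in Hq; simpl in *; lra.
  + destruct (H _ (locally_snd p (snd p - lam) ltac:(lra)))
      as [q [[Hq1 Hq2] Hq]].
    apply Rabs_def2 in Hq; simpl in *; lra.
- intros Hp P HP; destruct (locally_vertical p P HP) as [e [He H]].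
  pose proof (Rmin_l (e / 2) (lam / 4)); pose proof (Rmin_r (e / 2) (lam / 4)).
  assert (0 < Rmin (e / 2) (lam / 4)) by (apply Rmin_glb_lt; lra).
  set (d := Rmin (e / 2) (lam / 4)) in *.
  destruct (Rle_lt_dec (snd p) (lam / 2)).
  + exists (fst p, snd p + d); split; [unfold strip; simpl; lra |].
    apply H; apply Rabs_def1; lra.
  + exists (fst p, snd p - d); split; [unfold strip; simpl; lra |].
    apply H; apply Rabs_def1; lra.
Qed.

Lemma boundary_strip (lam : R) (p : R * R) :
  0 < lam -> boundary (strip lam) p <-> snd p = 0 \/ snd p = lam.
Proof.
intros Hl; unfold boundary; rewrite (closure_strip lam p Hl); split.
- intros [Hp H].
  destruct (Req_dec (snd p) 0) as [|H0]; [now left |].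
  destruct (Req_dec (snd p) lam) as [|H1]; [now right |].
  exfalso.
  pose proof (Rmin_l (snd p) (lam - snd p)).
  pose proof (Rmin_r (snd p) (lam - snd p)).
  assert (Hd : 0 < Rmin (snd p) (lam - snd p)) by (apply Rmin_glb_lt; lra).
  destruct (H _ (locally_snd p _ Hd)) as [q [Hq1 Hq2]].
  apply Hq1; apply Rabs_def2 in Hq2; unfold strip; simpl in *; lra.
- intros Hp; split; [lra |].
  intros P HP; exists p; split; [unfold strip; lra | exact (locally_singleton _ _ HP)].
Qed.

(* Main.v *)
Require Import Defs.
From Stdlib Require Import Reals Lra Lia ClassicalEpsilon.
From Coquelicot Require Import Coquelicot.
Open Scope R_scope.

(* The solution may be unbounded in x, so planes are moved inside triangles instead of strips.
   Reflect u across the line m x + y = s with m > 0 small and fixed: as s increases from 0 the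
   triangle cut off by this line, {x = 0} and {y = 0} stays bounded, and u lies below its
   reflection there as long as it does so on the side {x = 0}.  That persists in s because the
   weak maximum principle holds near the sides (f is Lipschitz from above) and the strong one
   holds inside (Osgood condition, through Vazquez' barrier psi'' = g psi).  Letting m -> 0, and
   using the mirror image of u for x < 0, gives u(x, y) <= u(x, 2 s - y).  The side condition on
   {x = 0} only involves a compact range of parameters and follows by compactness, from
   monotonicity up to s, slightly beyond s; near y = 0 it comes from Hopf's lemma when f 0 >= 0
   and from u_yy = - f 0 > 0 at critical boundary points when f 0 < 0. *)

(** * Compactness in the plane *)

(** The two one-sided conditions on [f] serve opposite signs of the difference between u and its
    reflection u'. Where u > u', the Lipschitz bound gives - lap (u - u') <= L (u - u'), which a
    weak maximum principle absorbs near the sides of the triangle. Where u <= u', the information is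
    f u - f u' <= g (u' - u), that is lap (u' - u) <= g (u' - u). As g need not be linear, Hopf's
    lemma has to be rebuilt on a nonlinear barrier: divergence of the Osgood integral lets a
    solution of psi'' = g psi leave 0 with positive slope and still stay below a prescribed height
    for a prescribed time. In the interior both functions are positive, so contact happens at a
    positive value, where the Osgood condition holds in both alternatives; the value 0 matters only
    on the edge y = 0. The slope m cannot be sent to 0 before sliding, because the triangle then
    becomes unbounded. Hence the side condition is wanted for all small m > 0 at once, including
    lines whose mirror image of a point of the side lies arbitrarily close to that point. *)

Lemma choose_fun {I : Type} (A : Type) (P : I -> A -> Prop) :
  (forall n, exists a, P n a) -> exists s : I -> A, forall n, P n (s n).
Proof.
intros H.
exists (fun n => proj1_sig (constructive_indefinite_description _ (H n))).
intros n; exact (proj2_sig (constructive_indefinite_description _ (H n))).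
Qed.

Lemma lim_seq_eps (x : nat -> R) (l : R) :
  is_lim_seq x l <->
  forall eps, 0 < eps -> exists N, forall n, (N <= n)%nat -> Rabs (x n - l) < eps.
Proof.
rewrite <- is_lim_seq_spec; split.
- intros H eps He; destruct (H (mkposreal eps He)) as [N HN]; exists N; exact HN.
- intros H eps; destruct (H eps (cond_pos eps)) as [N HN]; exists N; exact HN.
Qed.

Lemma inv_nat_lim : is_lim_seq (fun n => / (INR n + 1)) 0.
Proof.
apply is_lim_seq_ext with (fun n => / INR (S n)).
- intros n; now rewrite S_INR.
- apply (is_lim_seq_incr_1 (fun n => / INR n)).
  replace (Finite 0) with (Rbar_inv p_infty) by reflexivity.
  apply is_lim_seq_inv; [apply is_lim_seq_INR | discriminate].
Qed.

Lemma inv_nat_pos (n : nat) : 0 < / (INR n + 1).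
Proof. apply Rinv_0_lt_compat; pose proof (pos_INR n); lra. Qed.

Lemma is_lim_seq_mul (u v : nat -> R) (a b : R) :
  is_lim_seq u a -> is_lim_seq v b -> is_lim_seq (fun n => u n * v n) (a * b).
Proof. intros Hu Hv; exact (is_lim_seq_mult' u v a b Hu Hv). Qed.

Lemma scaled_inv_nat (a : R) (n : nat) : 0 < a -> 0 < a * / (INR n + 1) <= a.
Proof.
intros Ha; pose proof (inv_nat_pos n); split; [apply Rmult_lt_0_compat; lra |].
rewrite <- (Rmult_1_r a) at 2; apply Rmult_le_compat_l; [lra |].
rewrite <- Rinv_1; apply Rinv_le_contravar; pose proof (pos_INR n); lra.
Qed.

Lemma scaled_inv_lim (a : R) : is_lim_seq (fun n => a * / (INR n + 1)) 0.
Proof.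
replace 0 with (a * 0) by ring; apply is_lim_seq_mul; [apply is_lim_seq_const | apply inv_nat_lim].
Qed.

Lemma lim_subseq (x : nat -> R) (l : R) (phi : nat -> nat) :
  (forall n, (n <= phi n)%nat) -> is_lim_seq x l -> is_lim_seq (fun n => x (phi n)) l.
Proof.
intros Hphi H; apply is_lim_seq_subseq; [| exact H].
intros P [N HN]; exists N; intros n Hn; apply HN; specialize (Hphi n); lia.
Qed.

Lemma lim_dist_inv (x : nat -> R) (l : R) :
  (forall n, Rabs (x n - l) < / (INR n + 1)) -> is_lim_seq x l.
Proof.
intros H; apply lim_seq_eps; intros eps He.
destruct (proj1 (lim_seq_eps _ _) inv_nat_lim eps He) as [N HN]; exists N; intros n Hn.
specialize (HN n Hn); rewrite Rminus_0_r, Rabs_pos_eq in HN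
  by (apply Rlt_le, inv_nat_pos).
specialize (H n); lra.
Qed.

Lemma lim_le (x y : nat -> R) (a b : R) :
  (forall n, x n <= y n) -> is_lim_seq x a -> is_lim_seq y b -> a <= b.
Proof. intros H Hx Hy; exact (is_lim_seq_le _ _ _ _ H Hx Hy). Qed.

Lemma lim_between (x : nat -> R) (a b l : R) :
  (forall n, a <= x n <= b) -> is_lim_seq x l -> a <= l <= b.
Proof.
intros H Hx; split.
- apply (lim_le (fun _ => a) x); [apply H | apply is_lim_seq_const | exact Hx].
- apply (lim_le x (fun _ => b)); [apply H | exact Hx | apply is_lim_seq_const].
Qed.

Lemma bolzano_weierstrass (x : nat -> R) (a b : R) :
  (forall n, a <= x n <= b) ->
  exists (phi : nat -> nat) (l : R),
    (forall n, (n <= phi n)%nat) /\ is_lim_seq (fun n => x (phi n)) l.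
Proof.
intros H.
destruct (Bolzano_Weierstrass x (fun t => a <= t <= b) (compact_P3 a b) H) as [l Hl].
destruct (choose_fun nat (fun n p => (n <= p)%nat /\ Rabs (x p - l) < / (INR n + 1)))
  as [phi Hphi].
{ intros n; apply (Hl (fun t => Rabs (t - l) < / (INR n + 1)) n).
  exists (mkposreal _ (inv_nat_pos n)); intros t Ht; exact Ht. }
exists phi, l; split; [apply Hphi |].
apply lim_dist_inv; intros n; apply Hphi.
Qed.

Lemma bolzano_weierstrass_2d (x y : nat -> R) (M : R) :
  (forall n, Rabs (x n) <= M /\ Rabs (y n) <= M) ->
  exists (phi : nat -> nat) (lx ly : R),
    (forall n, (n <= phi n)%nat) /\
    is_lim_seq (fun n => x (phi n)) lx /\ is_lim_seq (fun n => y (phi n)) ly.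
Proof.
intros H.
destruct (bolzano_weierstrass x (- M) M) as [p1 [lx [Hp1 Hx]]].
{ intros n; apply Rabs_le_between, H. }
destruct (bolzano_weierstrass (fun n => y (p1 n)) (- M) M) as [p2 [ly [Hp2 Hy]]].
{ intros n; apply Rabs_le_between, H. }
exists (fun n => p1 (p2 n)), lx, ly; repeat split.
- intros n; specialize (Hp2 n); specialize (Hp1 (p2 n)); lia.
- exact (lim_subseq _ _ p2 Hp2 Hx).
- exact Hy.
Qed.

(** Continuity relative to [K], by sequences inside [K]: values off [K] never enter, so continuity
    up to the edge y = 0 needs no extension, and subsequence arguments apply directly. *)
Definition seqcont (K : R -> R -> Prop) (F : R -> R -> R) : Prop :=
  forall (xn yn : nat -> R) (x y : R),
    (forall n, K (xn n) (yn n)) -> K x y ->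
    is_lim_seq xn x -> is_lim_seq yn y ->
    is_lim_seq (fun n => F (xn n) (yn n)) (F x y).

Definition bounded2 (K : R -> R -> Prop) : Prop :=
  exists M, forall x y, K x y -> Rabs x <= M /\ Rabs y <= M.

Definition seqclosed (K : R -> R -> Prop) : Prop :=
  forall (xn yn : nat -> R) (x y : R),
    (forall n, K (xn n) (yn n)) ->
    is_lim_seq xn x -> is_lim_seq yn y -> K x y.

(** Shared by the boundedness half and the attainment half of [extreme_value]. *)
Lemma compact_subseq (K : R -> R -> Prop) (F : R -> R -> R) (p : nat -> R * R) :
  bounded2 K -> seqclosed K -> seqcont K F ->
  (forall n, K (fst (p n)) (snd (p n))) ->
  exists (phi : nat -> nat) (x y : R), (forall n, (n <= phi n)%nat) /\ K x y /\
    is_lim_seq (fun n => F (fst (p (phi n))) (snd (p (phi n)))) (F x y).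
Proof.
intros [M HM] Hcl HF Hp.
destruct (bolzano_weierstrass_2d (fun n => fst (p n)) (fun n => snd (p n)) M)
  as [phi [x [y [Hphi [Hx Hy]]]]].
{ intros n; apply HM, Hp. }
assert (K x y) by (apply (Hcl _ _ x y (fun n => Hp (phi n)) Hx Hy)).
exists phi, x, y; repeat split; auto.
Qed.

Lemma extreme_value (K : R -> R -> Prop) (F : R -> R -> R) :
  bounded2 K -> seqclosed K -> seqcont K F -> (exists x y, K x y) ->
  exists x y, K x y /\ forall x' y', K x' y' -> F x' y' <= F x y.
Proof.
intros HK Hcl HF [x0 [y0 H0]].
destruct (completeness (fun z => exists x y, K x y /\ z = F x y)) as [M [HM1 HM2]].
- apply NNPP; intros Hn.
  destruct (choose_fun (R * R) (fun n p => K (fst p) (snd p) /\ INR n < F (fst p) (snd p)))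
    as [p Hp].
  { intros n; apply NNPP; intros Hc; apply Hn; exists (INR n).
    intros z [x [y [Hxy ->]]]; apply Rnot_lt_le; intros Hlt; apply Hc.
    exists (x, y); split; assumption. }
  destruct (compact_subseq K F p HK Hcl HF (fun n => proj1 (Hp n)))
    as [phi [x [y [Hphi [_ Hl]]]]].
  destruct (proj1 (lim_seq_eps _ _) Hl 1 Rlt_0_1) as [N HN].
  destruct (INR_unbounded (F x y + 1)) as [N' HN'].
  specialize (HN (max N N') (Nat.le_max_l _ _)); apply Rabs_def2 in HN.
  pose proof (proj2 (Hp (phi (max N N')))).
  assert (INR N' <= INR (phi (max N N'))).
  { apply le_INR; specialize (Hphi (max N N')); lia. }
  lra.
- exists (F x0 y0), x0, y0; auto.
- destruct (choose_fun (R * R)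
    (fun n p => K (fst p) (snd p) /\ M - / (INR n + 1) < F (fst p) (snd p))) as [p Hp].
  { intros n; apply NNPP; intros Hc.
    assert (M <= M - / (INR n + 1)); [| pose proof (inv_nat_pos n); lra].
    apply HM2; intros z [x [y [Hxy ->]]]; apply Rnot_lt_le; intros Hlt; apply Hc.
    exists (x, y); split; assumption. }
  destruct (compact_subseq K F p HK Hcl HF (fun n => proj1 (Hp n)))
    as [phi [x [y [Hphi [Hxy Hl]]]]].
  exists x, y; split; [exact Hxy |]; intros x' y' H'.
  apply Rle_trans with M; [apply HM1; exists x', y'; auto |].
  apply (lim_le (fun n => M - / (INR (phi n) + 1))
                (fun n => F (fst (p (phi n))) (snd (p (phi n))))); [| | exact Hl].
  + intros n; apply Rlt_le, Hp.
  + replace (Finite M) with (Finite (M - 0)) by (f_equal; ring).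
    apply is_lim_seq_minus'; [apply is_lim_seq_const |].
    exact (lim_subseq _ _ phi Hphi inv_nat_lim).
Qed.

Lemma extreme_value_min (K : R -> R -> Prop) (F : R -> R -> R) :
  bounded2 K -> seqclosed K -> seqcont K F -> (exists x y, K x y) ->
  exists x y, K x y /\ forall x' y', K x' y' -> F x y <= F x' y'.
Proof.
intros HK Hcl HF H0.
destruct (extreme_value K (fun x y => - F x y) HK Hcl) as [x [y [Hxy H]]]; auto.
- intros xn yn x y Hn Hxy Hx Hy.
  apply (is_lim_seq_opp _ (F x y)), HF; auto.
- exists x, y; split; [exact Hxy |]; intros x' y' H'; specialize (H x' y' H'); lra.
Qed.

Lemma seqcont_eps (K : R -> R -> Prop) (F : R -> R -> R) (x y : R) :
  seqcont K F -> K x y -> forall eps, 0 < eps -> exists d, 0 < d /\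
    forall x' y', K x' y' -> Rabs (x' - x) < d -> Rabs (y' - y) < d ->
      Rabs (F x' y' - F x y) < eps.
Proof.
intros HF Hxy eps He; apply NNPP; intros Hn.
destruct (choose_fun (R * R) (fun n p => K (fst p) (snd p) /\
  Rabs (fst p - x) < / (INR n + 1) /\ Rabs (snd p - y) < / (INR n + 1) /\
  eps <= Rabs (F (fst p) (snd p) - F x y))) as [p Hp].
{ intros n; apply NNPP; intros Hc; apply Hn; exists (/ (INR n + 1)).
  split; [apply inv_nat_pos |]; intros x' y' HK Hx' Hy'.
  apply Rnot_le_lt; intros Hle; apply Hc; exists (x', y'); auto. }
assert (H : is_lim_seq (fun n => F (fst (p n)) (snd (p n))) (F x y)).
{ apply HF; auto; try (apply lim_dist_inv); intros n; apply Hp. }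
destruct (proj1 (lim_seq_eps _ _) H eps He) as [N HN].
specialize (HN N (Nat.le_refl N)); destruct (Hp N) as [_ [_ [_ ?]]]; lra.
Qed.

Lemma eps_seqcont (K : R -> R -> Prop) (F : R -> R -> R) :
  (forall x y, K x y -> forall eps, 0 < eps -> exists d, 0 < d /\
    forall x' y', K x' y' -> Rabs (x' - x) < d -> Rabs (y' - y) < d ->
      Rabs (F x' y' - F x y) < eps) -> seqcont K F.
Proof.
intros H xn yn x y Hn Hxy Hx Hy; apply lim_seq_eps; intros eps He.
destruct (H x y Hxy eps He) as [d [Hd Hd']].
destruct (proj1 (lim_seq_eps _ _) Hx d Hd) as [N1 HN1].
destruct (proj1 (lim_seq_eps _ _) Hy d Hd) as [N2 HN2].
exists (max N1 N2); intros n Hnn; apply Hd'; auto; [apply HN1 | apply HN2]; lia.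
Qed.

Lemma seqcont_sub (K K' : R -> R -> Prop) (F : R -> R -> R) :
  (forall x y, K' x y -> K x y) -> seqcont K F -> seqcont K' F.
Proof. intros H HF xn yn x y Hn Hxy; apply HF; auto. Qed.

(** * A frame-free pointwise Laplacian *)

Lemma mvt_le (f df : R -> R) (a b : R) :
  a <= b -> (forall t, a <= t <= b -> is_derive f t (df t)) ->
  exists c, a <= c <= b /\ f b - f a = df c * (b - a).
Proof.
intros Hab H; destruct (MVT_gen f a b df) as [c [Hc Heq]].
- intros t; rewrite Rmin_left, Rmax_right by lra; intros Ht; apply H; lra.
- intros t; rewrite Rmin_left, Rmax_right by lra; intros Ht.
  apply derivable_continuous_pt; exists (df t); apply is_derive_Reals, H; lra.
- rewrite Rmin_left, Rmax_right in Hc by lra; exists c; auto.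
Qed.

Lemma mvt_between (f df : R -> R) (a b : R) :
  (forall t, Rmin a b <= t <= Rmax a b -> is_derive f t (df t)) ->
  exists c, Rmin a b <= c <= Rmax a b /\ f b - f a = df c * (b - a).
Proof.
intros H; destruct (Rle_lt_dec a b) as [Hab|Hab].
- rewrite Rmin_left, Rmax_right in * by lra; exact (mvt_le f df a b Hab H).
- rewrite Rmin_right, Rmax_left in * by lra.
  destruct (mvt_le f df b a ltac:(lra) H) as [c [Hc Heq]]; exists c; split; [exact Hc | lra].
Qed.

Definition star (v : R -> R -> R) (x y e1 e2 : R) : R :=
  v (x + e1) (y + e2) + v (x - e1) (y - e2) + v (x - e2) (y + e1) + v (x + e2) (y - e1)
  - 4 * v x y.

(* The symmetric difference is taken along every orthogonal frame (e1,e2), (-e2,e1); this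
   makes the notion invariant under isometries, with no chain rule for second derivatives. *)
Definition lap (v : R -> R -> R) (x y l : R) : Prop :=
  forall eps, 0 < eps -> exists r, 0 < r /\
    forall e1 e2, Rabs e1 < r -> Rabs e2 < r ->
      Rabs (star v x y e1 e2 - (e1 ^ 2 + e2 ^ 2) * l) <= eps * (e1 ^ 2 + e2 ^ 2).

Lemma lap_lin (v w : R -> R -> R) (x y a c l m : R) :
  lap v x y l -> lap w x y m ->
  lap (fun s t => a * v s t + c * w s t) x y (a * l + c * m).
Proof.
intros Hv Hw eps He.
assert (Hp : 0 < Rabs a + Rabs c + 1) by (pose proof (Rabs_pos a); pose proof (Rabs_pos c); lra).
destruct (Hv (eps / (Rabs a + Rabs c + 1))) as [r1 [Hr1 H1]]; [now apply Rdiv_lt_0_compat |].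
destruct (Hw (eps / (Rabs a + Rabs c + 1))) as [r2 [Hr2 H2]]; [now apply Rdiv_lt_0_compat |].
exists (Rmin r1 r2); split; [now apply Rmin_glb_lt |]; intros e1 e2 He1 He2.
pose proof (Rmin_l r1 r2); pose proof (Rmin_r r1 r2).
specialize (H1 e1 e2 ltac:(lra) ltac:(lra)); specialize (H2 e1 e2 ltac:(lra) ltac:(lra)).
set (q := eps / (Rabs a + Rabs c + 1)) in *.
replace (star (fun s t => a * v s t + c * w s t) x y e1 e2 - (e1 ^ 2 + e2 ^ 2) * (a * l + c * m))
  with (a * (star v x y e1 e2 - (e1 ^ 2 + e2 ^ 2) * l)
      + c * (star w x y e1 e2 - (e1 ^ 2 + e2 ^ 2) * m)) by (unfold star; ring).
eapply Rle_trans; [apply Rabs_triang |]; rewrite !Rabs_mult.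
assert (Hq : eps = q * (Rabs a + Rabs c + 1)) by (unfold q; field; lra).
assert (0 <= q) by (unfold q; apply Rlt_le, Rdiv_lt_0_compat; lra).
assert (0 <= e1 ^ 2 + e2 ^ 2) by (pose proof (pow2_ge_0 e1); pose proof (pow2_ge_0 e2); lra).
apply Rle_trans with (Rabs a * (q * (e1 ^ 2 + e2 ^ 2)) + Rabs c * (q * (e1 ^ 2 + e2 ^ 2))).
- apply Rplus_le_compat; apply Rmult_le_compat_l; auto using Rabs_pos.
- rewrite Hq; assert (0 <= q * (e1 ^ 2 + e2 ^ 2)) by (apply Rmult_le_pos; lra).
  lra.
Qed.

Lemma lap_sub (v w : R -> R -> R) (x y l m : R) :
  lap v x y l -> lap w x y m -> lap (fun s t => v s t - w s t) x y (l - m).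
Proof.
intros Hv Hw; generalize (lap_lin v w x y 1 (-1) l m Hv Hw).
unfold lap, star; intros H eps He; destruct (H eps He) as [r [Hr Hr']].
exists r; split; [exact Hr |]; intros e1 e2 H1 H2; specialize (Hr' e1 e2 H1 H2).
match goal with |- Rabs ?A <= _ => match type of Hr' with Rabs ?B <= _ =>
  replace A with B by ring end end; exact Hr'.
Qed.

(** At a maximum the star is nonpositive, whereas l > 0 with eps = l / 2 would make it at least e^2
    l / 2. *)
Lemma lap_max (v : R -> R -> R) (x y l r : R) :
  0 < r -> (forall x' y', Rabs (x' - x) < r -> Rabs (y' - y) < r -> v x' y' <= v x y) ->
  lap v x y l -> l <= 0.
Proof.
intros Hr Hmax Hl; apply Rnot_lt_le; intros Hpos.
destruct (Hl (l / 2) ltac:(lra)) as [r' [Hr' H]].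
set (e := Rmin r r' / 2).
assert (0 < e /\ e < r /\ e < r').
{ assert (0 < Rmin r r') by now apply Rmin_glb_lt.
  pose proof (Rmin_l r r'); pose proof (Rmin_r r r'); unfold e; lra. }
specialize (H e 0); rewrite Rabs_R0, Rabs_pos_eq in H by lra.
specialize (H ltac:(lra) ltac:(lra)).
assert (star v x y e 0 <= 0).
{ unfold star; rewrite !Rplus_0_r, !Rminus_0_r.
  assert (v (x + e) y <= v x y) by
    (apply Hmax; [replace (x + e - x) with e by ring | rewrite Rminus_diag]; rewrite ?Rabs_R0, ?Rabs_pos_eq; lra).
  assert (v (x - e) y <= v x y) by
    (apply Hmax; [replace (x - e - x) with (- e) by ring | rewrite Rminus_diag];
     rewrite ?Rabs_R0, ?Rabs_Ropp, ?Rabs_pos_eq; lra).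
  assert (v x (y + e) <= v x y) by
    (apply Hmax; [rewrite Rminus_diag | replace (y + e - y) with e by ring]; rewrite ?Rabs_R0, ?Rabs_pos_eq; lra).
  assert (v x (y - e) <= v x y) by
    (apply Hmax; [rewrite Rminus_diag | replace (y - e - y) with (- e) by ring];
     rewrite ?Rabs_R0, ?Rabs_Ropp, ?Rabs_pos_eq; lra).
  lra. }
apply Rabs_le_between in H; assert (0 < e ^ 2) by (apply pow_lt; lra).
assert (0 < e ^ 2 * l) by (apply Rmult_lt_0_compat; lra).
lra.
Qed.

Lemma lap_ext_loc (v w : R -> R -> R) (x y l r : R) :
  0 < r -> (forall x' y', Rabs (x' - x) < r -> Rabs (y' - y) < r -> v x' y' = w x' y') ->
  lap v x y l -> lap w x y l.
Proof.
intros Hr Heq Hl eps He; destruct (Hl eps He) as [r' [Hr' H]].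
exists (Rmin r r'); split; [now apply Rmin_glb_lt |]; intros e1 e2 He1 He2.
pose proof (Rmin_l r r'); pose proof (Rmin_r r r').
specialize (H e1 e2 ltac:(lra) ltac:(lra)).
assert (Hs : star w x y e1 e2 = star v x y e1 e2); [| rewrite Hs; exact H].
apply Rabs_lt_between in He1, He2.
unfold star; rewrite !Heq; auto; apply Rabs_def1; lra.
Qed.

(** The matrix with rows (A, B) and (B, -A) is a reflection. It carries an orthogonal frame to an
    orthogonal frame of the same length, so the star of the composite is a star of [u] at the image
    point, with the same four points in another order. *)
Lemma lap_isom (u : R -> R -> R) (A B c d x y l : R) :
  A ^ 2 + B ^ 2 = 1 ->
  lap u (A * x + B * y + c) (B * x - A * y + d) l ->
  lap (fun s t => u (A * s + B * t + c) (B * s - A * t + d)) x y l.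
Proof.
intros HAB Hl eps He; destruct (Hl eps He) as [r [Hr H]].
(* Half the radius, since |A e1 + B e2| <= |e1| + |e2|. *)
exists (r / 2); split; [lra |]; intros e1 e2 He1 He2.
assert (HA : Rabs A <= 1) by (apply Rabs_le; nra).
assert (HB : Rabs B <= 1) by (apply Rabs_le; nra).
assert (Hin : forall a b, Rabs a <= 1 -> Rabs b <= 1 -> Rabs (a * e1 + b * e2) < r).
{ intros a b Ha Hb; eapply Rle_lt_trans; [apply Rabs_triang |]; rewrite !Rabs_mult.
  pose proof (Rabs_pos e1); pose proof (Rabs_pos e2); nra. }
specialize (H (A * e1 + B * e2) (B * e1 + - A * e2)).
specialize (H (Hin A B HA HB)).
specialize (H (Hin B (- A) HB ltac:(rewrite Rabs_Ropp; exact HA))).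
replace ((A * e1 + B * e2) ^ 2 + (B * e1 + - A * e2) ^ 2) with (e1 ^ 2 + e2 ^ 2) in H
  by (transitivity ((A ^ 2 + B ^ 2) * (e1 ^ 2 + e2 ^ 2)); [rewrite HAB; ring | ring]).
assert (Hs : star (fun s t => u (A * s + B * t + c) (B * s - A * t + d)) x y e1 e2
  = star u (A * x + B * y + c) (B * x - A * y + d) (A * e1 + B * e2) (B * e1 + - A * e2)).
{ unfold star.
  replace (A * (x + e1) + B * (y + e2) + c) with (A * x + B * y + c + (A * e1 + B * e2)) by ring.
  replace (B * (x + e1) - A * (y + e2) + d) with (B * x - A * y + d + (B * e1 + - A * e2)) by ring.
  replace (A * (x - e1) + B * (y - e2) + c) with (A * x + B * y + c - (A * e1 + B * e2)) by ring.
  replace (B * (x - e1) - A * (y - e2) + d) with (B * x - A * y + d - (B * e1 + - A * e2)) by ring.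
  replace (A * (x - e2) + B * (y + e1) + c) with (A * x + B * y + c + (B * e1 + - A * e2)) by ring.
  replace (B * (x - e2) - A * (y + e1) + d) with (B * x - A * y + d - (A * e1 + B * e2)) by ring.
  replace (A * (x + e2) + B * (y - e1) + c) with (A * x + B * y + c - (B * e1 + - A * e2)) by ring.
  replace (B * (x + e2) - A * (y - e1) + d) with (B * x - A * y + d + (A * e1 + B * e2)) by ring.
  ring. }
rewrite Hs; exact H.
Qed.

Lemma is_derive_eps (f : R -> R) (t l : R) :
  is_derive f t l -> forall eps, 0 < eps -> exists d, 0 < d /\
    forall h, Rabs h < d -> Rabs (f (t + h) - f t - l * h) <= eps * Rabs h.
Proof.
intros H eps He; apply is_derive_Reals in H; destruct (H eps He) as [d Hd].
exists d; split; [apply cond_pos |]; intros h Hh.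
destruct (Req_dec h 0) as [->|Hn].
- rewrite Rplus_0_r, Rmult_0_r, Rabs_R0, Rminus_diag, Rminus_0_r, Rabs_R0; lra.
- specialize (Hd h Hn Hh).
  replace (f (t + h) - f t - l * h) with (((f (t + h) - f t) / h - l) * h) by (field; exact Hn).
  rewrite Rabs_mult; apply Rmult_le_compat_r; [apply Rabs_pos | lra].
Qed.

(** Peano form, with [f1] differentiable at the single point [t]: the mean value theorem is applied
    to the remainder, whose derivative is the first-order remainder of [f1] at [t]. *)
Lemma taylor2 (f f1 : R -> R) (t f2 r : R) :
  0 < r -> (forall s, Rabs (s - t) < r -> is_derive f s (f1 s)) -> is_derive f1 t f2 ->
  forall eps, 0 < eps -> exists d, 0 < d /\
    forall h, Rabs h < d ->
      Rabs (f (t + h) - f t - f1 t * h - f2 / 2 * h ^ 2) <= eps * h ^ 2.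
Proof.
intros Hr H1 H2 eps He; destruct (is_derive_eps f1 t f2 H2 eps He) as [d [Hd Hd']].
exists (Rmin r d); split; [now apply Rmin_glb_lt |]; intros h Hh.
pose proof (Rmin_l r d); pose proof (Rmin_r r d).
destruct (mvt_between (fun s => f (t + s) - f1 t * s - f2 / 2 * s ^ 2)
  (fun s => f1 (t + s) - f1 t - f2 * s) 0 h) as [c [Hc Heq]].
- intros s Hs.
  assert (Rabs s <= Rabs h).
  { unfold Rmin, Rmax in Hs; destruct (Rle_dec 0 h); [rewrite !Rabs_pos_eq | rewrite !Rabs_left1]; lra. }
  assert (Hf : is_derive f (t + s) (f1 (t + s)))
    by (apply H1; replace (t + s - t) with s by ring; lra).
  auto_derive; [exists (f1 (t + s)); exact Hf |].
  replace (Derive (fun x => f x) (t + s)) with (f1 (t + s))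
    by (symmetry; apply is_derive_unique; exact Hf). field.
- assert (Rabs c <= Rabs h).
  { unfold Rmin, Rmax in Hc; destruct (Rle_dec 0 h); [rewrite !Rabs_pos_eq | rewrite !Rabs_left1]; lra. }
  replace (f (t + h) - f t - f1 t * h - f2 / 2 * h ^ 2)
    with ((f1 (t + c) - f1 t - f2 * c) * (h - 0))
    by (rewrite <- Heq, Rplus_0_r; ring).
  rewrite Rminus_0_r, Rabs_mult; specialize (Hd' c ltac:(lra)).
  replace (eps * h ^ 2) with (eps * Rabs h * Rabs h) by (rewrite <- (pow2_abs h); ring).
  apply Rmult_le_compat_r; [apply Rabs_pos |].
  eapply Rle_trans; [exact Hd' |]; apply Rmult_le_compat_l; lra.
Qed.

(* A function with the expansion assumed of [q] is a linear one (c = 0) or a squared distance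
   (c = 1), the two cases needed for barriers. *)
Lemma lap_comp_quad (q : R -> R -> R) (f f1 : R -> R) (x y a b c f2 r : R) :
  (forall e1 e2, q (x + e1) (y + e2) = q x y + a * e1 + b * e2 + c * (e1 ^ 2 + e2 ^ 2)) ->
  0 < r -> (forall s, Rabs (s - q x y) < r -> is_derive f s (f1 s)) ->
  is_derive f1 (q x y) f2 ->
  lap (fun s t => f (q s t)) x y (4 * c * f1 (q x y) + (a ^ 2 + b ^ 2) * f2).
Proof.
intros Hq Hr Hf Hf1 eps He; set (t := q x y) in *.
(* [N] bounds the sum of the four squared increments of [q] divided by |e|^2, once |e|^2 <= 1; [M]
   controls the part of order |e|^4 of that sum after multiplication by [f2]. Each receives half of
   [eps]. *)
set (N := 2 * (a ^ 2 + b ^ 2) + 4 * c ^ 2 + 1).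
assert (HN : 0 < N) by (unfold N; nra).
set (M := 2 * c ^ 2 * Rabs f2 + 1).
assert (HM : 0 < M) by (unfold M; pose proof (Rabs_pos f2); nra).
destruct (taylor2 f f1 t f2 r Hr Hf Hf1 (eps / 2 / N)) as [d [Hd HT]].
{ apply Rdiv_lt_0_compat; lra. }
set (Q := Rabs a + Rabs b + 2 * Rabs c + 1).
assert (HQ : 0 < Q)
  by (unfold Q; pose proof (Rabs_pos a); pose proof (Rabs_pos b); pose proof (Rabs_pos c); lra).
set (rho := Rmin (1 / 2) (Rmin (d / Q) (eps / 2 / M))).
assert (Hrho : 0 < rho) by (repeat apply Rmin_glb_lt; try lra; repeat apply Rdiv_lt_0_compat; lra).
assert (Hb : rho <= 1 / 2 /\ rho <= d / Q /\ rho <= eps / 2 / M).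
{ unfold rho; repeat split; [apply Rmin_l | |];
  (eapply Rle_trans; [apply Rmin_r |]); [apply Rmin_l | apply Rmin_r]. }
exists rho; split; [exact Hrho |]; intros e1 e2 He1 He2.
destruct Hb as [Hb1 [Hb2 Hb3]].
set (R2 := e1 ^ 2 + e2 ^ 2).
assert (HR2 : 0 <= R2) by (unfold R2; nra).
assert (HR2r : R2 <= rho).
{ unfold R2; rewrite <- (pow2_abs e1), <- (pow2_abs e2).
  pose proof (Rabs_pos e1); pose proof (Rabs_pos e2); nra. }
assert (Hsm : forall A B, Rabs A < rho -> Rabs B < rho -> A ^ 2 + B ^ 2 = R2 ->
   Rabs (a * A + b * B + c * R2) < d).
{ intros A B HA HB HAB.
  apply Rlt_le_trans with (Q * rho).
  - eapply Rle_lt_trans; [apply Rabs_triang |].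
    eapply Rle_lt_trans; [apply Rplus_le_compat_r, Rabs_triang |].
    rewrite !Rabs_mult, (Rabs_pos_eq R2) by lra.
    pose proof (Rabs_pos A); pose proof (Rabs_pos B);
    pose proof (Rabs_pos a); pose proof (Rabs_pos b); pose proof (Rabs_pos c).
    unfold Q; nra.
  - replace d with (Q * (d / Q)) by (field; lra); apply Rmult_le_compat_l; lra. }
assert (Hx : forall A B, q (x + A) (y + B) = t + (a * A + b * B + c * (A ^ 2 + B ^ 2)))
  by (intros A B; rewrite Hq; unfold t; ring).
assert (Hopp : Rabs (- e1) < rho /\ Rabs (- e2) < rho) by (rewrite !Rabs_Ropp; split; assumption).
destruct Hopp as [He1' He2'].
pose proof (HT _ (Hsm e1 e2 He1 He2 eq_refl)) as T1.
pose proof (HT _ (Hsm (- e1) (- e2) He1' He2' ltac:(unfold R2; ring))) as T2.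
pose proof (HT _ (Hsm (- e2) e1 He2' He1 ltac:(unfold R2; ring))) as T3.
pose proof (HT _ (Hsm e2 (- e1) He2 He1' ltac:(unfold R2; ring))) as T4.
unfold star, Rminus; rewrite !Hx.
replace ((- e1) ^ 2 + (- e2) ^ 2) with R2 by (unfold R2; ring).
replace ((- e2) ^ 2 + e1 ^ 2) with R2 by (unfold R2; ring).
replace (e2 ^ 2 + (- e1) ^ 2) with R2 by (unfold R2; ring).
fold R2; fold t.
set (D1 := a * e1 + b * e2 + c * R2) in *.
set (D2 := a * - e1 + b * - e2 + c * R2) in *.
set (D3 := a * - e2 + b * e1 + c * R2) in *.
set (D4 := a * e2 + b * - e1 + c * R2) in *.
(* The linear parts cancel over the star, and the squares add up to twice |grad q|^2 times [R2], up
   to [R2 ^ 2]. These identities produce the two terms of the Laplacian. *)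
assert (HD : D1 + D2 + D3 + D4 = 4 * c * R2) by (unfold D1, D2, D3, D4; ring).
assert (HD2 : D1 ^ 2 + D2 ^ 2 + D3 ^ 2 + D4 ^ 2 = 2 * (a ^ 2 + b ^ 2) * R2 + 4 * c ^ 2 * R2 ^ 2)
  by (unfold D1, D2, D3, D4, R2; ring).
clearbody D1 D2 D3 D4.
match goal with |- Rabs ?A <= _ => replace A with
  ((f (t + D1) - f t - f1 t * D1 - f2 / 2 * D1 ^ 2) +
   (f (t + D2) - f t - f1 t * D2 - f2 / 2 * D2 ^ 2) +
   (f (t + D3) - f t - f1 t * D3 - f2 / 2 * D3 ^ 2) +
   (f (t + D4) - f t - f1 t * D4 - f2 / 2 * D4 ^ 2) +
   f1 t * (D1 + D2 + D3 + D4 - 4 * c * R2) +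
   f2 / 2 * (D1 ^ 2 + D2 ^ 2 + D3 ^ 2 + D4 ^ 2 - 2 * (a ^ 2 + b ^ 2) * R2)) by field end.
rewrite HD, HD2, Rminus_diag, Rmult_0_r, Rplus_0_r.
set (k := eps / 2 / N) in *.
assert (Hk : 0 < k) by (unfold k; repeat apply Rdiv_lt_0_compat; lra).
assert (HkN : k * N = eps / 2) by (unfold k; field; lra).
assert (Hlast : Rabs (f2 / 2 * (2 * (a ^ 2 + b ^ 2) * R2 + 4 * c ^ 2 * R2 ^ 2 - 2 * (a ^ 2 + b ^ 2) * R2))
  <= eps / 2 * R2).
{ replace (f2 / 2 * (2 * (a ^ 2 + b ^ 2) * R2 + 4 * c ^ 2 * R2 ^ 2 - 2 * (a ^ 2 + b ^ 2) * R2))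
    with ((2 * c ^ 2 * f2 * R2) * R2) by field.
  rewrite !Rabs_mult, (Rabs_pos_eq R2), (Rabs_pos_eq 2), (Rabs_pos_eq (c ^ 2)) by nra.
  apply Rmult_le_compat_r; [exact HR2 |].
  apply Rle_trans with (M * (eps / 2 / M)); [| right; field; lra].
  apply Rmult_le_compat; [pose proof (Rabs_pos f2); nra | lra | unfold M; lra | lra]. }
assert (Hsum : k * (D1 ^ 2 + D2 ^ 2 + D3 ^ 2 + D4 ^ 2) <= eps / 2 * R2).
{ rewrite HD2; replace (eps / 2 * R2) with (k * (N * R2)) by (rewrite <- HkN; ring).
  apply Rmult_le_compat_l; [lra |].
  assert (0 <= R2 * (1 - R2)) by (apply Rmult_le_pos; lra).
  unfold N; pose proof (pow2_ge_0 c).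
  assert (0 <= c ^ 2 * (R2 * (1 - R2))) by (apply Rmult_le_pos; lra).
  nra. }
eapply Rle_trans; [apply Rabs_triang |].
eapply Rle_trans; [apply Rplus_le_compat_r, Rabs_triang |].
eapply Rle_trans; [apply Rplus_le_compat_r, Rplus_le_compat_r, Rabs_triang |].
eapply Rle_trans; [apply Rplus_le_compat_r, Rplus_le_compat_r, Rplus_le_compat_r, Rabs_triang |].
lra.
Qed.

(** Two mean value theorems: for f t + f (- t) - m t^2 on [0, 1], which removes the odd part, then
    for [f1] on [- c, c]. *)
Lemma second_difference (f f1 f2 : R -> R) (m eta : R) :
  (forall t, -1 <= t <= 1 -> is_derive f t (f1 t)) ->
  (forall t, -1 <= t <= 1 -> is_derive f1 t (f2 t)) ->
  (forall t, -1 <= t <= 1 -> Rabs (f2 t - m) <= eta) ->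
  Rabs (f 1 + f (-1) - 2 * f 0 - m) <= 2 * eta.
Proof.
intros H1 H2 Heta.
assert (Heta0 : 0 <= eta) by (eapply Rle_trans; [apply Rabs_pos | apply (Heta 0); lra]).
destruct (mvt_le (fun t => f t + f (- t) - m * t ^ 2) (fun t => f1 t - f1 (- t) - 2 * m * t) 0 1)
  as [c [Hc Heq]]; [lra | |].
- intros t Ht.
  pose proof (H1 t ltac:(lra)) as Ha; pose proof (H1 (- t) ltac:(lra)) as Hb.
  auto_derive.
  + repeat split; [exists (f1 t); exact Ha | exists (f1 (- t)); exact Hb].
  + replace (Derive (fun x => f x) t) with (f1 t) by (symmetry; apply is_derive_unique, Ha).
    replace (Derive (fun x => f x) (- t)) with (f1 (- t)) by (symmetry; apply is_derive_unique, Hb).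
    ring.
- destruct (mvt_le f1 f2 (- c) c ltac:(lra)) as [d [Hd Heq']].
  { intros t Ht; apply H2; lra. }
  replace (f 1 + f (-1) - 2 * f 0 - m) with ((f2 d - m) * (2 * c)).
  + rewrite Rabs_mult, (Rabs_pos_eq (2 * c)) by lra.
    specialize (Heta d ltac:(lra)); pose proof (Rabs_pos (f2 d - m)); nra.
  + rewrite Ropp_0 in Heq; replace (- (1)) with (-1) in Heq by ring.
    nra.
Qed.

Lemma differentiable_of_partials (v vx vy : R -> R -> R) (x y r : R) :
  0 < r ->
  (forall x' y', Rabs (x' - x) < r -> Rabs (y' - y) < r ->
    is_derive (fun s => v s y') x' (vx x' y') /\ is_derive (fun t => v x' t) y' (vy x' y')) ->
  continuity_2d_pt vx x y -> continuity_2d_pt vy x y ->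
  differentiable_pt_lim v x y (vx x y) (vy x y).
Proof.
intros Hr H Hcx Hcy eps.
assert (He : 0 < eps / 2) by (pose proof (cond_pos eps); lra).
destruct (Hcx (mkposreal _ He)) as [d1 Hd1]; destruct (Hcy (mkposreal _ He)) as [d2 Hd2].
simpl in Hd1, Hd2.
assert (Hd : 0 < Rmin r (Rmin d1 d2)) by (repeat apply Rmin_glb_lt; auto; apply cond_pos).
exists (mkposreal _ Hd); simpl; intros s t Hs Ht.
assert (Hbd : Rmin r (Rmin d1 d2) <= r /\ Rmin r (Rmin d1 d2) <= d1 /\ Rmin r (Rmin d1 d2) <= d2).
{ repeat split; [apply Rmin_l | |]; (eapply Rle_trans; [apply Rmin_r |]); [apply Rmin_l | apply Rmin_r]. }
assert (Hbet : forall a c z, Rmin a c <= z <= Rmax a c -> Rabs (z - a) <= Rabs (c - a)).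
{ intros a c z Hz; unfold Rmin, Rmax in Hz; destruct (Rle_dec a c);
  [rewrite !Rabs_pos_eq | rewrite !Rabs_left1]; lra. }
destruct (mvt_between (fun z => v z t) (fun z => vx z t) x s) as [c1 [Hc1 E1]].
{ intros z Hz; apply H; [apply Hbet in Hz |]; lra. }
destruct (mvt_between (fun z => v x z) (fun z => vy x z) y t) as [c2 [Hc2 E2]].
{ intros z Hz; apply H; [rewrite Rminus_diag, Rabs_R0; lra | apply Hbet in Hz; lra]. }
apply Hbet in Hc1, Hc2.
replace (v s t - v x y - (vx x y * (s - x) + vy x y * (t - y)))
  with ((vx c1 t - vx x y) * (s - x) + (vy x c2 - vy x y) * (t - y)) by (simpl in E1, E2; nra).
specialize (Hd1 c1 t ltac:(lra) ltac:(lra)).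
specialize (Hd2 x c2 ltac:(rewrite Rminus_diag, Rabs_R0; apply cond_pos) ltac:(lra)).
eapply Rle_trans; [apply Rabs_triang |]; rewrite !Rabs_mult.
pose proof (Rmax_l (Rabs (s - x)) (Rabs (t - y))); pose proof (Rmax_r (Rabs (s - x)) (Rabs (t - y))).
set (mm := Rmax (Rabs (s - x)) (Rabs (t - y))) in *.
pose proof (Rabs_pos (s - x)); pose proof (Rabs_pos (t - y)).
pose proof (Rabs_pos (vx c1 t - vx x y)); pose proof (Rabs_pos (vy x c2 - vy x y)).
apply Rle_trans with (eps / 2 * mm + eps / 2 * mm); [| lra].
apply Rplus_le_compat; apply Rmult_le_compat; lra.
Qed.

Lemma derive_along (v : R -> R -> R) (x y e1 e2 t a b : R) :
  differentiable_pt_lim v (x + t * e1) (y + t * e2) a b ->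
  is_derive (fun s => v (x + s * e1) (y + s * e2)) t (a * e1 + b * e2).
Proof.
intros H; apply is_derive_Reals.
apply (derivable_pt_lim_comp_2d v (fun s => x + s * e1) (fun s => y + s * e2)); [exact H | |];
apply is_derive_Reals; auto_derive; auto; ring.
Qed.

(** Each pair of opposite points of the star gives the Hessian quadratic form in its direction. Over
    the directions (e1, e2) and (-e2, e1) the mixed terms cancel, leaving the trace times |e|^2. *)
Lemma lap_of_C2 (v vx vy vxx vxy vyx vyy : R -> R -> R) (x y r : R) :
  0 < r ->
  (forall x' y', Rabs (x' - x) < r -> Rabs (y' - y) < r ->
    differentiable_pt_lim v x' y' (vx x' y') (vy x' y') /\
    differentiable_pt_lim vx x' y' (vxx x' y') (vxy x' y') /\
    differentiable_pt_lim vy x' y' (vyx x' y') (vyy x' y')) ->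
  continuity_2d_pt vxx x y -> continuity_2d_pt vxy x y ->
  continuity_2d_pt vyx x y -> continuity_2d_pt vyy x y ->
  lap v x y (vxx x y + vyy x y).
Proof.
intros Hr H C1 C2 C3 C4 eps He.
assert (He8 : 0 < eps / 8) by lra.
destruct (C1 (mkposreal _ He8)) as [d1 D1]; destruct (C2 (mkposreal _ He8)) as [d2 D2].
destruct (C3 (mkposreal _ He8)) as [d3 D3]; destruct (C4 (mkposreal _ He8)) as [d4 D4].
simpl in D1, D2, D3, D4.
set (d := Rmin r (Rmin (Rmin d1 d2) (Rmin d3 d4))).
assert (Hd : 0 < d) by (repeat apply Rmin_glb_lt; auto; apply cond_pos).
assert (Hds : d <= r /\ d <= d1 /\ d <= d2 /\ d <= d3 /\ d <= d4).
{ unfold d; pose proof (Rmin_l r (Rmin (Rmin d1 d2) (Rmin d3 d4)));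
  pose proof (Rmin_r r (Rmin (Rmin d1 d2) (Rmin d3 d4)));
  pose proof (Rmin_l (Rmin d1 d2) (Rmin d3 d4)); pose proof (Rmin_r (Rmin d1 d2) (Rmin d3 d4));
  pose proof (Rmin_l d1 d2); pose proof (Rmin_r d1 d2);
  pose proof (Rmin_l d3 d4); pose proof (Rmin_r d3 d4); lra. }
exists d; split; [exact Hd |].
assert (Key : forall e1 e2, Rabs e1 < d -> Rabs e2 < d ->
  Rabs (v (x + e1) (y + e2) + v (x - e1) (y - e2) - 2 * v x y
   - (vxx x y * e1 ^ 2 + (vxy x y + vyx x y) * (e1 * e2) + vyy x y * e2 ^ 2))
  <= 2 * (eps / 4 * (e1 ^ 2 + e2 ^ 2))).
{ intros e1 e2 He1 He2.
  assert (Hin : forall t e z, -1 <= t <= 1 -> Rabs e < d -> Rabs (z + t * e - z) < d).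
  { intros t e z Ht Hee; replace (z + t * e - z) with (t * e) by ring.
    rewrite Rabs_mult; assert (Rabs t <= 1) by (apply Rabs_le; lra).
    pose proof (Rabs_pos e); nra. }
  pose proof (second_difference (fun t => v (x + t * e1) (y + t * e2))
    (fun t => vx (x + t * e1) (y + t * e2) * e1 + vy (x + t * e1) (y + t * e2) * e2)
    (fun t => (vxx (x + t * e1) (y + t * e2) * e1 + vxy (x + t * e1) (y + t * e2) * e2) * e1
            + (vyx (x + t * e1) (y + t * e2) * e1 + vyy (x + t * e1) (y + t * e2) * e2) * e2)
    (vxx x y * e1 ^ 2 + (vxy x y + vyx x y) * (e1 * e2) + vyy x y * e2 ^ 2)
    (eps / 4 * (e1 ^ 2 + e2 ^ 2))) as HS.
  cbv beta in HS.
  rewrite !Rmult_1_l, !Rmult_0_l, !Rplus_0_r in HS.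
  replace (x + -1 * e1) with (x - e1) in HS by ring.
  replace (y + -1 * e2) with (y - e2) in HS by ring.
  apply HS.
  - intros t Ht; apply derive_along, H; (eapply Rlt_le_trans; [apply Hin; eauto | lra]).
  - intros t Ht.
    destruct (H (x + t * e1) (y + t * e2)) as [_ [Hx Hy]];
      try (eapply Rlt_le_trans; [apply Hin; eauto | lra]).
    apply derive_along in Hx, Hy.
    apply @is_derive_plus.
    + apply (is_derive_ext (fun s => e1 * vx (x + s * e1) (y + s * e2))); [intros; apply Rmult_comm |].
      rewrite Rmult_comm; exact (is_derive_scal _ _ e1 _ Hx).
    + apply (is_derive_ext (fun s => e2 * vy (x + s * e1) (y + s * e2))); [intros; apply Rmult_comm |].
      rewrite Rmult_comm; exact (is_derive_scal _ _ e2 _ Hy).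
  - intros t Ht.
    pose proof (Hin t e1 x Ht He1); pose proof (Hin t e2 y Ht He2).
    specialize (D1 (x + t * e1) (y + t * e2) ltac:(lra) ltac:(lra)).
    specialize (D2 (x + t * e1) (y + t * e2) ltac:(lra) ltac:(lra)).
    specialize (D3 (x + t * e1) (y + t * e2) ltac:(lra) ltac:(lra)).
    specialize (D4 (x + t * e1) (y + t * e2) ltac:(lra) ltac:(lra)).
    match goal with |- Rabs ?A <= _ => replace A with
      ((vxx (x + t * e1) (y + t * e2) - vxx x y) * e1 ^ 2
      + ((vxy (x + t * e1) (y + t * e2) - vxy x y) + (vyx (x + t * e1) (y + t * e2) - vyx x y)) * (e1 * e2)
      + (vyy (x + t * e1) (y + t * e2) - vyy x y) * e2 ^ 2) by ring end.
    set (A1 := vxx _ _ - _) in *; set (A2 := vxy _ _ - _) in *.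
    set (A3 := vyx _ _ - _) in *; set (A4 := vyy _ _ - _) in *.
    clearbody A1 A2 A3 A4.
    eapply Rle_trans; [apply Rabs_triang |].
    eapply Rle_trans; [apply Rplus_le_compat_r, Rabs_triang |].
    rewrite !Rabs_mult, (Rabs_pos_eq (e1 ^ 2)), (Rabs_pos_eq (e2 ^ 2)) by apply pow2_ge_0.
    pose proof (Rabs_triang A2 A3).
    pose proof (Rabs_pos e1); pose proof (Rabs_pos e2).
    assert (Rabs e1 * Rabs e2 <= (e1 ^ 2 + e2 ^ 2) / 2).
    { rewrite <- (pow2_abs e1), <- (pow2_abs e2); pose proof (pow2_ge_0 (Rabs e1 - Rabs e2)); nra. }
    assert (0 <= Rabs e1 * Rabs e2) by (apply Rmult_le_pos; lra).
    pose proof (pow2_ge_0 e1); pose proof (pow2_ge_0 e2).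
    pose proof (Rabs_pos (A2 + A3)).
    apply Rle_trans with (eps / 8 * e1 ^ 2 + (eps / 8 + eps / 8) * ((e1 ^ 2 + e2 ^ 2) / 2) + eps / 8 * e2 ^ 2);
      [| lra].
    repeat apply Rplus_le_compat; apply Rmult_le_compat; try apply Rabs_pos; lra. }
intros e1 e2 He1 He2.
pose proof (Key e1 e2 He1 He2) as K1.
pose proof (Key (- e2) e1 ltac:(rewrite Rabs_Ropp; exact He2) He1) as K2.
replace (x - - e2) with (x + e2) in K2 by ring; replace (x + - e2) with (x - e2) in K2 by ring.
unfold star.
match goal with |- Rabs ?A <= _ => match type of K1 with Rabs ?B <= _ => match type of K2 with
 Rabs ?C <= _ => replace A with (B + C) by ring end end end.
eapply Rle_trans; [apply Rabs_triang |].
replace ((- e2) ^ 2 + e1 ^ 2) with (e1 ^ 2 + e2 ^ 2) in K2 by ring.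
lra.
Qed.

(** * Barriers from the Osgood condition *)

(** A profile leaving 0 with slope at least [kappa] and staying below a prescribed height [m] for a
    prescribed time [T]. The condition psi'' > 0 is what makes the comparison in [hopf] strict, even
    where [g] vanishes. *)
Definition barrier (g : R -> R) (delta : R) : Prop :=
  forall m T, 0 < m -> m <= delta -> 0 < T ->
    exists (psi psi1 psi2 : R -> R) (kappa : R),
      0 < kappa /\ psi 0 = 0 /\
      (forall t, 0 <= t <= T -> is_derive psi t (psi1 t)) /\
      (forall t, 0 <= t <= T -> kappa * t <= psi t <= m) /\
      (forall t, 0 < t < T ->
         is_derive psi1 t (psi2 t) /\ 0 < psi2 t /\ g (psi t) <= psi2 t).

Definition modulus (g : R -> R) (delta : R) : Prop :=
  0 < delta /\ (forall s t, 0 <= s -> s <= t -> t <= delta -> g s <= g t) /\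
  barrier g delta.

(** A linear profile would solve psi'' = g psi, but [barrier] asks for psi'' > 0; hence k (exp t -
    1), with k making its value at T equal to m. *)
Lemma modulus_zero (g : R -> R) (delta : R) :
  0 < delta -> (forall s, 0 <= s <= delta -> g s = 0) -> modulus g delta.
Proof.
intros Hd Hg; split; [exact Hd |]; split.
{ intros s t Hs Hst Ht; rewrite !Hg by lra; lra. }
intros m T Hm Hmd HT.
assert (HeT : 1 < exp T) by (rewrite <- exp_0; now apply exp_increasing).
set (k := m / (exp T - 1)).
assert (Hk : 0 < k) by (apply Rdiv_lt_0_compat; lra).
assert (Hbd : forall t, 0 <= t <= T -> k * t <= k * (exp t - 1) <= m).
{ intros t Ht; split.
  - apply Rmult_le_compat_l; [lra |]; pose proof (exp_ineq1_le t); lra.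
  - replace m with (k * (exp T - 1)) by (unfold k; field; lra).
    apply Rmult_le_compat_l; [lra |].
    destruct (Rle_lt_or_eq_dec t T (proj2 Ht)) as [Hlt| ->]; [| lra].
    apply exp_increasing in Hlt; lra. }
exists (fun t => k * (exp t - 1)), (fun t => k * exp t), (fun t => k * exp t), k.
split; [exact Hk |]; split; [rewrite exp_0; ring |]; split; [| split; [exact Hbd |]].
- intros t _; auto_derive; auto; ring.
- intros t Ht; pose proof (exp_pos t).
  assert (0 < k * exp t) by (apply Rmult_lt_0_compat; lra).
  split; [auto_derive; auto; ring |]; split; [assumption |].
  rewrite Hg; [lra |].
  specialize (Hbd t ltac:(lra)); assert (0 <= k * t) by (apply Rmult_le_pos; lra); lra.
Qed.

Lemma strictly_increasing_of_derive (F dF : R -> R) :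
  (forall s, is_derive F s (dF s)) -> (forall s, 0 < dF s) ->
  forall s t, s < t -> F s < F t.
Proof.
intros HF Hp s t Hst; destruct (mvt_le F dF s t) as [c [_ Hc]]; [lra | auto |].
specialize (Hp c); assert (0 < dF c * (t - s)) by (apply Rmult_lt_0_compat; lra); lra.
Qed.

(** Inverse function rule for a mere right inverse [psi]: strict monotonicity of [F] confines
    [psi (y + h)] to the [d]-neighbourhood of [psi y] when |h| < r, and there [V] is within [eps] of
    its central value. *)
Lemma inverse_derive (F V psi : R -> R) (A B : R) :
  (forall s, is_derive F s (/ V s)) -> (forall s, 0 < V s) ->
  (forall s, continuity_pt V s) ->
  (forall y, A < y < B -> F (psi y) = y) ->
  forall y, A < y < B -> is_derive psi y (V (psi y)).
Proof.
intros HF HV HVc Hpsi y Hy.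
assert (Hinc := strictly_increasing_of_derive F (fun s => / V s) HF
  (fun s => Rinv_0_lt_compat _ (HV s))).
set (s0 := psi y).
assert (HFs : F s0 = y) by (apply Hpsi, Hy).
apply is_derive_Reals; intros eps He.
destruct (HVc s0 eps He) as [d [Hd Hd']]; simpl in Hd'.
assert (HVd : forall c, Rabs (c - s0) < d -> Rabs (V c - V s0) < eps).
{ intros c Hc; destruct (Req_dec c s0) as [->|Hn].
  - rewrite Rminus_diag, Rabs_R0; exact He.
  - apply Hd'; split; [| exact Hc]; split; [exact I | auto]. }
set (r := Rmin (Rmin (y - A) (B - y)) (Rmin (F (s0 + d) - y) (y - F (s0 - d)))).
assert (Hup : y < F (s0 + d)) by (rewrite <- HFs; apply Hinc; lra).
assert (Hdn : F (s0 - d) < y) by (rewrite <- HFs; apply Hinc; lra).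
assert (Hr : 0 < r) by (repeat apply Rmin_glb_lt; lra).
assert (Hrs : r <= y - A /\ r <= B - y /\ r <= F (s0 + d) - y /\ r <= y - F (s0 - d)).
{ unfold r; pose proof (Rmin_l (Rmin (y - A) (B - y)) (Rmin (F (s0 + d) - y) (y - F (s0 - d))));
  pose proof (Rmin_r (Rmin (y - A) (B - y)) (Rmin (F (s0 + d) - y) (y - F (s0 - d))));
  pose proof (Rmin_l (y - A) (B - y)); pose proof (Rmin_r (y - A) (B - y));
  pose proof (Rmin_l (F (s0 + d) - y) (y - F (s0 - d)));
  pose proof (Rmin_r (F (s0 + d) - y) (y - F (s0 - d))); lra. }
exists (mkposreal r Hr); simpl; intros h Hh0 Hh; apply Rabs_def2 in Hh.
assert (HFh : F (psi (y + h)) = y + h) by (apply Hpsi; lra).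
assert (Hs1 : psi (y + h) < s0 + d).
{ apply Rnot_le_lt; intros Hle; destruct (Rle_lt_or_eq_dec _ _ Hle) as [Hlt|Heq].
  - apply Hinc in Hlt; lra.
  - rewrite <- Heq in HFh; lra. }
assert (Hs2 : s0 - d < psi (y + h)).
{ apply Rnot_le_lt; intros Hle; destruct (Rle_lt_or_eq_dec _ _ Hle) as [Hlt|Heq].
  - apply Hinc in Hlt; lra.
  - rewrite Heq in HFh; lra. }
destruct (mvt_between F (fun s => / V s) s0 (psi (y + h))) as [c [Hc Heq]]; [auto |].
rewrite HFh, HFs in Heq.
assert (Hcd : Rabs (c - s0) < d).
{ unfold Rmin, Rmax in Hc; destruct (Rle_dec s0 (psi (y + h))); apply Rabs_def1; lra. }
fold s0.
replace ((psi (y + h) - s0) / h - V s0) with (V c - V s0); [apply HVd, Hcd |].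
pose proof (HV c).
 assert (Hhc : h = / V c * (psi (y + h) - s0)) by lra.
assert (psi (y + h) - s0 = V c * h) by (rewrite Hhc at 2; field; lra).
rewrite H0; field; exact Hh0.
Qed.

(** Projection onto [0, delta]. Composing with it extends a [g] known only on that interval to a
    continuous function on the line. *)
Definition clip (delta s : R) : R := Rmax 0 (Rmin s delta).

Lemma clip_range (delta s : R) : 0 <= delta -> 0 <= clip delta s <= delta.
Proof.
intros Hd; unfold clip, Rmax, Rmin.
destruct (Rle_dec s delta); destruct (Rle_dec 0 _); lra.
Qed.

Lemma clip_id (delta s : R) : 0 <= s <= delta -> clip delta s = s.
Proof. intros Hs; unfold clip; rewrite Rmin_left, Rmax_right; lra. Qed.

Lemma clip_neg (delta s : R) : 0 <= delta -> s <= 0 -> clip delta s = 0.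
Proof. intros Hd Hs; unfold clip; rewrite Rmin_left, Rmax_left; lra. Qed.

Lemma clip_dist (delta s t : R) : Rabs (clip delta s - clip delta t) <= Rabs (s - t).
Proof.
unfold clip, Rmax, Rmin.
destruct (Rle_dec s delta), (Rle_dec t delta); repeat destruct (Rle_dec 0 _);
unfold Rabs; repeat destruct Rcase_abs; lra.
Qed.

Lemma continuous_clip (g : R -> R) (delta : R) :
  0 <= delta -> continuous_on (fun s => 0 <= s <= delta) g ->
  forall s, continuous (fun t => g (clip delta t)) s.
Proof.
intros Hd Hg s; apply (filterlim_comp _ _ _ (clip delta) g _
  (within (fun s => 0 <= s <= delta) (locally (clip delta s)))); [| apply Hg, clip_range, Hd].
intros P [e He]; exists e; intros t Ht; apply He; [| apply clip_range, Hd].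
eapply Rle_lt_trans; [apply clip_dist | exact Ht].
Qed.

Lemma continuity_pt_of_derive (f : R -> R) (x l : R) : is_derive f x l -> continuity_pt f x.
Proof.
intros H; apply derivable_continuous_pt; exists l; apply is_derive_Reals, H.
Qed.

Lemma is_derive_RInt_continuous (f : R -> R) (a x : R) :
  (forall s, continuous f s) -> is_derive (fun t => RInt f a t) x (f x).
Proof.
intros Hf; apply (is_derive_RInt f _ a); [| apply Hf].
apply filter_forall; intros t; apply (RInt_correct (V := R_CompleteNormedModule)).
apply (ex_RInt_continuous (V := R_CompleteNormedModule)); auto.
Qed.

Lemma ex_RInt_cont (f : R -> R) (a b : R) :
  a <= b -> (forall s, a <= s <= b -> continuous f s) -> ex_RInt f a b.
Proof.
intros Hab Hf; apply (ex_RInt_continuous (V := R_CompleteNormedModule)).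
intros z; rewrite Rmin_left, Rmax_right by lra; apply Hf.
Qed.

(* The barrier is the inverse of [s => int_0^s dr / sqrt (2 G r + a^2)], so that
   [psi'^2 = 2 G psi + a^2] and [psi'' = g psi]; divergence of the integral for [a = 0]
   makes the time needed to reach height [m] exceed [T] when [a] is small. *)
Lemma modulus_osgood (g : R -> R) (delta : R) :
  0 < delta -> continuous_on (fun s => 0 <= s <= delta) g -> g 0 = 0 ->
  (forall s, 0 < s <= delta -> 0 < g s) ->
  (forall s t, 0 <= s -> s <= t -> t <= delta -> g s <= g t) ->
  filterlim (fun e => RInt (fun s => / sqrt (RInt g 0 s)) e delta)
    (at_right 0) (Rbar_locally p_infty) ->
  modulus g delta.
Proof.
intros Hd Hgc Hg0 Hgp Hgm Hdiv; split; [exact Hd |]; split; [exact Hgm |].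
intros m T Hm Hmd HT.
set (gc := fun s => g (clip delta s)).
assert (Hgcc : forall s, continuous gc s) by (apply continuous_clip; [lra | exact Hgc]).
assert (Hgc1 : forall s, 0 <= s <= delta -> gc s = g s) by (intros s Hs; unfold gc; now rewrite clip_id).
assert (Hgc0 : forall s, s <= 0 -> gc s = 0) by (intros s Hs; unfold gc; rewrite clip_neg; auto; lra).
assert (Hgcp : forall s, 0 <= gc s).
{ intros s; unfold gc; pose proof (clip_range delta s ltac:(lra)).
  destruct (Req_dec (clip delta s) 0) as [->|Hn]; [lra |].
  apply Rlt_le, Hgp; lra. }
set (G := fun s => RInt gc 0 s).
assert (HGd : forall s, is_derive G s (gc s)) by (intros s; apply is_derive_RInt_continuous, Hgcc).
assert (HG0 : G 0 = 0) by (unfold G; apply (RInt_point (V := R_CompleteNormedModule))).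
assert (HGinc : forall s t, s <= t -> G s <= G t).
{ intros s t Hst; destruct (mvt_le G gc s t Hst) as [c [_ Hc]]; [auto |].
  specialize (Hgcp c); assert (0 <= gc c * (t - s)) by (apply Rmult_le_pos; lra); lra. }
assert (HGnn : forall s, 0 <= G s).
{ intros s; destruct (Rle_lt_dec 0 s) as [Hs|Hs]; [rewrite <- HG0; apply HGinc, Hs |].
  destruct (mvt_le G gc s 0 ltac:(lra)) as [c [Hc Heq]]; [auto |].
  rewrite (Hgc0 c) in Heq by lra; lra. }
assert (HGpos : forall s, 0 < s <= delta -> 0 < G s).
{ intros s Hs; unfold G; apply RInt_gt_0; [lra | |].
  - intros x Hx; rewrite Hgc1 by lra; apply Hgp; lra.
  - intros x Hx; apply Hgcc. }
assert (HGext : forall s, 0 < s < delta -> RInt g 0 s = G s).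
{ intros s Hs; unfold G; apply RInt_ext; intros x.
  rewrite Rmin_left, Rmax_right by lra; intros Hx; rewrite Hgc1; lra. }
assert (Hsqc : forall s, 0 < s <= delta -> continuous (fun t => / sqrt (G t)) s).
{ intros s Hs; specialize (HGpos s Hs).
  apply (ex_derive_continuous (K := R_AbsRing) (V := R_NormedModule)); auto_derive.
  pose proof (sqrt_lt_R0 _ HGpos).
  repeat split; [exists (gc s); apply HGd | lra | lra]. }
(* [J] is the part of the integral above height [m], to be discarded; the factor 2 in the threshold
   below pays for the bound V <= 2 sqrt G on [e, m]. *)
set (J := RInt (fun s => / sqrt (G s)) m delta).
destruct (Hdiv (fun z => 2 * T + J < z)) as [eta Heta]; [exists (2 * T + J); auto |].
assert (He : exists e, 0 < e < eta /\ e < m).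
{ exists (Rmin eta m / 2); pose proof (Rmin_l eta m); pose proof (Rmin_r eta m).
  assert (0 < Rmin eta m) by (apply Rmin_glb_lt; [apply cond_pos | lra]); lra. }
destruct He as [e [He Hem]].
assert (Hlarge : 2 * T < RInt (fun s => / sqrt (G s)) e m).
{ specialize (Heta e).
  assert (Hb : ball 0 eta e).
  { unfold ball; simpl; unfold AbsRing_ball, abs, minus, plus, opp; simpl.
    rewrite Ropp_0, Rplus_0_r, Rabs_pos_eq; lra. }
  specialize (Heta Hb (proj1 He)).
  rewrite (RInt_ext _ (fun s => / sqrt (G s))) in Heta.
  - rewrite <- (RInt_Chasles (V := R_CompleteNormedModule) _ e m delta) in Heta.
    + fold J in Heta; unfold plus in Heta; simpl in Heta; lra.
    + apply ex_RInt_cont; [lra |]; intros s Hs; apply Hsqc; lra.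
    + apply ex_RInt_cont; [lra |]; intros s Hs; apply Hsqc; lra.
  - intros s; rewrite Rmin_left, Rmax_right by lra; intros Hs; rewrite HGext; auto; lra. }
assert (HGe : 0 < G e) by (apply HGpos; lra).
(* With this [a], 2 G s + a^2 <= 4 G s for s >= e. *)
set (a := sqrt (2 * G e)).
assert (Ha : 0 < a) by (apply sqrt_lt_R0; lra).
assert (Ha2 : a ^ 2 = 2 * G e) by (apply pow2_sqrt; lra).
assert (Harg : forall s, 0 < 2 * G s + a ^ 2) by (intros s; specialize (HGnn s); lra).
set (V := fun s => sqrt (2 * G s + a ^ 2)).
assert (HV : forall s, 0 < V s) by (intros s; apply sqrt_lt_R0, Harg).
assert (HVa : forall s, a <= V s).
{ intros s; unfold V; rewrite <- (sqrt_pow2 a) at 1 by lra; apply sqrt_le_1_alt.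
  specialize (HGnn s); lra. }
assert (HVd : forall s, is_derive V s (gc s / V s)).
{ intros s.
  assert (Hin : is_derive (fun t => 2 * G t + a ^ 2) s (2 * gc s)).
  { auto_derive; [exists (gc s); apply HGd |].
    replace (Derive (fun x => G x) s) with (gc s) by (symmetry; apply is_derive_unique, HGd); ring. }
  replace (gc s / V s) with (2 * gc s / (2 * V s)) by (specialize (HV s); field; lra).
  exact (is_derive_sqrt _ s _ Hin (Harg s)). }
set (F := fun s => RInt (fun t => / V t) 0 s).
assert (HVc : forall s, continuous (fun t => / V t) s).
{ intros s; apply (ex_derive_continuous (K := R_AbsRing) (V := R_NormedModule)); auto_derive.
  specialize (HV s); split; [exists (gc s / V s); apply HVd | split; [lra | exact I]]. }
assert (HFd : forall s, is_derive F s (/ V s))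
  by (intros s; apply (is_derive_RInt_continuous (fun t => / V t)), HVc).
assert (HF0 : F 0 = 0) by (unfold F; apply (RInt_point (V := R_CompleteNormedModule))).
assert (HFinc := strictly_increasing_of_derive F (fun s => / V s) HFd
  (fun s => Rinv_0_lt_compat _ (HV s))).
assert (HFcont : continuity F) by (intros s; apply (continuity_pt_of_derive _ _ _ (HFd s))).
assert (HFm : T < F m).
{ assert (HFe : 0 < F e) by (rewrite <- HF0; apply HFinc; lra).
  assert (Hsplit : F m = F e + RInt (fun t => / V t) e m).
  { unfold F; rewrite <- (RInt_Chasles (V := R_CompleteNormedModule) _ 0 e m); [reflexivity | |];
    apply ex_RInt_cont; auto; lra. }
  assert (Hcmp : RInt (fun s => / 2 * / sqrt (G s)) e m <= RInt (fun t => / V t) e m).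
  { apply RInt_le; [lra | | |].
    - apply ex_RInt_cont; [lra |]; intros s Hs.
      apply (continuous_mult (K := R_AbsRing)); [apply continuous_const | apply Hsqc; lra].
    - apply ex_RInt_cont; auto; lra.
    - intros s Hs.
      assert (HGs : 0 < G s) by (apply HGpos; lra).
      assert (G e <= G s) by (apply HGinc; lra).
      pose proof (sqrt_lt_R0 _ HGs).
      rewrite <- Rinv_mult; apply Rinv_le_contravar; [apply HV |].
      unfold V; replace 2 with (sqrt (2 ^ 2)) at 2 by (apply sqrt_pow2; lra).
      rewrite <- sqrt_mult by lra; apply sqrt_le_1_alt; lra. }
  rewrite (RInt_scal (V := R_CompleteNormedModule) (fun s => / sqrt (G s))) in Hcmp.
  - unfold scal in Hcmp; simpl in Hcmp; unfold mult in Hcmp; simpl in Hcmp; lra.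
  - apply ex_RInt_cont; [lra |]; intros s Hs; apply Hsqc; lra. }
(* Room on both sides of [0, m] makes 0 and [T] interior to the range of [F], so that [psi] has
   two-sided derivatives at both ends of [0, T]. *)
assert (HFm1 : F m < F (m + 1)) by (apply HFinc; lra).
assert (HFn1 : F (-1) < 0) by (rewrite <- HF0; apply HFinc; lra).
destruct (choose_fun R (fun y s => F (-1) < y < F (m + 1) -> F s = y)) as [psi Hpsi].
{ intros y; destruct (excluded_middle_informative (F (-1) < y < F (m + 1))) as [Hy|Hy].
  - destruct (IVT_gen F (-1) (m + 1) y HFcont) as [s [_ Hs]]; [| exists s; auto].
    rewrite Rmin_left, Rmax_right; lra.
  (* Arbitrary value of [psi] outside the range of [F] on (-1, m + 1). *)
  - exists 0; tauto. }
assert (Hpsid := inverse_derive F V psi _ _ HFd HV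
  (fun s => continuity_pt_of_derive _ _ _ (HVd s)) Hpsi).
assert (HFinj : forall s t, F s <= F t -> s <= t).
{ intros s t Hst; apply Rnot_lt_le; intros Hlt; apply HFinc in Hlt; lra. }
assert (Hp0 : psi 0 = 0).
{ assert (HH : F (psi 0) = 0) by (apply Hpsi; lra).
  apply Rle_antisym; apply HFinj; lra. }
assert (Hbd : forall t, 0 <= t <= T -> a * t <= psi t <= m).
{ intros t Ht; split.
  - destruct (mvt_le psi (fun y => V (psi y)) 0 t) as [c [_ Hc]]; [lra | |].
    + intros y Hy; apply Hpsid; lra.
    + specialize (HVa (psi c)).
      assert (0 <= (V (psi c) - a) * t) by (apply Rmult_le_pos; lra); lra.
  - apply HFinj; rewrite Hpsi; lra. }
exists psi, (fun y => V (psi y)), (fun y => gc (psi y)), a.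
split; [exact Ha |]; split; [exact Hp0 |]; split; [| split; [exact Hbd |]].
{ intros t Ht; apply Hpsid; lra. }
intros t Ht; split; [| split].
- assert (HH := is_derive_comp V psi t _ _ (HVd (psi t)) (Hpsid t ltac:(lra))).
  unfold scal in HH; simpl in HH; unfold mult in HH; simpl in HH.
  specialize (HV (psi t)).
  replace (gc (psi t)) with (V (psi t) * (gc (psi t) / V (psi t))) by (field; lra); exact HH.
- specialize (Hbd t ltac:(lra)); assert (0 < a * t) by (apply Rmult_lt_0_compat; lra).
  rewrite Hgc1 by lra; apply Hgp; lra.
- specialize (Hbd t ltac:(lra)); assert (0 < a * t) by (apply Rmult_lt_0_compat; lra).
  rewrite Hgc1 by lra; lra.
Qed.

Lemma osgood_modulus (f : R -> R) (tbar : R) :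
  one_sided_osgood f tbar ->
  exists (delta : R) (g : R -> R), modulus g delta /\
    forall s t, s <= t -> 0 <= s -> Rabs (s - tbar) <= delta / 2 ->
      Rabs (t - tbar) <= delta / 2 -> f s - f t <= g (t - s).
Proof.
intros [delta [g [Hd [Hc [H0 [Hf Hg]]]]]]; exists delta, g; split.
- destruct Hg as [Hg|[Hp [Hm Hi]]]; [apply modulus_zero | apply modulus_osgood]; assumption.
- intros s t Hst Hs H1 H2; apply Rabs_le_between in H1, H2; apply Hf; lra.
Qed.

(** * Hopf's lemma and the strong maximum principle *)

Definition sqd (c1 c2 x y : R) : R := (x - c1) ^ 2 + (y - c2) ^ 2.

Lemma sqd_cont (c1 c2 : R) (K : R -> R -> Prop) : seqcont K (sqd c1 c2).
Proof.
intros xn yn x y _ _ Hx Hy; unfold sqd; simpl.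
apply is_lim_seq_plus'; repeat apply is_lim_seq_mul;
  try apply is_lim_seq_const; apply is_lim_seq_minus'; auto; apply is_lim_seq_const.
Qed.

Lemma sqd_bounded (c1 c2 M : R) (K : R -> R -> Prop) :
  (forall x y, K x y -> sqd c1 c2 x y <= M) -> bounded2 K.
Proof.
intros H; exists (Rabs c1 + Rabs c2 + Rabs M + 1); intros x y Hxy; specialize (H x y Hxy).
unfold sqd in H; pose proof (Rle_abs M).
assert (Hb : forall a, a ^ 2 <= M -> Rabs a <= Rabs M + 1).
{ intros a Ha; rewrite <- (pow2_abs a) in Ha; pose proof (Rabs_pos a); nra. }
pose proof (Hb (x - c1)) as Hbx; pose proof (Hb (y - c2)) as Hby.
pose proof (Rabs_triang (x - c1) c1) as T1; pose proof (Rabs_triang (y - c2) c2) as T2.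
replace (x - c1 + c1) with x in T1 by ring; replace (y - c2 + c2) with y in T2 by ring.
pose proof (Rabs_pos c1); pose proof (Rabs_pos c2).
pose proof (pow2_ge_0 (x - c1)); pose proof (pow2_ge_0 (y - c2)).
split; [specialize (Hbx ltac:(lra)) | specialize (Hby ltac:(lra))]; lra.
Qed.

Lemma sqd_ge0 (c1 c2 x y : R) : 0 <= sqd c1 c2 x y.
Proof. unfold sqd; pose proof (pow2_ge_0 (x - c1)); pose proof (pow2_ge_0 (y - c2)); lra. Qed.

Lemma sqd_close (c1 c2 x y r : R) :
  0 < r -> sqd c1 c2 x y < r ^ 2 -> Rabs (x - c1) < r /\ Rabs (y - c2) < r.
Proof.
intros Hr H; unfold sqd in H.
pose proof (pow2_ge_0 (x - c1)); pose proof (pow2_ge_0 (y - c2)).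
split; rewrite <- (Rabs_pos_eq r) by lra; apply Rsqr_lt_abs_0; unfold Rsqr; lra.
Qed.

Lemma ln_le_sub1 (x : R) : 0 < x -> ln x <= x - 1.
Proof. intros Hx; pose proof (exp_ineq1_le (ln x)) as H; rewrite exp_ln in H; lra. Qed.

(* In dimension two [log |p - c|] is harmonic, so a function [psi] of [log (rad / |p - c|)] has
   Laplacian [psi'' / |p - c|^2], with no first-order term. *)
Lemma lap_radial (psi psi1 : R -> R) (psi2 A c1 c2 x y T : R) :
  let s := sqd c1 c2 x y in let t := / 2 * (A - ln s) in
  0 < s -> 0 < t < T ->
  (forall t, 0 <= t <= T -> is_derive psi t (psi1 t)) -> is_derive psi1 t psi2 ->
  lap (fun x y => psi (/ 2 * (A - ln (sqd c1 c2 x y)))) x y (psi2 / s).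
Proof.
intros s t Hs Ht H1 H2.
assert (Hcont : forall eps, 0 < eps -> exists r, 0 < r /\
   forall s', Rabs (s' - s) < r -> 0 < s' /\ Rabs (/ 2 * (A - ln s') - t) < eps).
{ intros eps He.
  assert (Hd : is_derive (fun s => / 2 * (A - ln s)) s (- / (2 * s)))
    by (auto_derive; [exact Hs | field; lra]).
  apply continuity_pt_of_derive in Hd.
  destruct (Hd eps He) as [d [Hd0 Hd']]; simpl in Hd'.
  exists (Rmin d s); split; [now apply Rmin_glb_lt |]; intros s' Hs'.
  pose proof (Rmin_l d s); pose proof (Rmin_r d s).
  split; [apply Rabs_def2 in Hs'; lra |].
  destruct (Req_dec s' s) as [->|Hn]; [unfold t; rewrite Rminus_diag, Rabs_R0; exact He |].
  apply Hd'; split; [split; [exact I | auto] |].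
  unfold R_dist; lra. }
destruct (Hcont (Rmin t (T - t))) as [r [Hr Hr']]; [apply Rmin_glb_lt; lra |].
assert (Hin : forall s', Rabs (s' - s) < r -> 0 < s' /\ 0 <= / 2 * (A - ln s') <= T).
{ intros s' Hs'; destruct (Hr' s' Hs') as [? Hb]; split; [assumption |].
  pose proof (Rmin_l t (T - t)); pose proof (Rmin_r t (T - t)); apply Rabs_def2 in Hb; lra. }
(* Chain rule through the squared distance, whose gradient has square 4 s: the two terms in [psi1]
   cancel. *)
replace (psi2 / s) with (4 * 1 * (- psi1 t / (2 * s))
  + ((2 * (x - c1)) ^ 2 + (2 * (y - c2)) ^ 2) * (psi2 / (4 * s ^ 2) + psi1 t / (2 * s ^ 2))).
2: { replace ((2 * (x - c1)) ^ 2 + (2 * (y - c2)) ^ 2) with (4 * s) by (unfold s, sqd; ring).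
  field; lra. }
apply (lap_comp_quad (sqd c1 c2) (fun s => psi (/ 2 * (A - ln s)))
  (fun s => - psi1 (/ 2 * (A - ln s)) / (2 * s)) x y _ _ 1 _ r); [| exact Hr | |].
- intros e1 e2; unfold sqd; ring.
- intros s' Hs'; destruct (Hin s' Hs') as [Hs'0 Hs't].
  evar_last; [apply (is_derive_comp psi (fun s => / 2 * (A - ln s))); [apply H1, Hs't |] |].
  + auto_derive; [exact Hs'0 | reflexivity].
  + unfold scal; simpl; unfold mult; simpl; field; lra.
- fold s.
  auto_derive; [repeat split; try lra; exists psi2; exact H2 |].
  replace (Derive (fun x : R => psi1 x) (/ 2 * (A + - ln s))) with psi2
    by (symmetry; apply is_derive_unique; exact H2).
  unfold t, Rminus; field; lra.
Qed.

(** In the annulus rad / 2 <= |p - c| <= rad, [z] is compared with h = psi (log (rad / |p - c|)). On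
    the inner circle h <= m <= z by compactness, and h = 0 on the outer one. At a negative interior
    minimum of z - h, lap h <= lap z <= g z <= g h <= psi'', while lap h = psi'' / |p - c|^2 > psi''
    because rad <= 1 / 2 makes |p - c| < 1. *)
Lemma hopf (z : R -> R -> R) (g : R -> R) (delta c1 c2 rad : R) :
  0 < rad <= 1 / 2 -> modulus g delta ->
  seqcont (fun x y => sqd c1 c2 x y <= rad ^ 2) z ->
  (forall x y, sqd c1 c2 x y < rad ^ 2 -> 0 < z x y) ->
  (forall x y, sqd c1 c2 x y = rad ^ 2 -> 0 <= z x y) ->
  (forall x y, sqd c1 c2 x y < rad ^ 2 -> exists l, lap z x y l /\ l <= g (z x y)) ->
  exists kappa, 0 < kappa /\ forall e1 e2 t, e1 ^ 2 + e2 ^ 2 = 1 -> 0 <= t <= rad / 2 ->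
    kappa * t <= z (c1 + (rad - t) * e1) (c2 + (rad - t) * e2).
Proof.
intros Hrad [Hdelta [Hgm Hbar]] Hz Hpos Hnn Hlap.
assert (Hrad2 : 0 < rad ^ 2 <= / 4) by (split; nra).
assert (Hclosed : forall a b, seqclosed (fun x y => a <= sqd c1 c2 x y <= b)).
{ intros a b xn yn x y Hn Hx Hy.
  apply (lim_between (fun n => sqd c1 c2 (xn n) (yn n))); [exact Hn |].
  apply (sqd_cont c1 c2 (fun _ _ => True)); auto. }
destruct (extreme_value_min (fun x y => rad ^ 2 / 4 <= sqd c1 c2 x y <= rad ^ 2 / 4) z)
  as [xm [ym [Hm Hmin]]].
{ apply (sqd_bounded c1 c2 (rad ^ 2 / 4)); intros; lra. }
{ apply Hclosed. }
{ apply (seqcont_sub (fun x y => sqd c1 c2 x y <= rad ^ 2)); [intros; lra | exact Hz]. }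
{ exists (c1 + rad / 2), c2; unfold sqd; split; right; field. }
set (m := Rmin delta (z xm ym)).
assert (Hzm : 0 < z xm ym) by (apply Hpos; lra).
assert (Hm0 : 0 < m) by (apply Rmin_glb_lt; assumption).
assert (Hmz : m <= z xm ym) by apply Rmin_r.
assert (Hmd : m <= delta) by apply Rmin_l.
(* For s the squared distance to the centre, tau s = log (rad / |p - c|); the inner circle is
   reached at time T = log 2. *)
set (tau := fun s => / 2 * (ln (rad ^ 2) - ln s)).
set (T := tau (rad ^ 2 / 4)).
assert (HtauT : forall s, rad ^ 2 / 4 < s < rad ^ 2 -> 0 < tau s < T).
{ intros s Hs; unfold T, tau; split.
  - assert (ln s < ln (rad ^ 2)) by (apply ln_increasing; lra); lra.
  - assert (ln (rad ^ 2 / 4) < ln s) by (apply ln_increasing; lra); lra. }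
assert (Htau0 : tau (rad ^ 2) = 0) by (unfold tau; ring).
assert (HT : 0 < T).
{ unfold T, tau; assert (ln (rad ^ 2 / 4) < ln (rad ^ 2)) by (apply ln_increasing; lra); lra. }
assert (HtauT' : forall s, rad ^ 2 / 4 <= s <= rad ^ 2 -> 0 <= tau s <= T).
{ intros s Hs; destruct (Req_dec s (rad ^ 2)) as [->|]; [lra |].
  destruct (Req_dec s (rad ^ 2 / 4)) as [->|]; [fold T; lra |].
  assert (0 < tau s < T) by (apply HtauT; lra); lra. }
destruct (Hbar m T Hm0 Hmd HT) as [psi [psi1 [psi2 [kappa [Hk [Hp0 [Hp1 [Hpb Hp2]]]]]]]].
set (h := fun x y => psi (tau (sqd c1 c2 x y))).
set (K := fun x y => rad ^ 2 / 4 <= sqd c1 c2 x y <= rad ^ 2).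
assert (Hh : seqcont K h).
{ intros xn yn x y Hn Hxy Hx Hy; unfold h.
  assert (Hs : is_lim_seq (fun n => sqd c1 c2 (xn n) (yn n)) (sqd c1 c2 x y))
    by (apply (sqd_cont c1 c2 K); auto).
  apply (is_lim_seq_continuous psi (fun n => tau (sqd c1 c2 (xn n) (yn n)))).
  - apply (continuity_pt_of_derive _ _ _ (Hp1 _ (HtauT' _ Hxy))).
  - apply (is_lim_seq_continuous tau (fun n => sqd c1 c2 (xn n) (yn n))); [| exact Hs].
    apply (continuity_pt_of_derive tau _ (- / (2 * sqd c1 c2 x y))).
    unfold K in Hxy; unfold tau; auto_derive; [lra | field; lra]. }
destruct (extreme_value_min K (fun x y => z x y - h x y)) as [x [y [Hxy HF]]].
{ apply (sqd_bounded c1 c2 (rad ^ 2)); intros ? ? Hq; apply Hq. }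
{ apply Hclosed. }
{ intros xn yn x y Hn Hxy Hx Hy; apply is_lim_seq_minus'; [| apply Hh; auto].
  apply Hz; auto; [intros n; apply Hn | apply Hxy]. }
{ exists xm, ym; unfold K; lra. }
assert (Hge : 0 <= z x y - h x y).
{ apply Rnot_lt_le; intros Hneg; unfold K in Hxy; set (s := sqd c1 c2 x y) in *.
  destruct (Req_dec s (rad ^ 2)) as [Hs|Hs1].
  { unfold h in Hneg; fold s in Hneg; rewrite Hs, Htau0, Hp0 in Hneg.
    specialize (Hnn x y Hs); lra. }
  destruct (Req_dec s (rad ^ 2 / 4)) as [Hs|Hs2].
  { unfold h in Hneg; fold s in Hneg; rewrite Hs in Hneg; fold T in Hneg.
    specialize (Hmin x y ltac:(fold s; lra)); specialize (Hpb T ltac:(lra)); lra. }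
  assert (Hst : 0 < tau s < T) by (apply HtauT; lra).
  destruct (Hp2 _ Hst) as [Hd2 [Hpos2 Hg2]].
  assert (Hzp : 0 < z x y) by (apply Hpos; fold s; lra).
  destruct (Hlap x y ltac:(fold s; lra)) as [l [Hl Hlg]].
  assert (Hlh : lap h x y (psi2 (tau s) / s)).
  { apply (lap_radial psi psi1 (psi2 (tau s)) (ln (rad ^ 2)) c1 c2 x y T); auto.
    fold s; lra. }
  assert (Hgap : exists r, 0 < r /\ forall x' y', Rabs (x' - x) < r -> Rabs (y' - y) < r -> K x' y').
  { destruct (seqcont_eps (fun _ _ => True) (sqd c1 c2) x y (sqd_cont c1 c2 _) I
      (Rmin (s - rad ^ 2 / 4) (rad ^ 2 - s))) as [r [Hr Hr']]; [apply Rmin_glb_lt; lra |].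
    exists r; split; [exact Hr |]; intros x' y' Hx' Hy'.
    specialize (Hr' x' y' I Hx' Hy'); fold s in Hr'; apply Rabs_def2 in Hr'.
    pose proof (Rmin_l (s - rad ^ 2 / 4) (rad ^ 2 - s)).
    pose proof (Rmin_r (s - rad ^ 2 / 4) (rad ^ 2 - s)); unfold K; lra. }
  destruct Hgap as [r [Hr Hr']].
  assert (Hle : psi2 (tau s) / s - l <= 0).
  { apply (lap_max (fun x y => h x y - z x y) x y _ r Hr); [| now apply lap_sub].
    intros x' y' Hx' Hy'; specialize (HF x' y' (Hr' x' y' Hx' Hy')); lra. }
  assert (Hgh : g (z x y) <= g (h x y)).
  { apply Hgm; [lra | lra |]; unfold h; fold s; specialize (Hpb (tau s) ltac:(lra)); lra. }
  unfold h in Hgh; fold s in Hgh.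
  assert (psi2 (tau s) < psi2 (tau s) / s); [| lra].
  apply (Rmult_lt_reg_r s); [lra |].
  replace (psi2 (tau s) / s * s) with (psi2 (tau s)) by (field; lra).
  nra. }
exists kappa; split; [exact Hk |]; intros e1 e2 t He Ht.
set (x' := c1 + (rad - t) * e1); set (y' := c2 + (rad - t) * e2).
assert (Hsq : sqd c1 c2 x' y' = (rad - t) ^ 2).
{ unfold sqd, x', y'; transitivity ((rad - t) ^ 2 * (e1 ^ 2 + e2 ^ 2)); [ring | rewrite He; ring]. }
assert (HK : K x' y') by (unfold K; rewrite Hsq; split; nra).
specialize (HF x' y' HK).
assert (Hh' : kappa * tau ((rad - t) ^ 2) <= h x' y').
{ unfold h; rewrite Hsq; apply Hpb, HtauT'; rewrite <- Hsq; apply HK. }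
(* log (rad / (rad - t)) >= t, from ln w <= w - 1 and rad <= 1 / 2. *)
assert (Hta : t <= tau ((rad - t) ^ 2)).
{ unfold tau; set (w := (1 - t / rad) ^ 2).
  assert (Htr : 2 * t <= t / rad <= / 2).
  { split.
    - apply (Rmult_le_reg_r rad); [lra |]; replace (t / rad * rad) with t by (field; lra); nra.
    - apply (Rmult_le_reg_r rad); [lra |]; replace (t / rad * rad) with t by (field; lra); lra. }
  assert (Hw : 0 < w) by (unfold w; apply pow_lt; lra).
  replace ((rad - t) ^ 2) with (rad ^ 2 * w) by (unfold w; field; lra).
  rewrite ln_mult by lra; pose proof (ln_le_sub1 w Hw).
  assert (w <= 1 - 2 * t) by (unfold w; set (q := t / rad) in *; nra).
  lra. }
assert (kappa * t <= kappa * tau ((rad - t) ^ 2)) by (apply Rmult_le_compat_l; lra).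
lra.
Qed.

Definition convex (D : R -> R -> Prop) : Prop :=
  forall x y x' y' t, D x y -> D x' y' -> 0 <= t <= 1 ->
    D (x + t * (x' - x)) (y + t * (y' - y)).

Definition open2 (D : R -> R -> Prop) : Prop :=
  forall x y, D x y -> exists r, 0 < r /\
    forall x' y', Rabs (x' - x) < r -> Rabs (y' - y) < r -> D x' y'.

(** [g] and [delta] may depend on the point, as the Osgood modulus of [f] depends on the value taken
    there. *)
Definition elliptic_at (z : R -> R -> R) (x y : R) : Prop :=
  exists (r : R) (g : R -> R) (delta : R), 0 < r /\ modulus g delta /\
    forall x' y', Rabs (x' - x) < r -> Rabs (y' - y) < r ->
      exists l, lap z x' y' l /\ l <= g (z x' y').

(** The last zero on the segment from the given zero to the positive point has positive points
    arbitrarily close to it; these serve as centres of balls for Hopf's lemma. *)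
Lemma first_contact (D : R -> R -> Prop) (z : R -> R -> R) (x0 y0 x1 y1 : R) :
  convex D -> seqcont D z -> D x0 y0 -> D x1 y1 -> 0 < z x0 y0 -> z x1 y1 = 0 ->
  (forall x y, D x y -> 0 <= z x y) ->
  exists x y, D x y /\ z x y = 0 /\ forall r, 0 < r -> exists c1 c2,
    D c1 c2 /\ 0 < z c1 c2 /\ Rabs (c1 - x) < r /\ Rabs (c2 - y) < r.
Proof.
intros Hconv Hz H0 H1 Hz0 Hz1 Hnn.
set (gx := fun t => x1 + t * (x0 - x1)); set (gy := fun t => y1 + t * (y0 - y1)).
assert (HD : forall t, 0 <= t <= 1 -> D (gx t) (gy t)) by (intros t Ht; apply Hconv; auto).
destruct (completeness (fun t => 0 <= t <= 1 /\ z (gx t) (gy t) = 0)) as [t [Hub Hlub]].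
{ exists 1; intros t [Ht _]; lra. }
{ exists 0; split; [lra |]; unfold gx, gy; rewrite !Rmult_0_l, !Rplus_0_r; exact Hz1. }
assert (Ht : 0 <= t <= 1).
{ split; [apply Hub; split; [lra |]; unfold gx, gy; rewrite !Rmult_0_l, !Rplus_0_r; exact Hz1 |].
  apply Hlub; intros s [Hs _]; lra. }
assert (Hzt : z (gx t) (gy t) = 0).
{ destruct (choose_fun R (fun n s => 0 <= s <= 1 /\ z (gx s) (gy s) = 0 /\ Rabs (s - t) < / (INR n + 1)))
    as [s Hs].
  { intros n; apply NNPP; intros Hn; pose proof (inv_nat_pos n).
    assert (t <= t - / (INR n + 1)); [| lra].
    apply Hlub; intros s [Hs Hzs]; apply Rnot_lt_le; intros Hlt; apply Hn; exists s.
    split; [exact Hs |]; split; [exact Hzs |].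
    assert (s <= t) by (apply Hub; auto); apply Rabs_def1; lra. }
  assert (Hlim : is_lim_seq s t) by (apply lim_dist_inv; intros n; apply Hs).
  assert (Hl : is_lim_seq (fun n => z (gx (s n)) (gy (s n))) (z (gx t) (gy t))).
  { apply Hz; [intros n; apply HD, Hs | apply HD, Ht | |];
    apply is_lim_seq_plus'; try apply is_lim_seq_const; apply is_lim_seq_mul; auto; apply is_lim_seq_const. }
  apply (is_lim_seq_ext _ (fun _ => 0)) in Hl; [| intros n; apply Hs].
  apply is_lim_seq_unique in Hl; rewrite Lim_seq_const in Hl; injection Hl; auto. }
assert (Ht1 : t < 1).
{ apply Rnot_le_lt; intros Hle; replace t with 1 in Hzt by lra.
  unfold gx, gy in Hzt; rewrite !Rmult_1_l in Hzt.
  replace (x1 + (x0 - x1)) with x0 in Hzt by ring; replace (y1 + (y0 - y1)) with y0 in Hzt by ring; lra. }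
exists (gx t), (gy t); split; [apply HD, Ht |]; split; [exact Hzt |]; intros r Hr.
set (N := Rabs (x0 - x1) + Rabs (y0 - y1) + 1).
assert (HN : 0 < N) by (unfold N; pose proof (Rabs_pos (x0 - x1)); pose proof (Rabs_pos (y0 - y1)); lra).
set (d := Rmin (1 - t) (r / (2 * N))).
assert (Hrn : 0 < r / (2 * N)) by (apply Rdiv_lt_0_compat; lra).
assert (Hd : 0 < d) by (apply Rmin_glb_lt; lra).
assert (Hd1 : d <= 1 - t) by apply Rmin_l.
assert (HdN : d * N <= r / 2).
{ apply Rle_trans with (r / (2 * N) * N); [apply Rmult_le_compat_r; [lra | apply Rmin_r] |].
  right; field; lra. }
exists (gx (t + d)), (gy (t + d)).
assert (Hin : D (gx (t + d)) (gy (t + d))) by (apply HD; lra).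
split; [exact Hin |]; split.
- destruct (Req_dec (z (gx (t + d)) (gy (t + d))) 0) as [Heq|Hne].
  + assert (t + d <= t) by (apply Hub; split; [lra | exact Heq]); lra.
  + specialize (Hnn _ _ Hin); lra.
- unfold gx, gy.
  replace (x1 + (t + d) * (x0 - x1) - (x1 + t * (x0 - x1))) with (d * (x0 - x1)) by ring.
  replace (y1 + (t + d) * (y0 - y1) - (y1 + t * (y0 - y1))) with (d * (y0 - y1)) by ring.
  rewrite !Rabs_mult, (Rabs_pos_eq d) by lra.
  pose proof (Rabs_pos (x0 - x1)); pose proof (Rabs_pos (y0 - y1)).
  unfold N in HdN; split; nra.
Qed.

(** Around a positive point close to a zero, the ball that just reaches the nearest zero (p, q) has
    z > 0 inside. By Hopf's lemma z is at least kappa t at distance t from (p, q) along the radius.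
    The star at (p, q) is then at least kappa t, as its other values are nonnegative, which
    contradicts its order t^2. *)
Lemma strong_maximum (D : R -> R -> Prop) (z : R -> R -> R) (x0 y0 : R) :
  convex D -> open2 D -> seqcont D z ->
  (forall x y, D x y -> 0 <= z x y) ->
  (forall x y, D x y -> z x y = 0 -> elliptic_at z x y) ->
  D x0 y0 -> 0 < z x0 y0 -> forall x y, D x y -> 0 < z x y.
Proof.
intros Hconv Hopen Hz Hnn Hell H0 Hz0 x1 y1 H1.
apply Rnot_le_lt; intros Hle.
assert (Hz1 : z x1 y1 = 0) by (specialize (Hnn _ _ H1); lra).
destruct (first_contact D z x0 y0 x1 y1) as [a [b [Hab [Hzab Hc]]]]; auto.
destruct (Hell a b Hab Hzab) as [r1 [g [delta [Hr1 [Hmod Hl]]]]].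
destruct (Hopen a b Hab) as [r2 [Hr2 Hbox]].
set (r := Rmin (1 / 4) (Rmin r1 r2)).
assert (Hr : 0 < r /\ r <= 1 / 4 /\ r <= r1 /\ r <= r2).
{ unfold r; pose proof (Rmin_l (1 / 4) (Rmin r1 r2)); pose proof (Rmin_r (1 / 4) (Rmin r1 r2)).
  pose proof (Rmin_l r1 r2); pose proof (Rmin_r r1 r2).
  split; [repeat apply Rmin_glb_lt; lra | lra]. }
destruct (Hc (r / 4) ltac:(lra)) as [c1 [c2 [HDc [Hzc [Hc1 Hc2]]]]].
set (d0 := sqd c1 c2 a b).
assert (Hd0 : d0 <= (r / 2) ^ 2).
{ unfold d0, sqd; apply Rabs_def2 in Hc1, Hc2; nra. }
assert (Hball : forall x y, sqd c1 c2 x y <= d0 -> Rabs (x - a) < r /\ Rabs (y - b) < r).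
{ intros x y Hxy; destruct (sqd_close c1 c2 x y (3 / 4 * r)) as [Hx Hy]; [lra | nra |].
  apply Rabs_def2 in Hc1, Hc2, Hx, Hy; split; apply Rabs_def1; lra. }
assert (HballD : forall x y, sqd c1 c2 x y <= d0 -> D x y)
  by (intros x y Hxy; destruct (Hball x y Hxy); apply Hbox; lra).
(* The zero nearest to the centre; (a, b) is a competitor, so the search is confined to a closed
   ball inside [D]. *)
destruct (extreme_value_min (fun x y => sqd c1 c2 x y <= d0 /\ z x y = 0) (sqd c1 c2))
  as [p [q [[Hpq Hzpq] Hnear]]].
{ apply (sqd_bounded c1 c2 d0); intros x y [Hxy _]; exact Hxy. }
{ intros xn yn x y Hn Hx Hy.
  assert (Hle' : sqd c1 c2 x y <= d0).
  { apply (lim_le (fun n => sqd c1 c2 (xn n) (yn n)) (fun _ => d0));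
    [apply Hn | apply (sqd_cont c1 c2 (fun _ _ => True)); auto | apply is_lim_seq_const]. }
  split; [exact Hle' |].
  assert (Hlz : is_lim_seq (fun n => z (xn n) (yn n)) (z x y)).
  { apply Hz; auto; intros n; apply HballD, Hn. }
  apply (is_lim_seq_ext _ (fun _ => 0)) in Hlz; [| intros n; apply Hn].
  apply is_lim_seq_unique in Hlz; rewrite Lim_seq_const in Hlz; injection Hlz; auto. }
{ apply sqd_cont. }
{ exists a, b; split; [apply Rle_refl | exact Hzab]. }
set (s := sqd c1 c2 p q) in *.
assert (Hs : 0 < s).
{ destruct (Rle_lt_or_eq_dec 0 s (sqd_ge0 _ _ _ _)) as [|Heq]; [assumption |].
  unfold s, sqd in Heq.
  pose proof (pow2_ge_0 (p - c1)); pose proof (pow2_ge_0 (q - c2)).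
  assert (p - c1 = 0) by (apply Rsqr_0_uniq; unfold Rsqr; lra).
  assert (q - c2 = 0) by (apply Rsqr_0_uniq; unfold Rsqr; lra).
  replace p with c1 in Hzpq by lra; replace q with c2 in Hzpq by lra; lra. }
set (rad := sqrt s).
assert (Hrad2 : rad ^ 2 = s) by (apply pow2_sqrt; lra).
assert (Hrad0 : 0 < rad) by (apply sqrt_lt_R0, Hs).
assert (Hradr : rad <= r / 2).
{ apply Rsqr_incr_0; [unfold Rsqr; nra | lra | lra]. }
destruct (hopf z g delta c1 c2 rad) as [kappa [Hk Hhopf]]; auto.
{ lra. }
{ apply (seqcont_sub D); [| exact Hz]; intros x y Hxy; apply HballD; lra. }
{ intros x y Hxy; assert (HDx : D x y) by (apply HballD; lra).
  destruct (Req_dec (z x y) 0) as [Heq|Hne]; [| specialize (Hnn x y HDx); lra].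
  specialize (Hnear x y ltac:(split; [lra | exact Heq])); lra. }
{ intros x y Hxy; apply Hnn, HballD; lra. }
{ intros x y Hxy; destruct (Hball x y ltac:(lra)); apply Hl; lra. }
destruct (Hball p q Hpq) as [Hpa Hqb].
destruct (Hl p q ltac:(lra) ltac:(lra)) as [l [Hlap _]].
destruct (Hlap 1 Rlt_0_1) as [r3 [Hr3 Hr3']].
destruct (Hopen p q (HballD p q Hpq)) as [r4 [Hr4 Hbox4]].
set (e1 := (p - c1) / rad); set (e2 := (q - c2) / rad).
assert (He : e1 ^ 2 + e2 ^ 2 = 1).
{ unfold e1, e2; transitivity (s / rad ^ 2); [unfold s, sqd; field; lra | rewrite Hrad2; field; lra]. }
assert (He1 : Rabs e1 <= 1) by (apply Rabs_le; nra).
assert (He2 : Rabs e2 <= 1) by (apply Rabs_le; nra).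
(* Below kappa / (1 + |l|), kappa t exceeds the t^2 (1 + |l|) that the expansion with eps = 1
   allows. *)
set (t := Rmin (Rmin r3 r4) (Rmin rad (kappa / (1 + Rabs l))) / 2).
assert (Hkl : 0 < kappa / (1 + Rabs l)) by (apply Rdiv_lt_0_compat; pose proof (Rabs_pos l); lra).
assert (Ht : 0 < t /\ t < r3 /\ t < r4 /\ t <= rad / 2 /\ t < kappa / (1 + Rabs l)).
{ unfold t.
  pose proof (Rmin_l (Rmin r3 r4) (Rmin rad (kappa / (1 + Rabs l)))).
  pose proof (Rmin_r (Rmin r3 r4) (Rmin rad (kappa / (1 + Rabs l)))).
  pose proof (Rmin_l r3 r4); pose proof (Rmin_r r3 r4).
  pose proof (Rmin_l rad (kappa / (1 + Rabs l))); pose proof (Rmin_r rad (kappa / (1 + Rabs l))).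
  assert (0 < Rmin (Rmin r3 r4) (Rmin rad (kappa / (1 + Rabs l)))) by (repeat apply Rmin_glb_lt; lra).
  lra. }
destruct Ht as [Ht0 [Ht3 [Ht4 [Htr Htk]]]].
assert (Hab1 : Rabs (t * e1) <= t) by (rewrite Rabs_mult, (Rabs_pos_eq t) by lra; nra).
assert (Hab2 : Rabs (t * e2) <= t) by (rewrite Rabs_mult, (Rabs_pos_eq t) by lra; nra).
specialize (Hr3' (t * e1) (t * e2) ltac:(lra) ltac:(lra)).
specialize (Hhopf e1 e2 t He ltac:(lra)).
replace (c1 + (rad - t) * e1) with (p - t * e1) in Hhopf by (unfold e1; field; lra).
replace (c2 + (rad - t) * e2) with (q - t * e2) in Hhopf by (unfold e2; field; lra).
assert (Hn4 : forall A B, Rabs A < r4 -> Rabs B < r4 -> 0 <= z (p + A) (q + B)).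
{ intros A B HA HB; apply Hnn, Hbox4; [replace (p + A - p) with A by ring | replace (q + B - q) with B by ring]; assumption. }
assert (Hstar : kappa * t <= star z p q (t * e1) (t * e2)).
{ unfold star; rewrite Hzpq.
  pose proof (Hn4 (t * e1) (t * e2) ltac:(lra) ltac:(lra)).
  pose proof (Hn4 (- (t * e2)) (t * e1) ltac:(rewrite Rabs_Ropp; lra) ltac:(lra)).
  pose proof (Hn4 (t * e2) (- (t * e1)) ltac:(lra) ltac:(rewrite Rabs_Ropp; lra)).
  unfold Rminus in *; lra. }
replace ((t * e1) ^ 2 + (t * e2) ^ 2) with (t ^ 2) in Hr3'
  by (transitivity (t ^ 2 * (e1 ^ 2 + e2 ^ 2)); [rewrite He; ring | ring]).
apply Rabs_le_between in Hr3'; pose proof (Rle_abs l).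
assert (Hfin : kappa * t <= t ^ 2 * (1 + Rabs l)).
{ assert (0 <= t ^ 2 * (Rabs l - l)) by (apply Rmult_le_pos; [apply pow2_ge_0 | lra]); lra. }
assert (kappa <= t * (1 + Rabs l)) by (apply (Rmult_le_reg_r t); lra).
assert (t * (1 + Rabs l) < kappa); [| lra].
apply Rlt_le_trans with (kappa / (1 + Rabs l) * (1 + Rabs l)).
- apply Rmult_lt_compat_r; [pose proof (Rabs_pos l); lra | exact Htk].
- right; field; pose proof (Rabs_pos l); lra.
Qed.

(** * Solutions in a strip and vertical reflections *)

(** The derivatives are carried as functions continuous on [S], hence up to the edge, while the
    derivative relations hold in the open strip only. [uxy] stands for both mixed derivatives. [S]
    is the half-open strip in the sliding argument and the closed one before the strip is turned
    upside down. *)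
Record c2_solution (S : R -> R -> Prop) (H : R) (f : R -> R)
  (u ux uy uxx uxy uyy : R -> R -> R) : Prop := {
  sol_u : seqcont S u;
  sol_ux : seqcont S ux;
  sol_uy : seqcont S uy;
  sol_uxx : seqcont S uxx;
  sol_uxy : seqcont S uxy;
  sol_uyy : seqcont S uyy;
  sol_dx : forall x y, 0 < y < H -> is_derive (fun s => u s y) x (ux x y);
  sol_dy : forall x y, 0 < y < H -> is_derive (fun t => u x t) y (uy x y);
  sol_dxx : forall x y, 0 < y < H -> is_derive (fun s => ux s y) x (uxx x y);
  sol_dxy : forall x y, 0 < y < H -> is_derive (fun t => ux x t) y (uxy x y);
  sol_dyx : forall x y, 0 < y < H -> is_derive (fun s => uy s y) x (uxy x y);
  sol_dyy : forall x y, 0 < y < H -> is_derive (fun t => uy x t) y (uyy x y);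
  sol_eq : forall x y, 0 < y < H -> - (uxx x y + uyy x y) = f (u x y);
  sol_pos : forall x y, 0 < y < H -> 0 < u x y;
  sol_zero : forall x, u x 0 = 0 }.

Arguments sol_u {S H f u ux uy uxx uxy uyy} _.
Arguments sol_ux {S H f u ux uy uxx uxy uyy} _.
Arguments sol_uy {S H f u ux uy uxx uxy uyy} _.
Arguments sol_dx {S H f u ux uy uxx uxy uyy} _.
Arguments sol_dy {S H f u ux uy uxx uxy uyy} _.
Arguments sol_eq {S H f u ux uy uxx uxy uyy} _.
Arguments sol_pos {S H f u ux uy uxx uxy uyy} _.
Arguments sol_zero {S H f u ux uy uxx uxy uyy} _.

Definition half_open (H : R) (x y : R) : Prop := 0 <= y < H.

(** The part common to both alternatives of the theorem, enough wherever the functions compared are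
    positive. *)
Definition osgood_everywhere (f : R -> R) : Prop :=
  forall tbar, 0 < tbar -> one_sided_osgood f tbar.

Lemma box_strip (H y : R) :
  0 < y < H -> exists r, 0 < r /\ forall y', Rabs (y' - y) < r -> 0 < y' < H.
Proof.
intros Hy; exists (Rmin y (H - y)); split; [apply Rmin_glb_lt; lra |].
intros y' Hy'; pose proof (Rmin_l y (H - y)); pose proof (Rmin_r y (H - y)).
apply Rabs_def2 in Hy'; lra.
Qed.

Lemma seqcont_continuity_2d (H : R) (v : R -> R -> R) (x y : R) :
  seqcont (half_open H) v -> 0 < y < H -> continuity_2d_pt v x y.
Proof.
intros Hv Hy eps; destruct (box_strip H y Hy) as [r [Hr Hbox]].
destruct (seqcont_eps _ v x y Hv ltac:(unfold half_open; lra) eps (cond_pos eps)) as [d [Hd Hd']].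
assert (Hm : 0 < Rmin r d) by (now apply Rmin_glb_lt).
exists (mkposreal _ Hm); simpl; intros x' y' Hx' Hy'.
pose proof (Rmin_l r d); pose proof (Rmin_r r d).
specialize (Hbox y' ltac:(lra)); apply Hd'; unfold half_open; lra.
Qed.

Section Solution.

Variables (H : R) (f : R -> R) (u ux uy uxx uxy uyy : R -> R -> R).
Hypothesis sol : c2_solution (half_open H) H f u ux uy uxx uxy uyy.

Lemma sol_differentiable (x y : R) :
  0 < y < H -> differentiable_pt_lim u x y (ux x y) (uy x y).
Proof.
intros Hy; destruct (box_strip H y Hy) as [r [Hr Hbox]].
apply (differentiable_of_partials u ux uy x y r Hr).
- intros x' y' _ Hy'; specialize (Hbox y' Hy').
  split; [apply (sol_dx sol) | apply (sol_dy sol)]; exact Hbox.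
- apply (seqcont_continuity_2d H); [apply (sol_ux sol) | exact Hy].
- apply (seqcont_continuity_2d H); [apply (sol_uy sol) | exact Hy].
Qed.

Lemma sol_lap (x y : R) : 0 < y < H -> lap u x y (- f (u x y)).
Proof.
intros Hy; rewrite <- (sol_eq sol x y Hy), Ropp_involutive.
destruct (box_strip H y Hy) as [r [Hr Hbox]].
assert (Hc : forall v, seqcont (half_open H) v -> forall x' y', Rabs (y' - y) < r -> continuity_2d_pt v x' y').
{ intros v Hv x' y' Hy'; apply (seqcont_continuity_2d H); auto. }
assert (Hyy : Rabs (y - y) < r) by (rewrite Rminus_diag, Rabs_R0; exact Hr).
destruct sol as [_ _ _ Cxx Cxy Cyy _ _ Dxx Dxy Dyx Dyy _ _ _].
apply (lap_of_C2 u ux uy uxx uxy uxy uyy x y r Hr); auto.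
intros x' y' _ Hy'; specialize (Hbox y' Hy').
destruct (box_strip H y' Hbox) as [r' [Hr' Hbox']].
split; [now apply sol_differentiable |].
split; apply (differentiable_of_partials _ _ _ x' y' r' Hr'); auto;
intros x'' y'' _ Hy''; specialize (Hbox' y'' Hy''); auto.
Qed.

(** Near a contact point both functions stay within delta / 2 of their common value, so w <= v gives
    lap (v - w) = f w - f v <= g (v - w). *)
Lemma elliptic_osgood (v w : R -> R -> R) (x y r : R) :
  0 < r ->
  seqcont (fun x' y' => Rabs (x' - x) < r /\ Rabs (y' - y) < r) v ->
  seqcont (fun x' y' => Rabs (x' - x) < r /\ Rabs (y' - y) < r) w ->
  (forall x' y', Rabs (x' - x) < r -> Rabs (y' - y) < r ->
     lap v x' y' (- f (v x' y')) /\ lap w x' y' (- f (w x' y'))) ->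
  (forall x' y', Rabs (x' - x) < r -> Rabs (y' - y) < r -> 0 <= w x' y') ->
  w x y = v x y -> one_sided_osgood f (v x y) ->
  exists (r' : R) (g : R -> R) (delta : R), 0 < r' /\ modulus g delta /\
    forall x' y', Rabs (x' - x) < r' -> Rabs (y' - y) < r' -> w x' y' <= v x' y' ->
      exists l, lap (fun s t => v s t - w s t) x' y' l /\ l <= g (v x' y' - w x' y').
Proof.
intros Hr Hv Hw Hlap Hnn Heq Hos.
destruct (osgood_modulus f _ Hos) as [delta [g [Hmod Hg]]].
assert (Hd : 0 < delta) by apply Hmod.
assert (Hin : Rabs (x - x) < r /\ Rabs (y - y) < r) by (rewrite !Rminus_diag, Rabs_R0; lra).
destruct (seqcont_eps _ v x y Hv Hin (delta / 2) ltac:(lra)) as [d1 [Hd1 H1]].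
destruct (seqcont_eps _ w x y Hw Hin (delta / 2) ltac:(lra)) as [d2 [Hd2 H2]].
exists (Rmin r (Rmin d1 d2)), g, delta.
split; [repeat apply Rmin_glb_lt; lra |]; split; [exact Hmod |].
intros x' y' Hx' Hy' Hle.
pose proof (Rmin_l r (Rmin d1 d2)); pose proof (Rmin_r r (Rmin d1 d2)).
pose proof (Rmin_l d1 d2); pose proof (Rmin_r d1 d2).
destruct (Hlap x' y') as [Lv Lw]; try lra.
exists (- f (v x' y') - - f (w x' y')); split; [now apply lap_sub |].
specialize (H1 x' y' ltac:(lra) ltac:(lra) ltac:(lra)).
specialize (H2 x' y' ltac:(lra) ltac:(lra) ltac:(lra)).
specialize (Hg (w x' y') (v x' y') Hle (Hnn x' y' ltac:(lra) ltac:(lra))).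
rewrite <- Heq in Hg at 1; lra.
Qed.

(** A contact value is positive because [w] is, so [osgood_everywhere] covers it. *)
Lemma strong_comparison (D : R -> R -> Prop) (v w : R -> R -> R) (x0 y0 : R) :
  osgood_everywhere f -> convex D -> open2 D -> seqcont D v -> seqcont D w ->
  (forall x y, D x y -> lap v x y (- f (v x y)) /\ lap w x y (- f (w x y))) ->
  (forall x y, D x y -> 0 < w x y /\ w x y <= v x y) ->
  D x0 y0 -> w x0 y0 < v x0 y0 -> forall x y, D x y -> w x y < v x y.
Proof.
intros Hos Hconv Hopen Hv Hw Hlap Hle H0 Hlt x y Hxy.
assert (0 < v x y - w x y); [| lra].
apply (strong_maximum D (fun s t => v s t - w s t) x0 y0); auto; [| | | lra].
- intros xn yn x' y' Hn Hxy' Hx' Hy'; apply is_lim_seq_minus'; auto.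
- intros x' y' Hxy'; specialize (Hle x' y' Hxy'); lra.
- intros a b Hab Heq.
  destruct (Hopen a b Hab) as [r [Hr Hbox]].
  destruct (elliptic_osgood v w a b r Hr) as [r' [g [delta [Hr' [Hmod Hl]]]]].
  + apply (seqcont_sub D); [intros x' y' [? ?]; auto | exact Hv].
  + apply (seqcont_sub D); [intros x' y' [? ?]; auto | exact Hw].
  + intros x' y' Hx' Hy'; apply Hlap; auto.
  + intros x' y' Hx' Hy'; apply Rlt_le, Hle; auto.
  + lra.
  + apply Hos; destruct (Hle a b Hab); lra.
  + exists (Rmin r r'), g, delta; split; [now apply Rmin_glb_lt |]; split; [exact Hmod |].
    pose proof (Rmin_l r r'); pose proof (Rmin_r r r').
    intros x' y' Hx' Hy'; apply Hl; try lra.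
    apply Hle, Hbox; lra.
Qed.

Lemma sol_lap_reflected (s x y : R) :
  0 < 2 * s - y < H -> lap (fun x y => u x (2 * s - y)) x y (- f (u x (2 * s - y))).
Proof.
intros Hy.
apply (lap_ext_loc (fun x y => u (1 * x + 0 * y + 0) (0 * x - 1 * y + 2 * s)) _ x y _ 1 Rlt_0_1).
- intros x' y' _ _; f_equal; ring.
- apply lap_isom; [ring |].
  replace (1 * x + 0 * y + 0) with x by ring; replace (0 * x - 1 * y + 2 * s) with (2 * s - y) by ring.
  now apply sol_lap.
Qed.

Lemma seqcont_reflected (s : R) :
  seqcont (fun x y => half_open H x (2 * s - y)) (fun x y => u x (2 * s - y)).
Proof.
intros xn yn x y Hn Hxy Hx Hy; apply (sol_u sol); auto.
apply is_lim_seq_minus'; [apply is_lim_seq_const | exact Hy].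
Qed.

Definition reflect_le (s : R) : Prop :=
  forall x y, 0 <= y <= s -> u x y <= u x (2 * s - y).

Lemma reflect_lt (s x y : R) :
  osgood_everywhere f -> 0 < s -> 2 * s < H -> reflect_le s ->
  0 < y < s -> u x y < u x (2 * s - y).
Proof.
intros Hos Hs HsH Hle Hy.
(* The strong principle needs one point of strict inequality: close to the edge u is small, while
   its mirror value is close to u 0 (2 s) > 0. *)
assert (Hsmall : exists d, 0 < d < s /\ u 0 d < u 0 (2 * s - d)).
{ destruct sol as [Cu _ _ _ _ _ _ _ _ _ _ _ _ Hpos Hzero].
  assert (Hp : 0 < u 0 (2 * s)) by (apply Hpos; lra).
  destruct (seqcont_eps _ u 0 0 Cu ltac:(unfold half_open; lra) (u 0 (2 * s) / 2) ltac:(lra))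
    as [d1 [Hd1 H1]].
  destruct (seqcont_eps _ u 0 (2 * s) Cu ltac:(unfold half_open; lra) (u 0 (2 * s) / 2) ltac:(lra))
    as [d2 [Hd2 H2]].
  set (d := Rmin s (Rmin d1 d2) / 2).
  assert (Hd : 0 < d /\ d < s /\ d < d1 /\ d < d2).
  { unfold d; pose proof (Rmin_l s (Rmin d1 d2)); pose proof (Rmin_r s (Rmin d1 d2)).
    pose proof (Rmin_l d1 d2); pose proof (Rmin_r d1 d2).
    assert (0 < Rmin s (Rmin d1 d2)) by (repeat apply Rmin_glb_lt; lra); lra. }
  exists d; split; [lra |].
  specialize (H1 0 d ltac:(unfold half_open; lra) ltac:(rewrite Rminus_diag, Rabs_R0; lra)
    ltac:(rewrite Rminus_0_r, Rabs_pos_eq; lra)).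
  specialize (H2 0 (2 * s - d) ltac:(unfold half_open; lra) ltac:(rewrite Rminus_diag, Rabs_R0; lra)
    ltac:(replace (2 * s - d - 2 * s) with (- d) by ring; rewrite Rabs_Ropp, Rabs_pos_eq; lra)).
  rewrite Hzero in H1; apply Rabs_def2 in H1, H2; lra. }
destruct Hsmall as [d [Hd Hlt]].
apply (strong_comparison (fun _ y => 0 < y < s) (fun x y => u x (2 * s - y)) u 0 d Hos); auto.
- intros x1 y1 x2 y2 t H1 H2 Ht.
  assert (0 <= t * y2 /\ 0 <= (1 - t) * y1) by (split; apply Rmult_le_pos; lra).
  assert (0 <= t * (s - y2) /\ 0 <= (1 - t) * (s - y1)) by (split; apply Rmult_le_pos; lra).
  destruct (Rle_lt_dec t (1 / 2)); [assert (0 < (1 - t) * y1) by (apply Rmult_lt_0_compat; lra);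
    assert (0 < (1 - t) * (s - y1)) by (apply Rmult_lt_0_compat; lra)
   | assert (0 < t * y2) by (apply Rmult_lt_0_compat; lra);
    assert (0 < t * (s - y2)) by (apply Rmult_lt_0_compat; lra)]; lra.
- intros x' y' Hy'; destruct (box_strip s y' Hy') as [r [Hr Hbox]].
  exists r; split; [exact Hr | auto].
- apply (seqcont_sub _ _ _) with (2 := seqcont_reflected s); unfold half_open; intros; lra.
- apply (seqcont_sub (half_open H)); [unfold half_open; intros; lra | apply (sol_u sol)].
- intros x' y' Hy'; split; [apply sol_lap_reflected | apply sol_lap]; lra.
- intros x' y' Hy'; split; [apply (sol_pos sol) | apply Hle]; lra.
Qed.

(** Hopf's lemma for the reflected function minus [u], in a ball tangent to y = s from below: u x (s
    + t) - u x (s - t) >= k t, and the left side is 2 t uy x s to first order. *)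
Lemma reflect_slope (s x : R) :
  osgood_everywhere f -> 0 < s -> 2 * s < H -> reflect_le s -> 0 < uy x s.
Proof.
intros Hos Hs HsH Hle.
set (v := fun x y => u x (2 * s - y)).
assert (Hvs : forall x, v x s = u x s) by (intros a; unfold v; f_equal; ring).
destruct (elliptic_osgood v u x s s Hs) as [r [g [delta [Hr [Hmod Hl]]]]].
{ apply (seqcont_sub _ _ _) with (2 := seqcont_reflected s); unfold half_open.
  intros x' y' [_ Hy']; apply Rabs_def2 in Hy'; lra. }
{ apply (seqcont_sub (half_open H)); [| apply (sol_u sol)].
  intros x' y' [_ Hy']; unfold half_open; apply Rabs_def2 in Hy'; lra. }
{ intros x' y' _ Hy'; apply Rabs_def2 in Hy'.
  split; [apply sol_lap_reflected | apply sol_lap]; lra. }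
{ intros x' y' _ Hy'; apply Rabs_def2 in Hy'; apply Rlt_le, (sol_pos sol); lra. }
{ now rewrite Hvs. }
{ rewrite Hvs; apply Hos, (sol_pos sol); lra. }
set (rad := Rmin (1 / 2) (Rmin s r) / 4).
assert (Hrad : 0 < rad /\ rad <= 1 / 2 /\ 4 * rad <= s /\ 4 * rad <= r).
{ unfold rad; pose proof (Rmin_l (1 / 2) (Rmin s r)); pose proof (Rmin_r (1 / 2) (Rmin s r)).
  pose proof (Rmin_l s r); pose proof (Rmin_r s r).
  assert (0 < Rmin (1 / 2) (Rmin s r)) by (repeat apply Rmin_glb_lt; lra); lra. }
assert (Hball : forall x' y', sqd x (s - rad) x' y' <= rad ^ 2 ->
  Rabs (x' - x) < r /\ Rabs (y' - s) < r /\ 0 < y' <= s).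
{ intros x' y' Hxy; unfold sqd in Hxy.
  assert (Ha : Rabs (x' - x) <= rad) by (apply Rabs_le; pose proof (pow2_ge_0 (y' - (s - rad))); nra).
  assert (Hb : Rabs (y' - (s - rad)) <= rad) by (apply Rabs_le; pose proof (pow2_ge_0 (x' - x)); nra).
  apply Rabs_le_between in Hb.
  split; [lra |]; split; [apply Rabs_def1; lra | lra]. }
destruct (hopf (fun x y => v x y - u x y) g delta x (s - rad) rad) as [k [Hk Hh]]; [lra | exact Hmod | | | | |].
- intros xn yn x' y' Hn Hxy Hx Hy; apply is_lim_seq_minus'.
  + apply (seqcont_reflected s); auto; unfold half_open; intros;
    [specialize (Hn n); destruct (Hball _ _ Hn) | destruct (Hball _ _ Hxy)]; lra.
  + apply (sol_u sol); auto; unfold half_open; intros;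
    [specialize (Hn n); destruct (Hball _ _ Hn) | destruct (Hball _ _ Hxy)]; lra.
- intros x' y' Hxy; destruct (Hball x' y' ltac:(lra)) as [_ [_ Hy']].
  assert (y' <> s).
  { intros ->; unfold sqd in Hxy; replace (s - (s - rad)) with rad in Hxy by ring.
    pose proof (pow2_ge_0 (x' - x)); lra. }
  assert (u x' y' < v x' y') by (apply reflect_lt; auto; lra); lra.
- intros x' y' Hxy; destruct (Hball x' y' ltac:(lra)) as [_ [_ Hy']].
  assert (u x' y' <= v x' y') by (apply Hle; lra); lra.
- intros x' y' Hxy; destruct (Hball x' y' ltac:(lra)) as [Hx' [Hy'' Hy']].
  apply Hl; auto; apply Hle; lra.
- apply Rnot_le_lt; intros Hneg.
  destruct (is_derive_eps (fun t => u x t) s (uy x s)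
    (sol_dy sol x s ltac:(lra)) (k / 4) ltac:(lra)) as [d [Hd Hd']].
  set (t := Rmin d rad / 2).
  assert (Ht : 0 < t /\ t < d /\ t <= rad / 2).
  { unfold t; pose proof (Rmin_l d rad); pose proof (Rmin_r d rad).
    assert (0 < Rmin d rad) by (apply Rmin_glb_lt; lra); lra. }
  specialize (Hh 0 1 t ltac:(ring) ltac:(lra)).
  replace (x + (rad - t) * 0) with x in Hh by ring.
  replace (s - rad + (rad - t) * 1) with (s - t) in Hh by ring.
  unfold v in Hh; replace (2 * s - (s - t)) with (s + t) in Hh by ring.
  pose proof (Hd' t ltac:(rewrite Rabs_pos_eq; lra)) as P1.
  pose proof (Hd' (- t) ltac:(rewrite Rabs_Ropp, Rabs_pos_eq; lra)) as P2.
  rewrite Rabs_Ropp in P2; rewrite (Rabs_pos_eq t) in P1, P2 by lra.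
  apply Rabs_le_between in P1, P2.
  replace (s + - t) with (s - t) in P2 by ring.
  assert (uy x s * t <= 0) by nra.
  assert (0 < k * t) by (apply Rmult_lt_0_compat; lra).
  lra.
Qed.

End Solution.

Arguments sol_lap {H f u ux uy uxx uxy uyy} _.
Arguments sol_differentiable {H f u ux uy uxx uxy uyy} _.
Arguments reflect_lt {H f u ux uy uxx uxy uyy} _.
Arguments reflect_slope {H f u ux uy uxx uxy uyy} _.

(** * Behaviour at the bottom *)

(** [vx] is a derivative only for y > 0, so v = 0 on the edge cannot be differentiated directly. If
    vx x 0 <> 0, [v] would vary by at least h |vx x 0| / 2 along horizontal segments of fixed length
    h just above the edge, yet it tends to 0 at both endpoints. *)
Lemma tangential_zero (H : R) (v vx : R -> R -> R) (x : R) :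
  0 < H -> seqcont (half_open H) v -> seqcont (half_open H) vx ->
  (forall x y, 0 < y < H -> is_derive (fun s => v s y) x (vx x y)) ->
  (forall x, v x 0 = 0) -> vx x 0 = 0.
Proof.
intros HH Hv Hvx Hd H0; apply NNPP; intros Hne.
set (a := Rabs (vx x 0)).
assert (Ha : 0 < a) by now apply Rabs_pos_lt.
assert (Hin : forall x, half_open H x 0) by (unfold half_open; intros; lra).
destruct (seqcont_eps _ vx x 0 Hvx (Hin x) (a / 2) ltac:(lra)) as [d [Hd0 Hd']].
set (h := d / 2).
assert (Hh : 0 < h < d) by (unfold h; lra).
destruct (seqcont_eps _ v x 0 Hv (Hin x) (h * a / 8)) as [d1 [Hd1 H1]];
  [assert (0 < h * a) by (apply Rmult_lt_0_compat; lra); lra |].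
destruct (seqcont_eps _ v (x + h) 0 Hv (Hin (x + h)) (h * a / 8)) as [d2 [Hd2 H2]];
  [assert (0 < h * a) by (apply Rmult_lt_0_compat; lra); lra |].
set (y := Rmin (Rmin H d) (Rmin d1 d2) / 2).
assert (Hy : 0 < y /\ y < H /\ y < d /\ y < d1 /\ y < d2).
{ unfold y; pose proof (Rmin_l (Rmin H d) (Rmin d1 d2)); pose proof (Rmin_r (Rmin H d) (Rmin d1 d2)).
  pose proof (Rmin_l d1 d2); pose proof (Rmin_r d1 d2); pose proof (Rmin_l H d); pose proof (Rmin_r H d).
  assert (0 < Rmin (Rmin H d) (Rmin d1 d2)) by (repeat apply Rmin_glb_lt; lra); lra. }
assert (Hys : half_open H x y /\ half_open H (x + h) y) by (unfold half_open; lra).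
assert (Hyabs : Rabs (y - 0) = y) by (rewrite Rminus_0_r, Rabs_pos_eq; lra).
specialize (H1 x y ltac:(tauto) ltac:(rewrite Rminus_diag, Rabs_R0; lra) ltac:(rewrite Hyabs; lra)).
specialize (H2 (x + h) y ltac:(tauto) ltac:(rewrite Rminus_diag, Rabs_R0; lra) ltac:(rewrite Hyabs; lra)).
rewrite H0 in H1, H2.
destruct (mvt_le (fun s => v s y) (fun s => vx s y) x (x + h)) as [c [Hc Heq]]; [lra | |].
{ intros t _; apply Hd; lra. }
simpl in Heq.
specialize (Hd' c y ltac:(unfold half_open; lra) ltac:(rewrite Rabs_pos_eq; lra) ltac:(rewrite Hyabs; lra)).
pose proof (Rabs_triang_inv (vx x 0) (vx x 0 - vx c y)) as HT.
replace (vx x 0 - (vx x 0 - vx c y)) with (vx c y) in HT by ring.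
rewrite (Rabs_minus_sym (vx x 0) (vx c y)) in HT; fold a in HT.
assert (HA : h * (a / 2) <= Rabs (v (x + h) y - v x y)).
{ rewrite Heq, Rabs_mult; replace (x + h - x) with h by ring; rewrite (Rabs_pos_eq h), Rmult_comm by lra.
  apply Rmult_le_compat_r; lra. }
pose proof (Rabs_triang (v (x + h) y - 0) (- (v x y - 0))) as HT2.
rewrite Rabs_Ropp in HT2.
replace (v (x + h) y - 0 + - (v x y - 0)) with (v (x + h) y - v x y) in HT2 by ring.
assert (0 < h * a) by (apply Rmult_lt_0_compat; lra); lra.
Qed.

Section Boundary.

Variables (H : R) (f : R -> R) (u ux uy uxx uxy uyy : R -> R -> R).
Hypothesis sol : c2_solution (half_open H) H f u ux uy uxx uxy uyy.
Hypothesis H_pos : 0 < H.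

Lemma bottom_in (x : R) : half_open H x 0.
Proof. unfold half_open; lra. Qed.

(** The mean value bound is taken on [y_n, y0] with y_n tending to 0, as [vy] is a derivative for y
    > 0 only. *)
Lemma bottom_mvt (v vy : R -> R -> R) (x y0 : R) :
  0 < y0 < H -> seqcont (half_open H) v ->
  (forall x y, 0 < y < H -> is_derive (fun t => v x t) y (vy x y)) ->
  forall a, (forall y, 0 < y <= y0 -> vy x y <= a) -> v x y0 <= v x 0 + a * y0.
Proof.
intros Hy0 Hv Hd a Ha.
assert (Hn : forall n, 0 < y0 * / (INR n + 1) <= y0).
{ intros n; apply scaled_inv_nat; lra. }
apply (lim_le (fun _ => v x y0) (fun n => v x (y0 * / (INR n + 1)) + a * (y0 - y0 * / (INR n + 1)))).
- intros n; specialize (Hn n); set (y := y0 * / (INR n + 1)) in *.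
  destruct (mvt_le (fun t => v x t) (fun t => vy x t) y y0) as [c [Hc Heq]]; [lra | |].
  + intros t Ht; apply Hd; lra.
  + specialize (Ha c ltac:(lra)); simpl in Heq.
    assert (0 <= (a - vy x c) * (y0 - y)) by (apply Rmult_le_pos; lra); lra.
- apply is_lim_seq_const.
- assert (Hl : is_lim_seq (fun n => y0 * / (INR n + 1)) 0).
  { apply scaled_inv_lim. }
  replace (v x 0 + a * y0) with (v x 0 + a * (y0 - 0)) by ring.
  apply is_lim_seq_plus'.
  + apply Hv; [intros n; specialize (Hn n); unfold half_open; lra | apply bottom_in | apply is_lim_seq_const | exact Hl].
  + apply is_lim_seq_mul; [apply is_lim_seq_const |].
    apply is_lim_seq_minus'; [apply is_lim_seq_const | exact Hl].
Qed.

Lemma bottom_slope (x k : R) :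
  uy x 0 < k -> exists d, 0 < d /\ forall t, 0 < t <= d -> t < H /\ u x t <= k * t.
Proof.
intros Hk.
destruct (seqcont_eps _ uy x 0 (sol_uy sol) (bottom_in x) (k - uy x 0) ltac:(lra))
  as [d [Hd Hd']].
exists (Rmin d H / 2).
pose proof (Rmin_l d H); pose proof (Rmin_r d H).
assert (0 < Rmin d H) by (apply Rmin_glb_lt; lra).
split; [lra |]; intros t Ht; split; [lra |].
replace (k * t) with (u x 0 + k * t) by (rewrite (sol_zero sol); ring).
apply (bottom_mvt u uy); [lra | apply (sol_u sol) | apply (sol_dy sol) |].
intros y Hy.
specialize (Hd' x y ltac:(unfold half_open; lra) ltac:(rewrite Rminus_diag, Rabs_R0; lra)
  ltac:(rewrite Rminus_0_r, Rabs_pos_eq; lra)).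
apply Rabs_def2 in Hd'; lra.
Qed.

Lemma bottom_slope_nonneg (x : R) : 0 <= uy x 0.
Proof.
apply Rnot_lt_le; intros Hneg.
destruct (bottom_slope x (uy x 0 / 2) ltac:(lra)) as [d [Hd Hd']].
destruct (Hd' d ltac:(lra)) as [HdH Hu].
pose proof (sol_pos sol x d ltac:(lra)).
assert (0 < (- uy x 0 / 2) * d) by (apply Rmult_lt_0_compat; lra); lra.
Qed.

(** Hopf's lemma for [u] itself, in a ball tangent to the edge from above: u x t >= k t for small t
    excludes a slope at the edge that is not positive. *)
Lemma bottom_hopf (x : R) :
  continuous_on (fun t => 0 <= t) f -> 0 <= f 0 -> (f 0 = 0 -> one_sided_osgood f 0) ->
  0 < uy x 0.
Proof.
intros Hf H0 Hos.
(* As lap u = - f u, Hopf's lemma asks for - f t <= g t at small t > 0. If f 0 = 0 this is the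
   Osgood bound between 0 and t; if f 0 > 0, continuity makes f positive there and g = 0 will do. *)
assert (Hg : exists (g : R -> R) (delta eta : R), modulus g delta /\ 0 < eta /\
  forall t, 0 < t < eta -> - f t <= g t).
{ destruct (Req_dec (f 0) 0) as [Hf0|Hf0].
  - destruct (osgood_modulus f 0 (Hos Hf0)) as [delta [g [Hmod Hg]]].
    assert (Hd : 0 < delta) by apply Hmod.
    exists g, delta, (delta / 2); split; [exact Hmod |]; split; [lra |]; intros t Ht.
    specialize (Hg 0 t ltac:(lra) ltac:(lra) ltac:(rewrite Rminus_diag, Rabs_R0; lra)
      ltac:(rewrite Rminus_0_r, Rabs_pos_eq; lra)).
    rewrite Rminus_0_r in Hg; lra.
  - destruct (Hf 0 (Rle_refl 0) (fun y => 0 < y)) as [eta Heta].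
    { exists (mkposreal (f 0) ltac:(lra)); intros y Hy; apply Rabs_def2 in Hy.
      unfold minus, plus, opp in Hy; simpl in Hy; lra. }
    exists (fun _ => 0), 1, eta; split; [apply modulus_zero; [lra | auto] |].
    split; [apply cond_pos |]; intros t Ht.
    assert (0 < f t); [| lra].
    apply Heta; [| lra].
    unfold ball; simpl; unfold AbsRing_ball, abs, minus, plus, opp; simpl.
    rewrite Ropp_0, Rplus_0_r, Rabs_pos_eq; lra. }
destruct Hg as [g [delta [eta [Hmod [Heta Hg]]]]].
destruct (seqcont_eps _ u x 0 (sol_u sol) (bottom_in x) eta Heta) as [r [Hr Hr']].
set (rad := Rmin (1 / 2) (Rmin H r) / 4).
assert (Hrad : 0 < rad /\ rad <= 1 / 2 /\ 4 * rad <= H /\ 4 * rad <= r).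
{ unfold rad; pose proof (Rmin_l (1 / 2) (Rmin H r)); pose proof (Rmin_r (1 / 2) (Rmin H r)).
  pose proof (Rmin_l H r); pose proof (Rmin_r H r).
  assert (0 < Rmin (1 / 2) (Rmin H r)) by (repeat apply Rmin_glb_lt; lra); lra. }
assert (Hball : forall x' y', sqd x rad x' y' <= rad ^ 2 -> Rabs (x' - x) < r /\ 0 <= y' <= 2 * rad).
{ intros x' y' Hxy; unfold sqd in Hxy.
  assert (Ha : Rabs (x' - x) <= rad) by (apply Rabs_le; pose proof (pow2_ge_0 (y' - rad)); nra).
  assert (Hb : Rabs (y' - rad) <= rad) by (apply Rabs_le; pose proof (pow2_ge_0 (x' - x)); nra).
  apply Rabs_le_between in Hb; split; lra. }
assert (Hball' : forall x' y', sqd x rad x' y' < rad ^ 2 -> 0 < y').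
{ intros x' y' Hxy; destruct (Hball x' y' ltac:(lra)) as [_ Hy'].
  assert (y' <> 0); [| lra]; intros ->; unfold sqd in Hxy; pose proof (pow2_ge_0 (x' - x)); nra. }
destruct (hopf u g delta x rad rad) as [k [Hk Hh]]; [lra | exact Hmod | | | | |].
- apply (seqcont_sub (half_open H)); [| apply (sol_u sol)].
  intros x' y' Hxy; destruct (Hball _ _ Hxy); unfold half_open; lra.
- intros x' y' Hxy; specialize (Hball' _ _ Hxy); destruct (Hball x' y' ltac:(lra)).
  apply (sol_pos sol); lra.
- intros x' y' Hxy; destruct (Hball x' y' ltac:(lra)).
  destruct (Req_dec y' 0) as [->|]; [rewrite (sol_zero sol); lra |].
  apply Rlt_le, (sol_pos sol); lra.
- intros x' y' Hxy; specialize (Hball' _ _ Hxy); destruct (Hball x' y' ltac:(lra)).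
  exists (- f (u x' y')); split; [apply (sol_lap sol); lra |].
  apply Hg; split; [apply (sol_pos sol); lra |].
  specialize (Hr' x' y' ltac:(unfold half_open; lra) ltac:(lra) ltac:(rewrite Rminus_0_r, Rabs_pos_eq; lra)).
  rewrite (sol_zero sol) in Hr'; apply Rabs_def2 in Hr'; lra.
- apply Rnot_le_lt; intros Hneg.
  destruct (bottom_slope x (k / 2) ltac:(lra)) as [d [Hd Hd']].
  set (t := Rmin d rad / 2).
  assert (Ht : 0 < t /\ t < d /\ t <= rad / 2).
  { unfold t; pose proof (Rmin_l d rad); pose proof (Rmin_r d rad).
    assert (0 < Rmin d rad) by (apply Rmin_glb_lt; lra); lra. }
  specialize (Hh 0 (-1) t ltac:(ring) ltac:(lra)).
  replace (x + (rad - t) * 0) with x in Hh by ring.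
  replace (rad + (rad - t) * -1) with t in Hh by ring.
  destruct (Hd' t ltac:(lra)) as [_ Hu].
  assert (0 < k * t) by (apply Rmult_lt_0_compat; lra); lra.
Qed.

(** The equation passes to the limit y -> 0, and [tangential_zero], applied to [u] and then to [ux],
    removes [uxx]. *)
Lemma bottom_uyy (x : R) : continuous_on (fun t => 0 <= t) f -> uyy x 0 = - f 0.
Proof.
intros Hf.
destruct sol as [Cu Cux Cuy Cxx Cxy Cyy Dx Dy Dxx Dxy Dyx Dyy Heq Hpos Hzero].
assert (Hx0 : forall a, ux a 0 = 0) by (intros a; apply (tangential_zero H u ux a); auto).
assert (Hxx0 : uxx x 0 = 0) by (apply (tangential_zero H ux uxx x); auto).
set (y := fun n : nat => H / 2 * / (INR n + 1)).
assert (Hy : forall n, 0 < y n < H).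
{ intros n; pose proof (scaled_inv_nat (H / 2) n ltac:(lra)); unfold y; lra. }
assert (Hl : is_lim_seq y 0).
{ apply scaled_inv_lim. }
assert (Hlim : forall v, seqcont (half_open H) v -> is_lim_seq (fun n => v x (y n)) (v x 0)).
{ intros v Hv; apply Hv; [intros n; specialize (Hy n); unfold half_open; lra | apply bottom_in
   | apply is_lim_seq_const | exact Hl]. }
assert (Hfu : is_lim_seq (fun n => f (u x (y n))) (f 0)).
{ intros P HP; destruct (Hf 0 (Rle_refl 0) P HP) as [eta Heta].
  destruct (proj1 (lim_seq_eps _ _) (Hlim u Cu) eta (cond_pos eta)) as [N HN].
  exists N; intros n Hn; apply Heta; [| apply Rlt_le, Hpos, Hy].
  specialize (HN n Hn); rewrite Hzero in HN; exact HN. }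
assert (Hsum : is_lim_seq (fun n => f (u x (y n))) (- (uxx x 0 + uyy x 0))).
{ apply (is_lim_seq_ext (fun n => - (uxx x (y n) + uyy x (y n)))); [intros n; apply Heq, Hy |].
  apply (is_lim_seq_opp _ (uxx x 0 + uyy x 0)), is_lim_seq_plus'; apply Hlim; assumption. }
apply is_lim_seq_unique in Hfu, Hsum; rewrite Hfu in Hsum; injection Hsum; intros; lra.
Qed.

(** (m, 1) is the direction from a point to its mirror image across m x + y = s. If uy > 0 at the
    base point, continuity of uy and boundedness of ux suffice. Otherwise [bottom_hopf] forces f 0 <
    0; with c = - f 0, uy grows at rate at least c / 2 in y, while ux, zero on the edge, is at most
    C y. Both are linear in y, and |m| <= c / (4 C) lets uy win uniformly down to the edge. *)
Lemma bottom_cone (x : R) :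
  continuous_on (fun t => 0 <= t) f -> (f 0 = 0 -> one_sided_osgood f 0) ->
  exists e, 0 < e /\ forall m x' y', Rabs m <= e -> Rabs (x' - x) < e -> 0 < y' < e ->
    0 < uy x' y' + m * ux x' y'.
Proof.
intros Hf Hos.
destruct sol as [Cu Cux Cuy Cxx Cxy Cyy Dx Dy Dxx Dxy Dyx Dyy Heq Hpos Hzero].
destruct (Rle_lt_or_eq_dec 0 _ (bottom_slope_nonneg x)) as [Hp|Hz].
- set (c := uy x 0) in *.
  destruct (seqcont_eps _ uy x 0 Cuy (bottom_in x) (c / 2) ltac:(lra)) as [d1 [Hd1 H1]].
  destruct (seqcont_eps _ ux x 0 Cux (bottom_in x) 1 ltac:(lra)) as [d2 [Hd2 H2]].
  set (C := Rabs (ux x 0) + 1).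
  assert (HC : 0 < C) by (unfold C; pose proof (Rabs_pos (ux x 0)); lra).
  set (e := Rmin (c / (4 * C)) (Rmin H (Rmin d1 d2))).
  assert (Hc4 : 0 < c / (4 * C)) by (apply Rdiv_lt_0_compat; lra).
  assert (He : 0 < e /\ e <= c / (4 * C) /\ e <= H /\ e <= d1 /\ e <= d2).
  { unfold e; pose proof (Rmin_l (c / (4 * C)) (Rmin H (Rmin d1 d2))).
    pose proof (Rmin_r (c / (4 * C)) (Rmin H (Rmin d1 d2))).
    pose proof (Rmin_l H (Rmin d1 d2)); pose proof (Rmin_r H (Rmin d1 d2)).
    pose proof (Rmin_l d1 d2); pose proof (Rmin_r d1 d2).
    split; [repeat apply Rmin_glb_lt; lra | lra]. }
  exists e; split; [lra |]; intros m x' y' Hm Hx' Hy'.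
  assert (Hin : half_open H x' y') by (unfold half_open; lra).
  assert (Hya : Rabs (y' - 0) = y') by (rewrite Rminus_0_r, Rabs_pos_eq; lra).
  specialize (H1 x' y' Hin ltac:(lra) ltac:(rewrite Hya; lra)); fold c in H1.
  specialize (H2 x' y' Hin ltac:(lra) ltac:(rewrite Hya; lra)).
  apply Rabs_def2 in H1.
  assert (Hux : Rabs (ux x' y') <= C).
  { pose proof (Rabs_triang (ux x' y' - ux x 0) (ux x 0)) as HT.
    replace (ux x' y' - ux x 0 + ux x 0) with (ux x' y') in HT by ring; unfold C; lra. }
  assert (Hmu : Rabs (m * ux x' y') <= c / 4).
  { rewrite Rabs_mult; apply Rle_trans with (c / (4 * C) * C); [| right; field; lra].
    apply Rmult_le_compat; try apply Rabs_pos; lra. }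
  apply Rabs_le_between in Hmu; lra.
- assert (Hf0 : f 0 < 0).
  { apply Rnot_le_lt; intros Hle; pose proof (bottom_hopf x Hf Hle Hos); lra. }
  pose proof (bottom_uyy x Hf) as Huyy; set (c := - f 0) in *.
  assert (Hc : 0 < c) by (unfold c; lra).
  assert (Hx0 : forall a, ux a 0 = 0) by (intros a; apply (tangential_zero H u ux a); auto).
  destruct (seqcont_eps _ uyy x 0 Cyy (bottom_in x) (c / 2) ltac:(lra)) as [d1 [Hd1 H1]].
  destruct (seqcont_eps _ uxy x 0 Cxy (bottom_in x) 1 ltac:(lra)) as [d2 [Hd2 H2]].
  set (C := Rabs (uxy x 0) + 1).
  assert (HC : 0 < C) by (unfold C; pose proof (Rabs_pos (uxy x 0)); lra).
  set (e := Rmin (c / (4 * C)) (Rmin H (Rmin d1 d2))).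
  assert (Hc4 : 0 < c / (4 * C)) by (apply Rdiv_lt_0_compat; lra).
  assert (He : 0 < e /\ e <= c / (4 * C) /\ e <= H /\ e <= d1 /\ e <= d2).
  { unfold e; pose proof (Rmin_l (c / (4 * C)) (Rmin H (Rmin d1 d2))).
    pose proof (Rmin_r (c / (4 * C)) (Rmin H (Rmin d1 d2))).
    pose proof (Rmin_l H (Rmin d1 d2)); pose proof (Rmin_r H (Rmin d1 d2)).
    pose proof (Rmin_l d1 d2); pose proof (Rmin_r d1 d2).
    split; [repeat apply Rmin_glb_lt; lra | lra]. }
  exists e; split; [lra |]; intros m x' y' Hm Hx' Hy'.
  assert (Hya : forall y, 0 < y <= y' -> half_open H x' y /\ Rabs (y - 0) < e).
  { intros y Hy; rewrite Rminus_0_r, Rabs_pos_eq; unfold half_open; lra. }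
  assert (Huy : c / 2 * y' <= uy x' y').
  { pose proof (bottom_slope_nonneg x').
    pose proof (bottom_mvt (fun x y => - uy x y) (fun x y => - uyy x y) x' y' ltac:(lra)) as HM.
    assert (- uy x' y' <= - uy x' 0 + (- c / 2) * y'); [apply HM | lra].
    - intros xn yn a b' Hn Hab Ha Hb; apply (is_lim_seq_opp _ (uy a b')), Cuy; auto.
    - intros a y Hy; apply (is_derive_opp (V := R_NormedModule) (fun t => uy a t)), Dyy, Hy.
    - intros y Hy; destruct (Hya y Hy) as [Hin Hyy].
      specialize (H1 x' y Hin ltac:(lra) ltac:(lra)); apply Rabs_def2 in H1; lra. }
  assert (Hxyb : forall y, 0 < y <= y' -> Rabs (uxy x' y) <= C).
  { intros y Hy; destruct (Hya y Hy) as [Hin Hyy].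
    specialize (H2 x' y Hin ltac:(lra) ltac:(lra)).
    pose proof (Rabs_triang (uxy x' y - uxy x 0) (uxy x 0)) as HT.
    replace (uxy x' y - uxy x 0 + uxy x 0) with (uxy x' y) in HT by ring; unfold C; lra. }
  assert (Hu1 : ux x' y' <= C * y').
  { replace (C * y') with (ux x' 0 + C * y') by (rewrite Hx0; ring).
    apply (bottom_mvt ux uxy); auto; [lra |].
    intros y Hy; specialize (Hxyb y Hy); apply Rabs_le_between in Hxyb; lra. }
  assert (Hu2 : - ux x' y' <= C * y').
  { replace (C * y') with (- ux x' 0 + C * y') by (rewrite Hx0; ring).
    apply (bottom_mvt (fun x y => - ux x y) (fun x y => - uxy x y)); [lra | | |].
    - intros xn yn a b' Hn Hab Ha Hb; apply (is_lim_seq_opp _ (ux a b')), Cux; auto.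
    - intros a y Hy; apply (is_derive_opp (V := R_NormedModule) (fun t => ux a t)), Dxy, Hy.
    - intros y Hy; specialize (Hxyb y Hy); apply Rabs_le_between in Hxyb; lra. }
  assert (Hmu : Rabs (m * ux x' y') <= c / 4 * y').
  { rewrite Rabs_mult; apply Rle_trans with (c / (4 * C) * (C * y')); [| right; field; lra].
    apply Rmult_le_compat; try apply Rabs_pos; [lra | apply Rabs_le; lra]. }
  apply Rabs_le_between in Hmu.
  assert (0 < c * y') by (apply Rmult_lt_0_compat; lra); lra.
Qed.

End Boundary.

Arguments bottom_cone {H f u ux uy uxx uxy uyy} _.

(** * Sliding a slanted line *)

Lemma lap_exp_linear (a b c x y : R) :
  lap (fun x y => exp (a * x + b * y + c)) x y ((a ^ 2 + b ^ 2) * exp (a * x + b * y + c)).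
Proof.
replace ((a ^ 2 + b ^ 2) * exp (a * x + b * y + c)) with
  (4 * 0 * exp (a * x + b * y + c) + (a ^ 2 + b ^ 2) * exp (a * x + b * y + c)) by ring.
apply (lap_comp_quad (fun x y => a * x + b * y + c) exp exp x y a b 0 _ 1).
- intros e1 e2; ring.
- exact Rlt_0_1.
- intros s _; apply is_derive_exp.
- apply is_derive_exp.
Qed.

(* Reflection of (x, y) across the line [m * x + y = s]. *)
Definition rx (m s x y : R) : R := x + m * (2 * (s - m * x - y) / (1 + m ^ 2)).
Definition ry (m s x y : R) : R := y + 2 * (s - m * x - y) / (1 + m ^ 2).

Definition triangle (m s x y : R) : Prop := 0 <= x /\ 0 <= y /\ m * x + y <= s.

Lemma sqr1_pos (m : R) : 0 < 1 + m ^ 2.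
Proof. pose proof (pow2_ge_0 m); lra. Qed.

(** The quotient is the coefficient along (m, 1) of the step to the mirror image. Convergence is
    joint in all four arguments, because later limits move the line together with the point. *)
Lemma gap_lim (m s x y : nat -> R) (m' s' x' y' : R) :
  is_lim_seq m m' -> is_lim_seq s s' -> is_lim_seq x x' -> is_lim_seq y y' ->
  is_lim_seq (fun n => 2 * (s n - m n * x n - y n) / (1 + m n ^ 2))
    (2 * (s' - m' * x' - y') / (1 + m' ^ 2)).
Proof.
intros Hm Hs Hx Hy; pose proof (sqr1_pos m').
apply is_lim_seq_div'; [| | lra].
- apply is_lim_seq_mul; [apply is_lim_seq_const |].
  apply is_lim_seq_minus'; [apply is_lim_seq_minus' | exact Hy]; [exact Hs | apply is_lim_seq_mul; auto].
- simpl; apply is_lim_seq_plus'; [apply is_lim_seq_const |].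
  repeat apply is_lim_seq_mul; auto; apply is_lim_seq_const.
Qed.

Lemma rx_lim (m s x y : nat -> R) (m' s' x' y' : R) :
  is_lim_seq m m' -> is_lim_seq s s' -> is_lim_seq x x' -> is_lim_seq y y' ->
  is_lim_seq (fun n => rx (m n) (s n) (x n) (y n)) (rx m' s' x' y').
Proof.
intros Hm Hs Hx Hy; apply is_lim_seq_plus'; [exact Hx |].
apply is_lim_seq_mul; [exact Hm | apply gap_lim; auto].
Qed.

Lemma ry_lim (m s x y : nat -> R) (m' s' x' y' : R) :
  is_lim_seq m m' -> is_lim_seq s s' -> is_lim_seq x x' -> is_lim_seq y y' ->
  is_lim_seq (fun n => ry (m n) (s n) (x n) (y n)) (ry m' s' x' y').
Proof. intros Hm Hs Hx Hy; apply is_lim_seq_plus'; [exact Hy | apply gap_lim; auto]. Qed.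

Lemma gap_bounds (m s x y : R) :
  m * x + y <= s -> 0 <= 2 * (s - m * x - y) / (1 + m ^ 2) <= 2 * (s - m * x - y).
Proof.
intros H; pose proof (sqr1_pos m); pose proof (pow2_ge_0 m).
set (q := 2 * (s - m * x - y) / (1 + m ^ 2)).
assert (Hq : q * (1 + m ^ 2) = 2 * (s - m * x - y)) by (unfold q; field; lra).
assert (Hq0 : 0 <= q).
{ unfold q, Rdiv; apply Rmult_le_pos; [lra | apply Rlt_le, Rinv_0_lt_compat; lra]. }
assert (0 <= q * m ^ 2) by (apply Rmult_le_pos; lra); lra.
Qed.

Lemma gap_pos (m s x y : R) :
  m * x + y < s -> 0 < 2 * (s - m * x - y) / (1 + m ^ 2).
Proof. intros H; pose proof (sqr1_pos m); apply Rdiv_lt_0_compat; lra. Qed.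

(** Keeps the mirror image of the triangle inside the strip as soon as 2 s < H. *)
Lemma ry_range (m s x y : R) : 0 <= m -> triangle m s x y -> y <= ry m s x y <= 2 * s.
Proof.
intros Hm [Hx [Hy H]]; pose proof (gap_bounds m s x y H); unfold ry.
assert (0 <= m * x) by (apply Rmult_le_pos; lra); lra.
Qed.

Lemma refl_on_line (m s x y : R) : m * x + y = s -> rx m s x y = x /\ ry m s x y = y.
Proof.
intros H; pose proof (sqr1_pos m); unfold rx, ry.
replace (s - m * x - y) with 0 by lra; split; field; lra.
Qed.

Section Sliding.

Variables (H : R) (f : R -> R) (u ux uy uxx uxy uyy : R -> R -> R) (m smax : R).
Hypothesis sol : c2_solution (half_open H) H f u ux uy uxx uxy uyy.
Hypothesis osg : osgood_everywhere f.
Hypothesis lip : locally_lipschitz_from_above f.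
Hypothesis m_pos : 0 < m.
Hypothesis smax_range : 2 * smax < H.
(** The side condition, supplied for all small [m] by [left_side_extend]. *)
Hypothesis left_side : forall s y, 0 < s <= smax -> 0 <= y < s ->
  u 0 y <= u (rx m s 0 y) (ry m s 0 y).

Lemma lap_refl (s x y : R) :
  0 < ry m s x y < H ->
  lap (fun x y => u (rx m s x y) (ry m s x y)) x y (- f (u (rx m s x y) (ry m s x y))).
Proof.
intros Hy; pose proof (sqr1_pos m) as Hm.
set (A := (1 - m ^ 2) / (1 + m ^ 2)); set (B := - (2 * m) / (1 + m ^ 2)).
set (c := 2 * m * s / (1 + m ^ 2)); set (d := 2 * s / (1 + m ^ 2)).
assert (Hrx : forall x y, A * x + B * y + c = rx m s x y)
  by (intros a b; unfold A, B, c, rx; field; lra).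
assert (Hry : forall x y, B * x - A * y + d = ry m s x y)
  by (intros a b; unfold A, B, d, ry; field; lra).
apply (lap_ext_loc (fun x y => u (A * x + B * y + c) (B * x - A * y + d)) _ x y _ 1 Rlt_0_1).
- intros x' y' _ _; rewrite Hrx, Hry; reflexivity.
- apply lap_isom; [unfold A, B; field; lra |].
  rewrite Hrx, Hry; apply (sol_lap sol); exact Hy.
Qed.

Lemma refl_cont (s : R) (K : R -> R -> Prop) :
  (forall x y, K x y -> half_open H (rx m s x y) (ry m s x y)) ->
  seqcont K (fun x y => u (rx m s x y) (ry m s x y)).
Proof.
intros HK xn yn x y Hn Hxy Hx Hy; apply (sol_u sol); auto.
- apply (rx_lim (fun _ => m) (fun _ => s)); auto; apply is_lim_seq_const.
- apply (ry_lim (fun _ => m) (fun _ => s)); auto; apply is_lim_seq_const.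
Qed.

Lemma triangle_in (s x y : R) :
  s <= smax -> triangle m s x y -> half_open H x y /\ half_open H (rx m s x y) (ry m s x y).
Proof.
intros Hs HT; pose proof (ry_range m s x y ltac:(lra) HT); destruct HT as [Hx [Hy HT]].
unfold half_open; lra.
Qed.

Lemma triangle_closed (s : R) : seqclosed (triangle m s).
Proof.
intros xn yn x y Hn Hx Hy; repeat split.
- apply (lim_le (fun _ => 0) xn); [apply Hn | apply is_lim_seq_const | exact Hx].
- apply (lim_le (fun _ => 0) yn); [apply Hn | apply is_lim_seq_const | exact Hy].
- apply (lim_le (fun n => m * xn n + yn n) (fun _ => s)); [apply Hn | | apply is_lim_seq_const].
  apply is_lim_seq_plus'; [apply is_lim_seq_mul; [apply is_lim_seq_const |] |]; assumption.
Qed.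

Lemma triangle_x_bound (s x y : R) : triangle m s x y -> 0 <= x <= s / m.
Proof.
intros [Hx [Hy HT]]; split; [exact Hx |].
apply (Rmult_le_reg_r m); [exact m_pos |].
replace (s / m * m) with s by (field; lra); lra.
Qed.

Lemma triangle_bounded (s : R) : bounded2 (triangle m s).
Proof.
exists (Rmax s (s / m)); intros x y HT; pose proof (triangle_x_bound s x y HT).
destruct HT as [Hx [Hy HT]]; pose proof (Rmax_l s (s / m)); pose proof (Rmax_r s (s / m)).
assert (0 <= m * x) by (apply Rmult_le_pos; lra).
rewrite !Rabs_pos_eq; lra.
Qed.

Definition bad (s : R) : Prop :=
  exists x y, triangle m s x y /\ u (rx m s x y) (ry m s x y) < u x y.

(* Weak maximum principle near the sides of the triangle: with [lap phi <= -k^2/3] within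
   distance [1/k] of a side and [phi <= 4], a positive maximum of the difference divided by
   [phi] cannot occur there once [k^2 > 12 L]. *)
Lemma bad_deep : exists k, 0 < k /\ forall s, 0 < s <= smax -> bad s ->
  exists x y, 1 <= k * x /\ 1 <= k * y /\ 1 <= k * (s - m * x - y) /\
    u (rx m s x y) (ry m s x y) <= u x y.
Proof.
destruct (Rle_lt_dec smax 0) as [Hneg|Hsm].
{ exists 1; split; [lra |]; intros s Hs; lra. }
(* One bound for [u] on the largest triangle, so that [L] and [k] do not depend on [s]. *)
destruct (extreme_value (triangle m smax) u) as [xb [yb [HTb Hmax]]].
{ apply triangle_bounded. }
{ apply triangle_closed. }
{ apply (seqcont_sub (half_open H)); [| apply (sol_u sol)].
  intros x y HT; apply (triangle_in smax); [lra | exact HT]. }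
{ exists 0, 0; unfold triangle; lra. }
destruct (lip (Rabs (u xb yb) + 1)) as [L [HL Hlip]]; [pose proof (Rabs_pos (u xb yb)); lra |].
set (k := 12 * (L + 1)).
assert (Hk : 0 < k) by (unfold k; lra).
assert (HkL : 12 * L < k ^ 2) by (unfold k; nra).
(* [E1], [E2], [E3] below equal 1 on the sides x = 0, y = 0 and m x + y = s respectively, and decay
   exponentially away from them. *)
exists k; split; [exact Hk |]; intros s Hs [xs [ys [HTs Hbad]]].
set (E1 := fun x y : R => exp (- k * x + 0 * y + 0)).
set (E2 := fun x y : R => exp (0 * x + - k * y + 0)).
set (E3 := fun x y : R => exp (k * m * x + k * y + - k * s)).
set (phi := fun x y => 4 - (E1 x y + E2 x y + E3 x y)).
assert (HE : forall x y, 0 < E1 x y /\ 0 < E2 x y /\ 0 < E3 x y)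
  by (intros; unfold E1, E2, E3; repeat split; apply exp_pos).
assert (Hexp1 : forall t, t <= 0 -> exp t <= 1).
{ intros t Ht; rewrite <- exp_0; destruct Ht as [Ht| ->]; [left; now apply exp_increasing | lra]. }
assert (HE1 : forall x y, triangle m s x y -> E1 x y <= 1 /\ E2 x y <= 1 /\ E3 x y <= 1).
{ intros x y [Hx [Hy HT]]; unfold E1, E2, E3.
  assert (0 <= k * x /\ 0 <= k * y /\ 0 <= k * (s - m * x - y)) by (repeat split; apply Rmult_le_pos; lra).
  repeat split; apply Hexp1; lra. }
assert (Hphi : forall x y, triangle m s x y -> 1 <= phi x y <= 4).
{ intros x y HT; specialize (HE1 x y HT); specialize (HE x y); unfold phi; lra. }
assert (HEc : forall a b c (K : R -> R -> Prop), seqcont K (fun x y => exp (a * x + b * y + c))).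
{ intros a b c K xn yn x y _ _ Hx Hy.
  apply (is_lim_seq_continuous exp (fun n => a * xn n + b * yn n + c)).
  - apply (continuity_pt_of_derive _ _ _ (is_derive_exp _)).
  - repeat apply is_lim_seq_plus'; try apply is_lim_seq_const;
    (apply is_lim_seq_mul; [apply is_lim_seq_const | assumption]). }
set (w := fun x y => u x y - u (rx m s x y) (ry m s x y)).
assert (Hw : seqcont (triangle m s) w).
{ intros xn yn x y Hn Hxy Hx Hy; apply is_lim_seq_minus'.
  - apply (sol_u sol); auto; [intros n |]; apply (triangle_in s); auto; lra.
  - apply (refl_cont s (triangle m s)); auto; intros a b Hab; apply triangle_in; auto; lra. }
destruct (extreme_value (triangle m s) (fun x y => w x y / phi x y)) as [x [y [HT HM]]].
{ apply triangle_bounded. }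
{ apply triangle_closed. }
{ intros xn yn x y Hn Hxy Hx Hy; apply is_lim_seq_div'; [apply Hw; auto | |].
  - apply is_lim_seq_minus'; [apply is_lim_seq_const |].
    repeat apply is_lim_seq_plus'; apply (HEc _ _ _ (triangle m s)); auto.
  - specialize (Hphi x y Hxy); lra. }
{ exists xs, ys; exact HTs. }
set (M := w x y / phi x y) in *.
assert (HMpos : 0 < M).
{ apply Rlt_le_trans with (w xs ys / phi xs ys); [| apply HM, HTs].
  apply Rdiv_lt_0_compat; [unfold w; lra | specialize (Hphi xs ys HTs); lra]. }
pose proof (Hphi x y HT) as Hphixy.
assert (HwM : w x y = M * phi x y) by (unfold M; field; lra).
assert (Hwpos : 0 < w x y) by (rewrite HwM; apply Rmult_lt_0_compat; lra).
pose proof (triangle_in s x y ltac:(lra) HT) as [Hin Hrin].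
pose proof (ry_range m s x y ltac:(lra) HT) as Hryr.
pose proof HT as [Hx [Hy HTl]].
assert (Hrnn : 0 <= u (rx m s x y) (ry m s x y)).
{ destruct (Req_dec (ry m s x y) 0) as [->|]; [rewrite (sol_zero sol); lra |].
  apply Rlt_le, (sol_pos sol); unfold half_open in Hrin; lra. }
assert (Hline : m * x + y < s).
{ destruct HTl as [|HTl]; [assumption |]; exfalso.
  destruct (refl_on_line m s x y HTl) as [H1 H2]; unfold w in Hwpos; rewrite H1, H2 in Hwpos; lra. }
assert (Hy0 : 0 < y).
{ destruct Hy as [|Hy]; [assumption |]; exfalso; subst y.
  unfold w in Hwpos; rewrite (sol_zero sol) in Hwpos; lra. }
assert (Hx0 : 0 < x).
{ destruct Hx as [|Hx]; [assumption |]; exfalso; subst x.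
  specialize (left_side s y ltac:(lra) ltac:(lra)); unfold w in Hwpos; lra. }
assert (Hbox : exists r, 0 < r /\ forall x' y', Rabs (x' - x) < r -> Rabs (y' - y) < r -> triangle m s x' y').
{ exists (Rmin (Rmin x y) ((s - m * x - y) / (1 + m))).
  assert (Hg : 0 < (s - m * x - y) / (1 + m)) by (apply Rdiv_lt_0_compat; lra).
  split; [repeat apply Rmin_glb_lt; lra |]; intros x' y' Hx' Hy'.
  pose proof (Rmin_l (Rmin x y) ((s - m * x - y) / (1 + m))).
  pose proof (Rmin_r (Rmin x y) ((s - m * x - y) / (1 + m))).
  pose proof (Rmin_l x y); pose proof (Rmin_r x y).
  apply Rabs_def2 in Hx', Hy'.
  set (q := (s - m * x - y) / (1 + m)) in *.
  assert (Hq : q * (1 + m) = s - m * x - y) by (unfold q; field; lra).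
  assert (m * (x' - x) <= m * q) by (apply Rmult_le_compat_l; lra).
  unfold triangle; lra. }
destruct Hbox as [r [Hr Hbox]].
assert (Hlw : lap w x y (- f (u x y) - - f (u (rx m s x y) (ry m s x y)))).
{ apply lap_sub; [apply (sol_lap sol); unfold half_open in Hin; lra |].
  apply lap_refl; unfold half_open in Hrin; lra. }
assert (Hlphi : lap (fun x y => 1 * 4 + (-1) * (1 * (1 * E1 x y + 1 * E2 x y) + 1 * E3 x y)) x y
  (1 * 0 + (-1) * (1 * (1 * (((- k) ^ 2 + 0 ^ 2) * E1 x y) + 1 * ((0 ^ 2 + (- k) ^ 2) * E2 x y))
     + 1 * (((k * m) ^ 2 + k ^ 2) * E3 x y)))).
{ repeat apply (lap_lin (fun _ _ => 4)) || apply lap_lin; try apply lap_exp_linear.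
  intros eps Heps; exists 1; split; [lra |]; intros e1 e2 _ _; unfold star.
  match goal with |- Rabs ?A <= _ => replace A with 0 by ring end.
  rewrite Rabs_R0; apply Rmult_le_pos; [lra |]; pose proof (pow2_ge_0 e1); pose proof (pow2_ge_0 e2); lra. }
pose proof (lap_lin _ _ x y 1 (- M) _ _ Hlw Hlphi) as Hl.
apply (lap_max _ x y _ r Hr) in Hl.
2: { intros x' y' Hx' Hy'; specialize (Hbox x' y' Hx' Hy').
  specialize (HM x' y' Hbox); specialize (Hphi x' y' Hbox).
  assert (Hwl : w x' y' <= M * phi x' y').
  { replace (w x' y') with (w x' y' / phi x' y' * phi x' y') by (field; lra).
    apply Rmult_le_compat_r; lra. }
  unfold phi in HwM, Hwl; lra. }
assert (Hub : u x y <= Rabs (u xb yb) + 1).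
{ assert (u x y <= u xb yb) by (apply Hmax; unfold triangle; lra).
  pose proof (Rle_abs (u xb yb)); lra. }
specialize (Hlip (u x y) (u (rx m s x y) (ry m s x y)) Hrnn ltac:(unfold w in Hwpos; lra) Hub).
fold (w x y) in Hlip; rewrite HwM in Hlip.
destruct (HE x y) as [P1 [P2 P3]].
(* Combines lap (w - M phi) <= 0 at the maximum of w / phi with lap w >= - L w and w = M phi <= 4
   M. *)
assert (HMk : M * k ^ 2 * (E1 x y + E2 x y + E3 x y) <= 4 * L * M).
{ assert (0 <= M * (k ^ 2 * m ^ 2 * E3 x y)).
  { apply Rmult_le_pos; [lra |]; apply Rmult_le_pos; [| lra].
    apply Rmult_le_pos; apply pow2_ge_0. }
  assert (L * (M * phi x y) <= L * (M * 4)).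
  { apply Rmult_le_compat_l; [lra |]; apply Rmult_le_compat_l; lra. }
  lra. }
assert (Hsum : E1 x y + E2 x y + E3 x y < / 3).
{ apply Rnot_le_lt; intros Hge.
  assert (M * (12 * L) < M * k ^ 2) by (apply Rmult_lt_compat_l; lra).
  assert (M * k ^ 2 * / 3 <= M * k ^ 2 * (E1 x y + E2 x y + E3 x y)).
  { apply Rmult_le_compat_l; [apply Rmult_le_pos; [lra | apply pow2_ge_0] | exact Hge]. }
  lra. }
(* Each exponential is below 1 / 3 <= exp (-1), so each exponent is below -1: this is the depth
   claimed. *)
assert (He1 : / 3 <= exp (-1)).
{ replace (-1) with (Ropp 1) by ring; rewrite exp_Ropp; apply Rinv_le_contravar; [apply exp_pos | apply exp_le_3]. }
assert (Hdeep : forall t, exp t < / 3 -> t < -1).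
{ intros t Ht; apply exp_lt_inv; lra. }
exists x, y; unfold E1, E2, E3, w in *; repeat split; [| | | lra].
- assert (- k * x + 0 * y + 0 < -1) by (apply Hdeep; lra); lra.
- assert (0 * x + - k * y + 0 < -1) by (apply Hdeep; lra); lra.
- assert (k * m * x + k * y + - k * s < -1) by (apply Hdeep; lra); lra.
Qed.

Lemma triangle_strict (s : R) :
  0 < s <= smax -> (forall x y, triangle m s x y -> u x y <= u (rx m s x y) (ry m s x y)) ->
  forall x y, 0 < x -> 0 < y -> m * x + y < s -> u x y < u (rx m s x y) (ry m s x y).
Proof.
intros Hs Hle x y Hx Hy Hxy.
(* The midpoint of the bottom side, where u = 0 while the mirror image lies in the open strip;
   interior points above it inherit the strict inequality that starts the strong principle. *)
set (x1 := s / (2 * m)).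
assert (Hx1 : 0 < x1) by (apply Rdiv_lt_0_compat; lra).
assert (Hmx1 : m * x1 = s / 2) by (unfold x1; field; lra).
assert (HT1 : triangle m s x1 0) by (unfold triangle; lra).
assert (Hw : seqcont (triangle m s) (fun x y => u (rx m s x y) (ry m s x y) - u x y)).
{ intros xn yn a b Hn Hab Ha Hb; apply is_lim_seq_minus'.
  - apply (refl_cont s (triangle m s)); auto; intros c d Hcd; apply triangle_in; auto; lra.
  - apply (sol_u sol); auto; [intros n |]; apply (triangle_in s); auto; lra. }
assert (Hp : 0 < u (rx m s x1 0) (ry m s x1 0) - u x1 0).
{ rewrite (sol_zero sol), Rminus_0_r; apply (sol_pos sol).
  pose proof (gap_pos m s x1 0 ltac:(lra)); pose proof (ry_range m s x1 0 ltac:(lra) HT1).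
  unfold ry in *; lra. }
destruct (seqcont_eps _ _ x1 0 Hw HT1 _ Hp) as [d [Hd Hd']].
set (y1 := Rmin d s / 4).
assert (Hy1 : 0 < y1 /\ y1 < d /\ y1 <= s / 4).
{ unfold y1; pose proof (Rmin_l d s); pose proof (Rmin_r d s).
  assert (0 < Rmin d s) by (apply Rmin_glb_lt; lra); lra. }
specialize (Hd' x1 y1 ltac:(unfold triangle; lra) ltac:(rewrite Rminus_diag, Rabs_R0; lra)
  ltac:(rewrite Rminus_0_r, Rabs_pos_eq; lra)).
apply Rabs_def2 in Hd'.
set (D := fun x y => 0 < x /\ 0 < y /\ m * x + y < s).
assert (HD : forall a b, D a b -> triangle m s a b) by (unfold D, triangle; intros; lra).
apply (strong_comparison f D (fun x y => u (rx m s x y) (ry m s x y)) u x1 y1 osg).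
- intros a b a' b' t [H1 [H2 H3]] [H1' [H2' H3']] Ht.
  assert (Hcv : forall p q, 0 < p -> 0 < q -> 0 < p + t * (q - p)).
  { intros p q Hp' Hq; destruct (Rle_lt_dec p q).
    - assert (0 <= t * (q - p)) by (apply Rmult_le_pos; lra); lra.
    - assert (t * (p - q) <= 1 * (p - q)) by (apply Rmult_le_compat_r; lra); lra. }
  repeat split; [now apply Hcv | now apply Hcv |].
  pose proof (Hcv (s - m * a - b) (s - m * a' - b') ltac:(lra) ltac:(lra)); lra.
- intros a b [H1 [H2 H3]].
  exists (Rmin (Rmin a b) ((s - m * a - b) / (1 + m))).
  assert (Hg : 0 < (s - m * a - b) / (1 + m)) by (apply Rdiv_lt_0_compat; lra).
  split; [repeat apply Rmin_glb_lt; lra |]; intros x' y' Hx' Hy'.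
  pose proof (Rmin_l (Rmin a b) ((s - m * a - b) / (1 + m))).
  pose proof (Rmin_r (Rmin a b) ((s - m * a - b) / (1 + m))).
  pose proof (Rmin_l a b); pose proof (Rmin_r a b).
  apply Rabs_def2 in Hx', Hy'.
  set (q := (s - m * a - b) / (1 + m)) in *.
  assert (Hq : q * (1 + m) = s - m * a - b) by (unfold q; field; lra).
  assert (m * (x' - a) < m * q) by (apply Rmult_lt_compat_l; lra).
  unfold D; lra.
- apply refl_cont; intros a b Hab; apply triangle_in; [lra | auto].
- apply (seqcont_sub (half_open H)); [| apply (sol_u sol)].
  intros a b Hab; apply (triangle_in s); [lra | auto].
- intros a b Hab; pose proof (ry_range m s a b ltac:(lra) (HD a b Hab)).
  destruct (triangle_in s a b ltac:(lra) (HD a b Hab)) as [Hi1 Hi2]; unfold half_open, D in *.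
  split; [apply lap_refl | apply (sol_lap sol)]; lra.
- intros a b Hab; split; [| apply Hle, HD, Hab].
  destruct (triangle_in s a b ltac:(lra) (HD a b Hab)) as [Hi1 Hi2]; unfold half_open, D in *.
  apply (sol_pos sol); lra.
- unfold D; lra.
- lra.
- unfold D; lra.
Qed.

(** Let s0 be the infimum of the bad parameters. [bad_deep] trades points of failure for points at a
    fixed depth, which accumulate at an interior point of the triangle for s0. In particular s0 > 0,
    so the start of the slide needs no separate argument. At that point the limit inequality
    contradicts [triangle_strict]. *)
Lemma sliding (s x y : R) :
  0 < s <= smax -> triangle m s x y -> u x y <= u (rx m s x y) (ry m s x y).
Proof.
intros Hs HT; apply Rnot_lt_le; intros Hbad.
destruct bad_deep as [k [Hk Hdeep]].
(* The infimum of the bad parameters, as the supremum of their nonnegative lower bounds. *)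
destruct (completeness (fun t => 0 <= t /\ forall s', 0 < s' <= smax -> bad s' -> t <= s')) as [s0 [Hub Hlub]].
{ exists s; intros t [_ Ht]; apply Ht; [lra |]; exists x, y; auto. }
{ exists 0; split; [lra |]; intros; lra. }
assert (Hgood : forall s', 0 < s' <= smax -> bad s' -> s0 <= s').
{ intros s' Hs' Hb; apply Hlub; intros t [_ Ht]; apply Ht; auto. }
destruct (choose_fun R (fun n s' => 0 < s' <= smax /\ bad s' /\ Rabs (s' - s0) < / (INR n + 1))) as [sn Hsn].
{ intros n; apply NNPP; intros Hn; pose proof (inv_nat_pos n).
  assert (Hs0 : 0 <= s0) by (apply Hub; split; [lra |]; intros; lra).
  assert (s0 + / (INR n + 1) <= s0); [| lra].
  apply Hub; split; [lra |]; intros s' Hs' Hb; apply Rnot_lt_le; intros Hlt.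
  apply Hn; exists s'; split; [exact Hs' |]; split; [exact Hb |].
  specialize (Hgood s' Hs' Hb); apply Rabs_def1; lra. }
assert (Hsl : is_lim_seq sn s0) by (apply lim_dist_inv; intros n; apply Hsn).
destruct (choose_fun (R * R) (fun n p => 1 <= k * fst p /\ 1 <= k * snd p /\
  1 <= k * (sn n - m * fst p - snd p) /\
  u (rx m (sn n) (fst p) (snd p)) (ry m (sn n) (fst p) (snd p)) <= u (fst p) (snd p))) as [p Hp].
{ intros n; destruct (Hsn n) as [H1 [H2 _]]; destruct (Hdeep (sn n) H1 H2) as [a [b Hab]].
  exists (a, b); exact Hab. }
assert (Hk1 : forall t, 1 <= k * t -> 0 < t).
{ intros t Ht; apply Rnot_le_lt; intros Hle.
  assert (k * t <= k * 0) by (apply Rmult_le_compat_l; lra); lra. }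
assert (HTn : forall n, triangle m (sn n) (fst (p n)) (snd (p n))).
{ intros n; destruct (Hp n) as [A [B [C _]]]; apply Hk1 in A, B, C; unfold triangle; lra. }
destruct (bolzano_weierstrass_2d (fun n => fst (p n)) (fun n => snd (p n)) (Rmax smax (smax / m)))
  as [phi [a [b [Hphi [Ha Hb]]]]].
{ intros n; destruct (Hsn n) as [H1 _].
  assert (HT' : triangle m smax (fst (p n)) (snd (p n))) by (specialize (HTn n); unfold triangle in *; lra).
  pose proof (triangle_x_bound smax _ _ HT'); destruct HT' as [Hx' [Hy' HT']].
  pose proof (Rmax_l smax (smax / m)); pose proof (Rmax_r smax (smax / m)).
  assert (0 <= m * fst (p n)) by (apply Rmult_le_pos; lra).
  rewrite !Rabs_pos_eq; lra. }
assert (Hsl' := lim_subseq _ _ phi Hphi Hsl).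
assert (Hlim1 : forall (t : nat -> R) (l : R), (forall n, 1 <= k * t (phi n)) -> is_lim_seq (fun n => t (phi n)) l -> 0 < l).
{ intros t l Ht Hl; apply Hk1.
  apply (lim_le (fun _ => 1) (fun n => k * t (phi n))); [exact Ht | apply is_lim_seq_const |].
  apply is_lim_seq_mul; [apply is_lim_seq_const | exact Hl]. }
assert (Ha0 : 0 < a) by (apply (Hlim1 (fun n => fst (p n))); [intros n; apply Hp | exact Ha]).
assert (Hb0 : 0 < b) by (apply (Hlim1 (fun n => snd (p n))); [intros n; apply Hp | exact Hb]).
assert (Hg0 : 0 < s0 - m * a - b).
{ apply (Hlim1 (fun n => sn n - m * fst (p n) - snd (p n))); [intros n; apply Hp |].
  apply is_lim_seq_minus'; [apply is_lim_seq_minus'; [exact Hsl' |] | exact Hb].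
  apply is_lim_seq_mul; [apply is_lim_seq_const | exact Ha]. }
assert (Hs0 : 0 < s0 <= smax).
{ assert (0 < m * a) by (apply Rmult_lt_0_compat; lra); split; [lra |].
  apply (lim_le sn (fun _ => smax)); [apply Hsn | exact Hsl | apply is_lim_seq_const]. }
assert (Hle0 : forall a b, triangle m s0 a b -> u a b <= u (rx m s0 a b) (ry m s0 a b)).
{ intros a' b' HT'; destruct (Req_dec (m * a' + b') s0) as [Hl|Hl].
  { destruct (refl_on_line m s0 a' b' Hl) as [-> ->]; lra. }
  pose proof HT' as [Ha' [Hb' Hab']].
  assert (Hma : 0 <= m * a') by (apply Rmult_le_pos; lra).
  set (g := s0 - (m * a' + b')).
  assert (Hg : 0 < g) by (unfold g; lra).
  (* Parameters below s0, hence good, whose triangle still contains (a', b'), as only half of its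
     gap [g] to the line is used. *)
  set (t := fun n : nat => s0 - g / 2 * / (INR n + 1)).
  assert (Ht : forall n, 0 < t n < s0 /\ triangle m (t n) a' b').
  { intros n; unfold t; pose proof (scaled_inv_nat (g / 2) n ltac:(lra)).
    unfold triangle, g in *; lra. }
  assert (Htl : is_lim_seq t s0).
  { replace (Finite s0) with (Finite (s0 - g / 2 * 0)) by (f_equal; ring).
    apply is_lim_seq_minus'; [apply is_lim_seq_const |].
    apply is_lim_seq_mul; [apply is_lim_seq_const | apply inv_nat_lim]. }
  apply (lim_le (fun _ => u a' b') (fun n => u (rx m (t n) a' b') (ry m (t n) a' b')));
    [| apply is_lim_seq_const |].
  - intros n; destruct (Ht n) as [Ht1 Ht2]; apply Rnot_lt_le; intros Hlt.
    assert (s0 <= t n) by (apply Hgood; [lra | exists a', b'; auto]); lra.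
  - apply (sol_u sol).
    + intros n; destruct (Ht n) as [Ht1 Ht2]; apply triangle_in; [lra | exact Ht2].
    + apply triangle_in; [lra | exact HT'].
    + apply (rx_lim (fun _ => m) t (fun _ => a') (fun _ => b')); auto; apply is_lim_seq_const.
    + apply (ry_lim (fun _ => m) t (fun _ => a') (fun _ => b')); auto; apply is_lim_seq_const. }
pose proof (triangle_strict s0 Hs0 Hle0 a b Ha0 Hb0 ltac:(lra)) as Hlt.
assert (Hge : u (rx m s0 a b) (ry m s0 a b) <= u a b); [| lra].
apply (lim_le (fun n => u (rx m (sn (phi n)) (fst (p (phi n))) (snd (p (phi n))))
                          (ry m (sn (phi n)) (fst (p (phi n))) (snd (p (phi n)))))
              (fun n => u (fst (p (phi n))) (snd (p (phi n))))).
- intros n; apply Hp.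
- apply (sol_u sol).
  + intros n; apply triangle_in; [apply Hsn | apply HTn].
  + apply triangle_in; [lra | unfold triangle; lra].
  + apply (rx_lim (fun _ => m)); auto; apply is_lim_seq_const.
  + apply (ry_lim (fun _ => m)); auto; apply is_lim_seq_const.
- apply (sol_u sol); auto.
  + intros n; apply (triangle_in (sn (phi n))); [apply Hsn | apply HTn].
  + apply (triangle_in s0); [lra | unfold triangle; lra].
Qed.

End Sliding.

(** * Monotonicity up to the middle of the strip *)

Lemma solution_mirror (H : R) (f : R -> R) (u ux uy uxx uxy uyy : R -> R -> R) :
  c2_solution (half_open H) H f u ux uy uxx uxy uyy ->
  c2_solution (half_open H) H f (fun x y => u (- x) y) (fun x y => - ux (- x) y)
    (fun x y => uy (- x) y) (fun x y => uxx (- x) y) (fun x y => - uxy (- x) y)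
    (fun x y => uyy (- x) y).
Proof.
intros [Cu Cux Cuy Cxx Cxy Cyy Dx Dy Dxx Dxy Dyx Dyy Heq Hpos Hzero].
assert (Hc : forall v, seqcont (half_open H) v -> seqcont (half_open H) (fun x y => v (- x) y)).
{ intros v Hv xn yn x y Hn Hxy Hx Hy; apply Hv; auto; exact (proj1 (is_lim_seq_opp _ x) Hx). }
assert (Hco : forall v, seqcont (half_open H) v -> seqcont (half_open H) (fun x y => - v (- x) y)).
{ intros v Hv xn yn x y Hn Hxy Hx Hy; apply (is_lim_seq_opp _ (v (- x) y)), (Hc v Hv); auto. }
assert (Hd : forall (v vx : R -> R -> R) x y, (forall x, is_derive (fun s => v s y) x (vx x y)) ->
  is_derive (fun s => v (- s) y) x (- vx (- x) y)).
{ intros v vx x y Hv; evar_last.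
  - apply (is_derive_comp (fun s => v s y) Ropp); [apply Hv |].
    apply (is_derive_opp (V := R_NormedModule) (fun s => s)), (is_derive_id (K := R_AbsRing)).
  - unfold scal, one, opp; simpl; unfold mult; simpl; ring. }
constructor; auto.
- intros x y Hy; replace (uxx (- x) y) with (- - uxx (- x) y) by ring.
  apply (is_derive_opp (V := R_NormedModule) (fun s => ux (- s) y)), Hd; auto.
- intros x y Hy; apply (is_derive_opp (V := R_NormedModule) (fun t => ux (- x) t)); auto.
Qed.

Section Induction.

Variables (H : R) (f : R -> R).
Hypothesis f_cont : continuous_on (fun t => 0 <= t) f.
Hypothesis osg : osgood_everywhere f.
Hypothesis osg0 : f 0 = 0 -> one_sided_osgood f 0.
Hypothesis lip : locally_lipschitz_from_above f.
Hypothesis H_pos : 0 < H.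

(** Violations with m_n -> 0 have a limit (s0, y0) with y0 <= s0 <= lam. If y0 < s0, the limit
    contradicts the strict vertical comparison, or positivity of [u] when y0 = 0. If y0 = s0, the
    inequality degenerates and a derivative takes its place. *)
Lemma left_side_extend (u ux uy uxx uxy uyy : R -> R -> R) (lam : R) :
  c2_solution (half_open H) H f u ux uy uxx uxy uyy ->
  0 <= lam -> 2 * lam < H -> (forall s, 0 < s <= lam -> reflect_le u s) ->
  exists delta, 0 < delta /\ 2 * (lam + delta) < H /\ forall s m y,
    0 < s <= lam + delta -> 0 < m <= delta -> 0 <= y < s ->
    u 0 y <= u (rx m s 0 y) (ry m s 0 y).
Proof.
intros sol Hlam HlamH Hrefl; apply NNPP; intros Hno.
set (eta := (H - 2 * lam) / 4).
assert (Heta : 0 < eta) by (unfold eta; lra).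
assert (Hen : forall n, 0 < eta * / (INR n + 1) <= eta).
{ intros n; apply scaled_inv_nat; lra. }
assert (Hel : is_lim_seq (fun n => eta * / (INR n + 1)) 0).
{ apply scaled_inv_lim. }
destruct (choose_fun (R * R * R) (fun n p => let '(s, m, y) := p in
  0 < s <= lam + eta * / (INR n + 1) /\ 0 < m <= eta * / (INR n + 1) /\ 0 <= y < s /\
  u (rx m s 0 y) (ry m s 0 y) < u 0 y)) as [p Hp].
{ intros n; apply NNPP; intros Hc; apply Hno; exists (eta * / (INR n + 1)).
  specialize (Hen n); split; [lra |]; split; [unfold eta in *; lra |].
  intros s m y Hs Hm Hy; apply Rnot_lt_le; intros Hlt; apply Hc; exists (s, m, y); auto. }
set (sn := fun n => fst (fst (p n))); set (mn := fun n => snd (fst (p n))); set (yn := fun n => snd (p n)).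
assert (Hn : forall n, 0 < sn n <= lam + eta * / (INR n + 1) /\ 0 < mn n <= eta * / (INR n + 1) /\
  0 <= yn n < sn n /\ u (rx (mn n) (sn n) 0 (yn n)) (ry (mn n) (sn n) 0 (yn n)) < u 0 (yn n)).
{ intros n; specialize (Hp n); unfold sn, mn, yn; destruct (p n) as [[s m] y]; exact Hp. }
clearbody sn mn yn; clear Hp p Hno.
assert (Hml : is_lim_seq mn 0).
{ apply (is_lim_seq_le_le (fun _ => 0) mn (fun n => eta * / (INR n + 1))); [| apply is_lim_seq_const | exact Hel].
  intros n; specialize (Hn n); lra. }
destruct (bolzano_weierstrass_2d sn yn (lam + eta)) as [phi [s0 [y0 [Hphi [Hs Hy]]]]].
{ intros n; specialize (Hn n); specialize (Hen n); rewrite !Rabs_pos_eq; lra. }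
assert (Hm := lim_subseq _ _ phi Hphi Hml).
assert (Hs0 : s0 <= lam).
{ apply (lim_le (fun n => sn (phi n)) (fun n => lam + eta * / (INR (phi n) + 1))); [intros n; apply Hn | exact Hs |].
  replace (Finite lam) with (Finite (lam + 0)) by (f_equal; ring).
  apply is_lim_seq_plus'; [apply is_lim_seq_const | exact (lim_subseq _ _ phi Hphi Hel)]. }
assert (Hy0 : 0 <= y0).
{ apply (lim_le (fun _ => 0) (fun n => yn (phi n))); [intros n; apply Hn | apply is_lim_seq_const | exact Hy]. }
assert (Hys0 : y0 <= s0).
{ apply (lim_le (fun n => yn (phi n)) (fun n => sn (phi n))); [| exact Hy | exact Hs].
  intros n; destruct (Hn (phi n)) as [_ [_ [? _]]]; lra. }
assert (Hr0 : rx 0 s0 0 y0 = 0 /\ ry 0 s0 0 y0 = 2 * s0 - y0) by (unfold rx, ry; split; field).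
assert (Hrx := rx_lim _ _ (fun _ => 0) _ _ _ _ _ Hm Hs (is_lim_seq_const 0) Hy).
assert (Hry := ry_lim _ _ (fun _ => 0) _ _ _ _ _ Hm Hs (is_lim_seq_const 0) Hy).
rewrite (proj1 Hr0) in Hrx; rewrite (proj2 Hr0) in Hry.
assert (Hrange : forall n, yn n < ry (mn n) (sn n) 0 (yn n) <= 2 * sn n /\ 2 * sn n < H).
{ intros n; specialize (Hn n); specialize (Hen n).
  assert (HT : triangle (mn n) (sn n) 0 (yn n)) by (unfold triangle; lra).
  pose proof (ry_range (mn n) (sn n) 0 (yn n) ltac:(lra) HT).
  pose proof (gap_pos (mn n) (sn n) 0 (yn n) ltac:(lra)).
  split; [unfold ry in *; lra | unfold eta in *; lra]. }
assert (Hinr : forall n, half_open H (rx (mn n) (sn n) 0 (yn n)) (ry (mn n) (sn n) 0 (yn n))).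
{ intros n; specialize (Hrange n); specialize (Hn n); unfold half_open; lra. }
destruct (Rle_lt_or_eq_dec _ _ Hys0) as [Hlt|Heq].
- assert (Hge : u 0 (2 * s0 - y0) <= u 0 y0).
  { apply (lim_le (fun n => u (rx (mn (phi n)) (sn (phi n)) 0 (yn (phi n))) (ry (mn (phi n)) (sn (phi n)) 0 (yn (phi n))))
      (fun n => u 0 (yn (phi n)))); [intros n; apply Rlt_le, Hn | |].
    - apply (sol_u sol); auto; unfold half_open; lra.
    - apply (sol_u sol); auto; [| unfold half_open; lra | apply is_lim_seq_const].
      intros n; specialize (Hrange (phi n)); specialize (Hn (phi n)); unfold half_open; lra. }
  destruct Hy0 as [Hy0|Hy0].
  + pose proof (reflect_lt sol s0 0 y0 osg ltac:(lra) ltac:(lra)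
      (Hrefl s0 ltac:(lra)) ltac:(lra)); lra.
  + rewrite <- Hy0, (sol_zero sol), Rminus_0_r in Hge.
    pose proof (sol_pos sol 0 (2 * s0) ltac:(lra)); lra.
(* The points and their mirror images merge. On the segment from (0, y) to its image (m k, y + k),
   with k the gap, the mean value theorem turns the violation into a negative derivative along (m,
   1). *)
- assert (Hq : forall n, exists q : R * R, 0 <= fst q <= rx (mn n) (sn n) 0 (yn n) /\
    yn n <= snd q <= ry (mn n) (sn n) 0 (yn n) /\ 0 < snd q < H /\
    uy (fst q) (snd q) + mn n * ux (fst q) (snd q) < 0).
  { intros n; specialize (Hn n); specialize (Hrange n); specialize (Hinr n).
    set (s := sn n) in *; set (m := mn n) in *; set (y := yn n) in *.
    assert (Hyp : 0 < y).
    { destruct (proj1 (proj1 (proj2 (proj2 Hn)))) as [|Hy00]; [assumption |]; exfalso.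
      assert (Hu0 : u 0 y = 0) by (rewrite <- Hy00; apply (sol_zero sol)).
      pose proof (sol_pos sol (rx m s 0 y) (ry m s 0 y) ltac:(lra)); lra. }
    assert (Hkp := gap_pos m s 0 y ltac:(lra)).
    unfold rx, ry in *; rewrite Rplus_0_l in *.
    set (k := 2 * (s - m * 0 - y) / (1 + m ^ 2)) in *.
    assert (Hseg : forall t, 0 <= t <= 1 -> 0 <= t * k <= k).
    { intros t Ht; split; [apply Rmult_le_pos; lra |].
      rewrite <- (Rmult_1_l k) at 2; apply Rmult_le_compat_r; lra. }
    destruct (mvt_le (fun t => u (0 + t * (m * k)) (y + t * k))
      (fun t => ux (0 + t * (m * k)) (y + t * k) * (m * k) + uy (0 + t * (m * k)) (y + t * k) * k) 0 1)
      as [c [Hc Hmv]]; [lra | |].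
    - intros t Ht; apply derive_along, (sol_differentiable sol).
      specialize (Hseg t Ht); lra.
    - simpl in Hmv; rewrite !Rmult_0_l, !Rmult_1_l, !Rplus_0_l, !Rplus_0_r in Hmv.
      specialize (Hseg c Hc).
      exists (c * (m * k), y + c * k); simpl.
      replace (c * (m * k)) with (m * (c * k)) in * by ring.
      split; [split; [apply Rmult_le_pos; lra | apply Rmult_le_compat_l; lra] |].
      split; [lra |]; split; [lra |].
      apply (Rmult_lt_reg_r k); [exact Hkp |]; lra. }
  destruct (choose_fun (R * R) _ Hq) as [q Hqn]; clear Hq.
  assert (Hq1 : is_lim_seq (fun n => fst (q (phi n))) 0).
  { apply (is_lim_seq_le_le (fun _ => 0) _ (fun n => rx (mn (phi n)) (sn (phi n)) 0 (yn (phi n))));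
    [intros n; apply Hqn | apply is_lim_seq_const | exact Hrx]. }
  assert (Hq2 : is_lim_seq (fun n => snd (q (phi n))) s0).
  { apply (is_lim_seq_le_le (fun n => yn (phi n)) _ (fun n => ry (mn (phi n)) (sn (phi n)) 0 (yn (phi n))));
    [intros n; apply Hqn | rewrite <- Heq; exact Hy |].
    replace s0 with (2 * s0 - y0) by lra; exact Hry. }
  destruct (Rle_lt_or_eq_dec 0 s0 ltac:(lra)) as [Hsp|Hsz].
  + assert (Hle : uy 0 s0 + 0 * ux 0 s0 <= 0).
    { assert (Hin : half_open H 0 s0) by (unfold half_open; lra).
      assert (Hqin : forall n, half_open H (fst (q (phi n))) (snd (q (phi n))))
        by (intros n; destruct (Hqn (phi n)) as [_ [_ [? _]]]; unfold half_open; lra).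
      apply (lim_le (fun n => uy (fst (q (phi n))) (snd (q (phi n))) + mn (phi n) * ux (fst (q (phi n))) (snd (q (phi n))))
        (fun _ => 0)); [intros n; apply Rlt_le, Hqn | | apply is_lim_seq_const].
      apply is_lim_seq_plus'; [apply (sol_uy sol); auto |].
      apply is_lim_seq_mul; [exact Hm | apply (sol_ux sol); auto]. }
    pose proof (reflect_slope sol s0 0 osg Hsp ltac:(lra) (Hrefl s0 ltac:(lra))); lra.
  (* With s0 = 0 the points shrink to the corner; for lam = 0 this is the only case, so it also
     starts the induction. *)
  + destruct (bottom_cone sol H_pos 0 f_cont osg0) as [e [He Hcone]].
    destruct (proj1 (lim_seq_eps _ _) Hm e He) as [N1 HN1].
    destruct (proj1 (lim_seq_eps _ _) Hq1 e He) as [N2 HN2].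
    destruct (proj1 (lim_seq_eps _ _) Hq2 e He) as [N3 HN3].
    set (n := max N1 (max N2 N3)).
    specialize (HN1 n ltac:(lia)); specialize (HN2 n ltac:(lia)); specialize (HN3 n ltac:(lia)).
    destruct (Hqn (phi n)) as [_ [_ [Hqp Hqneg]]].
    rewrite <- Hsz, Rminus_0_r, Rabs_pos_eq in HN3 by lra; rewrite Rminus_0_r in HN1.
    specialize (Hcone (mn (phi n)) (fst (q (phi n))) (snd (q (phi n))) ltac:(lra) HN2 ltac:(lra)); lra.
Qed.

Lemma reflect_le_right (u ux uy uxx uxy uyy : R -> R -> R) (smax delta s x y : R) :
  c2_solution (half_open H) H f u ux uy uxx uxy uyy ->
  2 * smax < H -> 0 < delta ->
  (forall s m y, 0 < s <= smax -> 0 < m <= delta -> 0 <= y < s ->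
    u 0 y <= u (rx m s 0 y) (ry m s 0 y)) ->
  0 < s <= smax -> 0 <= x -> 0 <= y <= s -> u x y <= u x (2 * s - y).
Proof.
intros sol Hsm Hd Hside Hs Hx Hy.
destruct (Req_dec y s) as [->|Hne]; [replace (2 * s - s) with s by ring; lra |].
(* m x <= s - y puts (x, y) in the triangle of every smaller slope; x + 1 avoids a division by
   zero. *)
set (m := Rmin delta ((s - y) / (x + 1))).
assert (Hsy : 0 < (s - y) / (x + 1)) by (apply Rdiv_lt_0_compat; lra).
assert (Hm : 0 < m) by (apply Rmin_glb_lt; lra).
assert (Hmx : m * x <= s - y).
{ apply Rle_trans with ((s - y) / (x + 1) * (x + 1)); [| right; field; lra].
  apply Rmult_le_compat; try lra; apply Rmin_r. }
assert (Hmd : m <= delta) by apply Rmin_l.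
set (mn := fun n : nat => m * / (INR n + 1)).
assert (Hmn : forall n, 0 < mn n <= m).
{ intros n; apply scaled_inv_nat; lra. }
assert (HT : forall n, triangle (mn n) s x y).
{ intros n; specialize (Hmn n); assert (mn n * x <= m * x) by (apply Rmult_le_compat_r; lra).
  unfold triangle; lra. }
assert (Hml : is_lim_seq mn 0).
{ apply scaled_inv_lim. }
apply (lim_le (fun _ => u x y) (fun n => u (rx (mn n) s x y) (ry (mn n) s x y)));
  [| apply is_lim_seq_const |].
- intros n; specialize (Hmn n).
  apply (sliding H f u ux uy uxx uxy uyy (mn n) smax sol osg lip); auto; try lra.
  intros; apply Hside; lra.
- replace (2 * s - y) with (ry 0 s x y) by (unfold ry; field).
  replace (u x (ry 0 s x y)) with (u (rx 0 s x y) (ry 0 s x y)) by (f_equal; unfold rx; field).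
  apply (sol_u sol).
  + intros n; specialize (Hmn n); pose proof (ry_range (mn n) s x y ltac:(lra) (HT n)); unfold half_open; lra.
  + assert (HT0 : triangle 0 s x y) by (unfold triangle; lra).
    pose proof (ry_range 0 s x y ltac:(lra) HT0); unfold half_open; lra.
  + apply (rx_lim mn (fun _ => s) (fun _ => x) (fun _ => y)); auto; apply is_lim_seq_const.
  + apply (ry_lim mn (fun _ => s) (fun _ => x) (fun _ => y)); auto; apply is_lim_seq_const.
Qed.

Lemma reflect_le_extend (u ux uy uxx uxy uyy : R -> R -> R) (lam : R) :
  c2_solution (half_open H) H f u ux uy uxx uxy uyy ->
  0 <= lam -> 2 * lam < H -> (forall s, 0 < s <= lam -> reflect_le u s) ->
  exists delta, 0 < delta /\ 2 * (lam + delta) < H /\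
    forall s, 0 < s <= lam + delta -> reflect_le u s.
Proof.
intros sol Hlam HlamH Hrefl.
destruct (left_side_extend _ _ _ _ _ _ lam sol Hlam HlamH Hrefl) as [d1 [Hd1 [Hd1H H1]]].
assert (solm := solution_mirror _ _ _ _ _ _ _ _ sol).
destruct (left_side_extend _ _ _ _ _ _ lam solm Hlam HlamH) as [d2 [Hd2 [Hd2H H2]]].
{ intros s Hs x y Hy; apply Hrefl; auto. }
exists (Rmin d1 d2); pose proof (Rmin_l d1 d2); pose proof (Rmin_r d1 d2).
split; [now apply Rmin_glb_lt |]; split; [lra |].
intros s Hs x y Hy; destruct (Rle_lt_dec 0 x).
- apply (reflect_le_right _ _ _ _ _ _ (lam + d1) d1 s x y sol); auto; lra.
- pose proof (reflect_le_right _ _ _ _ _ _ (lam + d2) d2 s (- x) y solm) as HR; cbv beta in HR.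
  rewrite !Ropp_involutive in HR; apply HR; auto; lra.
Qed.

(** Continuation from the vacuous level 0: the supremum l of the admissible levels is itself
    admissible by continuity of [u], and if l <= s then 2 l < H and [reflect_le_extend] goes beyond
    it. *)
Lemma reflect_le_all (u ux uy uxx uxy uyy : R -> R -> R) (s : R) :
  c2_solution (half_open H) H f u ux uy uxx uxy uyy ->
  0 < s -> 2 * s < H -> reflect_le u s.
Proof.
intros sol Hs HsH.
destruct (completeness (fun l => 0 <= l /\ 2 * l < H /\ forall s, 0 < s <= l -> reflect_le u s)) as [l [Hub Hlub]].
{ exists H; intros t [Ht [Ht' _]]; lra. }
{ exists 0; split; [lra |]; split; [lra |]; intros; lra. }
assert (Hl0 : 0 <= l) by (apply Hub; split; [lra |]; split; [lra |]; intros; lra).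
assert (Hlt : forall t, 0 < t < l -> reflect_le u t).
{ intros t Ht; apply NNPP; intros Hno; assert (l <= t); [| lra].
  apply Hlub; intros r [Hr [HrH Hr']]; apply Rnot_lt_le; intros Hlt; apply Hno, Hr'; lra. }
destruct (Rle_lt_dec l s) as [Hls|Hls]; [exfalso | apply Hlt; lra].
assert (Hle : forall t, 0 < t <= l -> reflect_le u t).
{ intros t Ht; destruct (Req_dec t l) as [->|]; [| apply Hlt; lra].
  intros x y Hy; destruct (Req_dec y l) as [->|Hne]; [replace (2 * l - l) with l by ring; lra |].
  set (t := fun n : nat => l - (l - y) / 2 * / (INR n + 1)).
  assert (Ht' : forall n, y < t n < l).
  { intros n; unfold t; pose proof (scaled_inv_nat ((l - y) / 2) n ltac:(lra)); lra. }
  assert (Htl : is_lim_seq t l).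
  { replace (Finite l) with (Finite (l - (l - y) / 2 * 0)) by (f_equal; ring).
    apply is_lim_seq_minus'; [apply is_lim_seq_const |].
    apply is_lim_seq_mul; [apply is_lim_seq_const | apply inv_nat_lim]. }
  apply (lim_le (fun _ => u x y) (fun n => u x (2 * t n - y))); [| apply is_lim_seq_const |].
  - intros n; specialize (Ht' n); apply Hlt; lra.
  - apply (sol_u sol); [| unfold half_open; lra | apply is_lim_seq_const |].
    + intros n; specialize (Ht' n); unfold half_open; lra.
    + apply is_lim_seq_minus'; [| apply is_lim_seq_const].
      apply is_lim_seq_mul; [apply is_lim_seq_const | exact Htl]. }
destruct (reflect_le_extend _ _ _ _ _ _ l sol Hl0 ltac:(lra) Hle) as [d [Hd [HdH Hd']]].
assert (l + d <= l); [apply Hub; split; [lra |]; split; [lra | exact Hd'] | lra].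
Qed.

Lemma slope_pos (u ux uy uxx uxy uyy : R -> R -> R) (x y : R) :
  c2_solution (half_open H) H f u ux uy uxx uxy uyy ->
  0 < y -> 2 * y < H -> 0 < uy x y.
Proof.
intros sol Hy HyH; apply (reflect_slope sol); auto.
apply (reflect_le_all _ _ _ _ _ _ y sol); auto.
Qed.

(** The level H / 2 is approached from below, [reflect_le_all] stopping short of it; [u] is
    continuous at (x, H - y) because y > 0 keeps this point off the upper edge. *)
Lemma reflect_le_middle (u ux uy uxx uxy uyy : R -> R -> R) (x y : R) :
  c2_solution (half_open H) H f u ux uy uxx uxy uyy ->
  0 < y -> 2 * y <= H -> u x y <= u x (H - y).
Proof.
intros sol Hy HyH.
destruct (Req_dec (2 * y) H) as [He|Hne]; [replace (H - y) with y by lra; lra |].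
set (t := fun n : nat => H / 2 - (H / 2 - y) / 2 * / (INR n + 1)).
assert (Ht' : forall n, y < t n < H / 2).
{ intros n; unfold t; pose proof (scaled_inv_nat ((H / 2 - y) / 2) n ltac:(lra)); lra. }
apply (lim_le (fun _ => u x y) (fun n => u x (2 * t n - y))); [| apply is_lim_seq_const |].
- intros n; specialize (Ht' n); apply (reflect_le_all _ _ _ _ _ _ (t n) sol); lra.
- apply (sol_u sol); [| unfold half_open; lra | apply is_lim_seq_const |].
  + intros n; specialize (Ht' n); unfold half_open; lra.
  + replace (Finite (H - y)) with (Finite (2 * (H / 2 - (H / 2 - y) / 2 * 0) - y)) by (f_equal; field).
    apply is_lim_seq_minus'; [| apply is_lim_seq_const].
    apply is_lim_seq_mul; [apply is_lim_seq_const |].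
    apply is_lim_seq_minus'; [apply is_lim_seq_const |].
    apply is_lim_seq_mul; [apply is_lim_seq_const | apply inv_nat_lim].
Qed.

End Induction.

(** * From the C2 hypotheses to boundary values of the derivatives *)

Definition closed_strip (c x y : R) : Prop := 0 <= y <= c.

Lemma seqcont_of_continuous_on (c : R) (w : R * R -> R) :
  0 < c -> continuous_on (closure (strip c)) w ->
  seqcont (closed_strip c) (fun x y => w (x, y)).
Proof.
intros Hc Hw xn yn x y Hn Hxy Hx Hy P HP.
destruct (Hw (x, y) ltac:(apply closure_strip; auto) P HP) as [eps Heps].
destruct (proj1 (lim_seq_eps _ _) Hx eps (cond_pos eps)) as [N1 HN1].
destruct (proj1 (lim_seq_eps _ _) Hy eps (cond_pos eps)) as [N2 HN2].
exists (max N1 N2); intros n Hnn; apply Heps.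
- split; [apply HN1 | apply HN2]; lia.
- apply closure_strip; auto; apply Hn.
Qed.

(** Both values are the limit of [d] along the vertical through x. *)
Lemma extension_unique_bottom (c c' : R) (d w w' : R -> R -> R) (x : R) :
  0 < c -> 0 < c' -> seqcont (closed_strip c) w -> seqcont (closed_strip c') w' ->
  (forall x y, 0 < y < c -> w x y = d x y) -> (forall x y, 0 < y < c' -> w' x y = d x y) ->
  w x 0 = w' x 0.
Proof.
intros Hc Hc' Hw Hw' Hd Hd'.
set (a := Rmin c c' / 2).
assert (Ha : 0 < a /\ a < c /\ a < c').
{ unfold a; pose proof (Rmin_l c c'); pose proof (Rmin_r c c').
  assert (0 < Rmin c c') by (now apply Rmin_glb_lt); lra. }
set (y := fun n : nat => a * / (INR n + 1)).
assert (Hy : forall n, 0 < y n <= a).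
{ intros n; apply scaled_inv_nat; lra. }
assert (Hl : is_lim_seq y 0).
{ apply scaled_inv_lim. }
assert (H1 : is_lim_seq (fun n => d x (y n)) (w x 0)).
{ apply (is_lim_seq_ext (fun n => w x (y n))); [intros n; apply Hd; specialize (Hy n); lra |].
  apply Hw; [| unfold closed_strip; lra | apply is_lim_seq_const | exact Hl].
  intros n; specialize (Hy n); unfold closed_strip; lra. }
assert (H2 : is_lim_seq (fun n => d x (y n)) (w' x 0)).
{ apply (is_lim_seq_ext (fun n => w' x (y n))); [intros n; apply Hd'; specialize (Hy n); lra |].
  apply Hw'; [| unfold closed_strip; lra | apply is_lim_seq_const | exact Hl].
  intros n; specialize (Hy n); unfold closed_strip; lra. }
apply is_lim_seq_unique in H1, H2; rewrite H1 in H2; injection H2; auto.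
Qed.

(** Each c comes with its own extension, and these must be glued: above the edge every one of them
    is [d], and on the edge they agree by [extension_unique_bottom], so the one for H / 2 can be
    used there. *)
Lemma extension_half_open (H : R) (d : R -> R -> R) :
  0 < H ->
  (forall c, 0 < c < H -> exists w, seqcont (closed_strip c) w /\
     forall x y, 0 < y < c -> w x y = d x y) ->
  exists W, seqcont (half_open H) W /\ forall x y, 0 < y < H -> W x y = d x y.
Proof.
intros HH Hex.
destruct (Hex (H / 2) ltac:(lra)) as [w0 [Hw0 Hd0]].
exists (fun x y => if Rlt_dec 0 y then d x y else w0 x y); split.
- intros xn yn x y Hn Hxy Hx Hy.
  assert (Hc : exists c, y < c < H) by (exists ((y + H) / 2); unfold half_open in Hxy; lra).
  destruct Hc as [c Hc].
  destruct (Hex c ltac:(unfold half_open in Hxy; lra)) as [w [Hw Hd]].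
  assert (Heq : forall x y, 0 <= y < c -> (if Rlt_dec 0 y then d x y else w0 x y) = w x y).
  { intros a b Hb; destruct (Rlt_dec 0 b); [symmetry; apply Hd; lra |].
    replace b with 0 by lra.
    apply (extension_unique_bottom (H / 2) c d); auto; lra. }
  rewrite Heq by (unfold half_open in Hxy; lra).
  (* The truncation by [c] keeps the whole sequence in the closed strip where [w] is continuous; it
     is inactive from some rank on. *)
  apply (is_lim_seq_ext_loc (fun n => w (xn n) (Rmin (yn n) c))).
  + destruct (proj1 (lim_seq_eps _ _) Hy (c - y) ltac:(lra)) as [N HN]; exists N; intros m Hm.
    specialize (HN m Hm); apply Rabs_def2 in HN; specialize (Hn m); unfold half_open in Hn.
    rewrite Heq, Rmin_left by lra; reflexivity.
  + apply Hw; [| unfold half_open, closed_strip in *; lra | exact Hx |].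
    * intros n; specialize (Hn n); unfold half_open, closed_strip in *.
      split; [apply Rmin_glb; unfold half_open in Hxy; lra | apply Rmin_r].
    * apply lim_seq_eps; intros eps He.
      destruct (proj1 (lim_seq_eps _ _) Hy eps He) as [N HN]; exists N; intros m Hm.
      specialize (HN m Hm); unfold Rmin; destruct (Rle_dec (yn m) c); [exact HN |].
      apply Rabs_def2 in HN; apply Rabs_def1; lra.
- intros x y Hy; destruct (Rlt_dec 0 y); [reflexivity | lra].
Qed.

Lemma solution_of_extensions (S : R -> R -> Prop) (H : R) (f : R -> R)
  (u w10 w01 w20 w11 w02 : R -> R -> R) :
  (forall x y, 0 < y < H -> ex_diff_n u 2 x y) ->
  seqcont S u -> seqcont S w10 -> seqcont S w01 -> seqcont S w20 -> seqcont S w11 -> seqcont S w02 ->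
  (forall x y, 0 < y < H -> w10 x y = partial_derive 1 0 u x y) ->
  (forall x y, 0 < y < H -> w01 x y = partial_derive 0 1 u x y) ->
  (forall x y, 0 < y < H -> w20 x y = partial_derive 2 0 u x y) ->
  (forall x y, 0 < y < H -> w11 x y = partial_derive 1 1 u x y) ->
  (forall x y, 0 < y < H -> w02 x y = partial_derive 0 2 u x y) ->
  (forall x y, strip H (x, y) -> - laplacian u x y = f (u x y)) ->
  (forall x y, strip H (x, y) -> 0 < u x y) ->
  (forall x, u x 0 = 0) ->
  c2_solution S H f u w10 w01 w20 w11 w02.
Proof.
intros Hdiff Cu C10 C01 C20 C11 C02 E10 E01 E20 E11 E02 Heq Hpos Hzero.
assert (Hvert : forall (v w : R -> R -> R) x y l, (forall x y, 0 < y < H -> v x y = w x y) -> 0 < y < H ->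
  is_derive (fun t => w x t) y l -> is_derive (fun t => v x t) y l).
{ intros v w x y l Hvw Hy Hd; apply (is_derive_ext_loc (fun t => w x t)); [| exact Hd].
  destruct (box_strip H y Hy) as [r [Hr Hbox]].
  exists (mkposreal r Hr); intros t Ht; symmetry; apply Hvw, Hbox, Ht. }
assert (Hhor : forall (v w : R -> R -> R) x y l, (forall x y, 0 < y < H -> v x y = w x y) -> 0 < y < H ->
  is_derive (fun s => w s y) x l -> is_derive (fun s => v s y) x l).
{ intros v w x y l Hvw Hy Hd; apply (is_derive_ext (fun s => w s y)); [| exact Hd].
  intros t; symmetry; apply Hvw, Hy. }
constructor; auto.
- intros x y Hy; rewrite E10 by exact Hy; destruct (Hdiff x y Hy) as [_ [D _]].
  exact (Derive_correct _ _ D).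
- intros x y Hy; rewrite E01 by exact Hy; destruct (Hdiff x y Hy) as [_ [_ [D _]]].
  exact (Derive_correct _ _ D).
- intros x y Hy; rewrite E20 by exact Hy; apply (Hhor w10 (partial_derive 1 0 u)); auto.
  destruct (Hdiff x y Hy) as [_ [_ [_ [[_ [D _]] _]]]]; exact (Derive_correct _ _ D).
- intros x y Hy; rewrite E11 by exact Hy; apply (Hvert w10 (partial_derive 1 0 u)); auto.
  destruct (Hdiff x y Hy) as [_ [_ [_ [[_ [_ [D [_ Cyx]]]] [_ [_ [_ [Cxy _]]]]]]]].
  (* [partial_derive 1 1] differentiates in y first, whereas the derivative of [ux] in y is wanted;
     [ex_diff_n] contains the continuity of both mixed derivatives that Schwarz's theorem uses. *)
  change (partial_derive 1 1 u x y) with (Derive (fun z => Derive (fun t => u z t) y) x).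
  rewrite Schwarz; [exact (Derive_correct _ _ D) | | exact (proj1 Cxy) | exact (proj1 Cyx)].
  destruct (box_strip H y Hy) as [r [Hr Hbox]].
  exists (mkposreal r Hr); intros a b _ Hb.
  destruct (Hdiff a b (Hbox b Hb)) as [_ [D1 [D2 [[_ [_ [D4 _]]] [_ [D3 _]]]]]]; auto.
- intros x y Hy; rewrite E11 by exact Hy; apply (Hhor w01 (partial_derive 0 1 u)); auto.
  destruct (Hdiff x y Hy) as [_ [_ [_ [_ [_ [D _]]]]]]; exact (Derive_correct _ _ D).
- intros x y Hy; rewrite E02 by exact Hy; apply (Hvert w01 (partial_derive 0 1 u)); auto.
  destruct (Hdiff x y Hy) as [_ [_ [_ [_ [_ [_ [D _]]]]]]]; exact (Derive_correct _ _ D).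
- intros x y Hy; rewrite E20, E02 by exact Hy; apply Heq; exact Hy.
Qed.

Lemma solution_half_open (H : R) (f : R -> R) (u : R -> R -> R) :
  0 < H ->
  (forall c, 0 < c < H -> C2_closure (strip c) u) ->
  (forall x y, strip H (x, y) -> - laplacian u x y = f (u x y)) ->
  (forall x y, strip H (x, y) -> 0 < u x y) ->
  (forall x, u x 0 = 0) ->
  exists ux uy uxx uxy uyy, c2_solution (half_open H) H f u ux uy uxx uxy uyy /\
    forall x y, 0 < y < H -> uy x y = partial_derive 0 1 u x y.
Proof.
intros HH HC Heq Hpos Hzero.
assert (Hext : forall m k, (m + k <= 2)%nat -> exists W, seqcont (half_open H) W /\
  forall x y, 0 < y < H -> W x y = partial_derive m k u x y).
{ intros m k Hmk; apply extension_half_open; [exact HH |]; intros c Hc.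
  destruct (HC c Hc) as [_ [_ Hw]]; destruct (Hw m k Hmk) as [w [Hw1 Hw2]].
  exists (fun x y => w (x, y)); split; [apply seqcont_of_continuous_on; [lra | exact Hw1] |].
  intros x y Hy; apply Hw2; exact Hy. }
destruct (Hext 1%nat 0%nat ltac:(lia)) as [w10 [C10 E10]].
destruct (Hext 0%nat 1%nat ltac:(lia)) as [w01 [C01 E01]].
destruct (Hext 2%nat 0%nat ltac:(lia)) as [w20 [C20 E20]].
destruct (Hext 1%nat 1%nat ltac:(lia)) as [w11 [C11 E11]].
destruct (Hext 0%nat 2%nat ltac:(lia)) as [w02 [C02 E02]].
exists w10, w01, w20, w11, w02; split; [| exact E01].
assert (Hmid : forall y, y < H -> exists c, y < c < H) by (intros y Hy; exists ((y + H) / 2); lra).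
apply solution_of_extensions; auto.
- intros x y Hy; destruct (Hmid y ltac:(lra)) as [c Hc]; apply (HC c); [lra | unfold strip; simpl; lra].
- apply eps_seqcont; intros x y Hxy eps He; unfold half_open in Hxy.
  destruct (Hmid y ltac:(lra)) as [c Hc]; destruct (HC c ltac:(lra)) as [_ [Cu _]].
  apply seqcont_of_continuous_on in Cu; [| lra].
  destruct (seqcont_eps _ _ x y Cu ltac:(unfold closed_strip; lra) eps He) as [d [Hd Hd']].
  exists (Rmin d (c - y)); split; [apply Rmin_glb_lt; lra |]; intros x' y' Hxy' Hx' Hy'.
  pose proof (Rmin_l d (c - y)); pose proof (Rmin_r d (c - y)).
  apply (Hd' x' y'); try lra; apply Rabs_def2 in Hy'; unfold half_open, closed_strip in *; lra.
Qed.

(** Regularity up to y = H and u = 0 there enter here: they become the conditions on the bottom edge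
    for the strip turned upside down. *)
Lemma solution_flip (H : R) (f : R -> R) (u ux uy uxx uxy uyy : R -> R -> R) :
  c2_solution (closed_strip H) H f u ux uy uxx uxy uyy -> (forall x, u x H = 0) ->
  c2_solution (half_open H) H f (fun x y => u x (H - y)) (fun x y => ux x (H - y))
    (fun x y => - uy x (H - y)) (fun x y => uxx x (H - y)) (fun x y => - uxy x (H - y))
    (fun x y => uyy x (H - y)).
Proof.
intros [Cu Cux Cuy Cxx Cxy Cyy Dx Dy Dxx Dxy Dyx Dyy Heq Hpos Hzero] HzH.
assert (Hc : forall v, seqcont (closed_strip H) v -> seqcont (half_open H) (fun x y => v x (H - y))).
{ intros v Hv xn yn x y Hn Hxy Hx Hy; unfold half_open in *; apply Hv; auto.
  - intros n; specialize (Hn n); unfold closed_strip; lra.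
  - unfold closed_strip; lra.
  - apply is_lim_seq_minus'; [apply is_lim_seq_const | exact Hy]. }
assert (Hco : forall v, seqcont (closed_strip H) v -> seqcont (half_open H) (fun x y => - v x (H - y))).
{ intros v Hv xn yn x y Hn Hxy Hx Hy; apply (is_lim_seq_opp _ (v x (H - y))), (Hc v Hv); auto. }
assert (Hd : forall (v vy : R -> R -> R) x y, is_derive (fun t => v x t) (H - y) (vy x (H - y)) ->
  is_derive (fun t => v x (H - t)) y (- vy x (H - y))).
{ intros v vy x y Hv; evar_last.
  - apply (is_derive_comp (fun t => v x t) (fun t => H - t)); [exact Hv |].
    auto_derive; [exact I | reflexivity].
  - unfold scal; simpl; unfold mult; simpl; ring. }
constructor; auto.
- intros x y Hy; apply Dx; lra.
- intros x y Hy; apply Hd, Dy; lra.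
- intros x y Hy; apply Dxx; lra.
- intros x y Hy; apply (Hd ux uxy), Dxy; lra.
- intros x y Hy; apply (is_derive_opp (V := R_NormedModule) (fun s => uy s (H - y))), Dyx; lra.
- intros x y Hy; replace (uyy x (H - y)) with (- - uyy x (H - y)) by ring.
  apply (is_derive_opp (V := R_NormedModule) (fun t => uy x (H - t))), Hd, Dyy; lra.
- intros x y Hy; apply Heq; lra.
- intros x y Hy; apply Hpos; lra.
- intros x; rewrite Rminus_0_r; apply HzH.
Qed.

Lemma solution_closed (H : R) (f : R -> R) (u : R -> R -> R) :
  0 < H -> C2_closure (strip H) u ->
  (forall x y, strip H (x, y) -> - laplacian u x y = f (u x y)) ->
  (forall x y, strip H (x, y) -> 0 < u x y) ->
  (forall x, u x 0 = 0) ->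
  exists ux uy uxx uxy uyy, c2_solution (closed_strip H) H f u ux uy uxx uxy uyy.
Proof.
intros HH [Hdiff [Cu Hw]] Heq Hpos Hzero.
assert (Hext : forall m k, (m + k <= 2)%nat -> exists W, seqcont (closed_strip H) W /\
  forall x y, 0 < y < H -> W x y = partial_derive m k u x y).
{ intros m k Hmk; destruct (Hw m k Hmk) as [w [Hw1 Hw2]].
  exists (fun x y => w (x, y)); split; [apply seqcont_of_continuous_on; assumption |].
  intros x y Hy; apply Hw2; exact Hy. }
destruct (Hext 1%nat 0%nat ltac:(lia)) as [w10 [C10 E10]].
destruct (Hext 0%nat 1%nat ltac:(lia)) as [w01 [C01 E01]].
destruct (Hext 2%nat 0%nat ltac:(lia)) as [w20 [C20 E20]].
destruct (Hext 1%nat 1%nat ltac:(lia)) as [w11 [C11 E11]].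
destruct (Hext 0%nat 2%nat ltac:(lia)) as [w02 [C02 E02]].
exists w10, w01, w20, w11, w02; apply solution_of_extensions; auto.
apply (seqcont_of_continuous_on H (fun p => u (fst p) (snd p))); assumption.
Qed.

(** * Positivity of the vertical derivative and symmetry about the middle line *)

Theorem theorem1p3 (b : R) (f : R -> R) (u : R -> R -> R)
  (hb : 0 < b)
  (hC2 : forall c, 0 < c < 2 * b -> C2_closure (strip c) u)
  (heq : forall x y, strip (2 * b) (x, y) -> - laplacian u x y = f (u x y))
  (hpos : forall x y, strip (2 * b) (x, y) -> 0 < u x y)
  (hzero : forall x, u x 0 = 0)
  (hfcont : continuous_on (fun t => 0 <= t) f)
  (hflip : locally_lipschitz_from_above f)
  (hosgood :
     (f 0 = 0 /\ forall tbar, 0 <= tbar -> one_sided_osgood f tbar) \/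
     (f 0 <> 0 /\ forall tbar, 0 < tbar -> one_sided_osgood f tbar)) :
  (forall x y, strip b (x, y) -> 0 < partial_derive 0 1 u x y) /\
  (C2_closure (strip (2 * b)) u ->
   (forall x y, boundary (strip (2 * b)) (x, y) -> u x y = 0) ->
   forall x y, strip (2 * b) (x, y) -> u x y = u x (2 * b - y)).
Proof.
assert (osg : osgood_everywhere f).
{ intros t Ht; destruct hosgood as [[_ Ho]|[_ Ho]]; apply Ho; lra. }
assert (osg0 : f 0 = 0 -> one_sided_osgood f 0).
{ intros Hf0; destruct hosgood as [[_ Ho]|[Hn _]]; [apply Ho; lra | contradiction]. }
assert (HH : 0 < 2 * b) by lra.
destruct (solution_half_open (2 * b) f u HH hC2 heq hpos hzero)
  as [ux [uy [uxx [uxy [uyy [sol Huy]]]]]].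
split.
- intros x y [Hy1 Hy2]; simpl in Hy1, Hy2; rewrite <- Huy by lra.
  apply (slope_pos (2 * b) f hfcont osg osg0 hflip HH u ux uy uxx uxy uyy); [exact sol | |]; lra.
- intros HC Hbd.
  destruct (solution_closed (2 * b) f u HH HC heq hpos hzero) as [vx [vy [vxx [vxy [vyy solc]]]]].
  assert (solf := solution_flip _ _ _ _ _ _ _ _ solc
    (fun x => Hbd x (2 * b) (proj2 (boundary_strip (2 * b) (x, 2 * b) HH) (or_intror eq_refl)))).
  (* [reflect_le_middle] for [u] gives one inequality, and for the flipped solution at the same
     point the reverse one. *)
  assert (Hsym : forall x y, 0 < y <= b -> u x y = u x (2 * b - y)).
  { intros x y Hy; apply Rle_antisym.
    - apply (reflect_le_middle (2 * b) f hfcont osg osg0 hflip HH _ _ _ _ _ _ x y sol); lra.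
    - pose proof (reflect_le_middle (2 * b) f hfcont osg osg0 hflip HH _ _ _ _ _ _ x y solf
        ltac:(lra) ltac:(lra)) as Hr; cbv beta in Hr.
      replace (2 * b - (2 * b - y)) with y in Hr by ring; exact Hr. }
  intros x y [Hy1 Hy2]; simpl in Hy1, Hy2.
  destruct (Rle_lt_dec y b); [apply Hsym; lra |].
  rewrite (Hsym x (2 * b - y)) by lra; f_equal; ring.
Qed.
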